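(* Let $G=G_1\times\cdots\times G_n$ be a product of locally compact $\sigma$-compact groups and let $\Gamma<G$ be an irreducible uniform lattice. Let $\Gamma$ act by isometries on a proper CAT(0) space $X$ without global fixed point (in $X$). Then there is a non-empty closed $\Gamma$-invariant set $\mathcal{C}\subseteq\partial X$ on which the $\Gamma$-action extends continuously to a $G$-action (that is, there is a continuous action $G\times\mathcal{C}\to\mathcal{C}$ whose restriction to $\Gamma$ is the given action of $\Gamma$ on $\mathcal{C}$). Moreover this $G$-action factors through the projection $G\to G_i$ for some $i\in\{1,\ldots,n\}$.
   Context: Locally compact groups are assumed Hausdorff. A lattice is a discrete subgroup $\Gamma<G$ such that $G/\Gamma$ carries a finite $G$-invariant measure; it is uniform if it is cocompact. A lattice $\Gamma$ in $G=G_1\times\cdots\times G_n$ is irreducible if the projection of $\Gamma$ to each factor $G_i$ is dense in $G_i$. A metric space is proper if its closed balls are compact. $\partial X$ is the boundary at infinity of $X$ (equivalence classes of asymptotic geodesic rays), endowed with the cone topology; isometries of $X$ act on it by homeomorphisms. *)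

(* Defs.v *)
From HB Require Import structures.
From mathcomp Require Import all_boot all_order all_algebra.
From mathcomp Require Import all_classical all_reals all_analysis.

Set Implicit Arguments.
Unset Strict Implicit.
Unset Printing Implicit Defensive.

Import Order.TTheory GRing.Theory Num.Theory.

Local Open Scope classical_set_scope.
Local Open Scope ring_scope.
Local Open Scope quotient_scope.

HB.structure Definition PreTopologicalGroup :=
  {G of Topological G & Group G}.

HB.mixin Record PreTopologicalGroup_isTopologicalGroup G
    & PreTopologicalGroup G := {
  mulg_continuous : continuous (fun p : G * G => (p.1 * p.2)%g) ;
  invg_continuous : continuous (fun g : G => (g^-1)%g) ;
}.

#[short(type="topologicalGroupType")]
HB.structure Definition TopologicalGroup :=
  {G of PreTopologicalGroup G & PreTopologicalGroup_isTopologicalGroup G}.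

Definition prod_group (I : Type) (G : I -> Type) : Type := forall i, G i.

Section ProdGroup.
Variables (I : eqType) (G : I -> topologicalGroupType).

HB.instance Definition _ := Topological.copy (prod_group G) (prod_topology G).

Let one : prod_group G := fun i => 1%g.
Let inv (g : prod_group G) : prod_group G := fun i => (g i)^-1%g.
Let mul (g h : prod_group G) : prod_group G := fun i => (g i * h i)%g.

Let mulA : associative mul.
Proof. by move=> f g h; apply: functional_extensionality_dep => i; exact: mulgA. Qed.
Let mul1 : left_id one mul.
Proof. by move=> f; apply: functional_extensionality_dep => i; exact: mul1g. Qed.
Let mul1r : right_id one mul.
Proof. by move=> f; apply: functional_extensionality_dep => i; exact: mulg1. Qed.
Let mulV : left_inverse one inv mul.
Proof. by move=> f; apply: functional_extensionality_dep => i; exact: mulVg. Qed.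
Let mulVr : right_inverse one inv mul.
Proof. by move=> f; apply: functional_extensionality_dep => i; exact: mulgV. Qed.

HB.instance Definition _ :=
  isGroup.Build (prod_group G) mulA mul1 mul1r mulV mulVr.

Let proj_cts (i : I) : continuous (fun g : prod_group G => g i).
Proof. exact: (@proj_continuous I G i). Qed.

Let prod_cts (T : topologicalType) (f : T -> prod_group G) :
  (forall i, continuous (fun t => f t i)) -> continuous f.
Proof.
move=> cf x; apply/cvg_sup => i.
exact: (@continuous_comp_initial (prod_group G) T (G i) (fun g => g i) f (cf i)).
Qed.

Let mulg_cts : continuous (fun p : prod_group G * prod_group G => (p.1 * p.2)%g).
Proof.
apply: prod_cts => i p.
have cp : continuous_at p (fun q : prod_group G * prod_group G => (q.1 i, q.2 i)).
  apply: cvg_pair.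
    by apply: (@continuous_comp _ _ _ fst (fun g : prod_group G => g i));
      [exact: cvg_fst|exact: proj_cts].
  by apply: (@continuous_comp _ _ _ snd (fun g : prod_group G => g i));
    [exact: cvg_snd|exact: proj_cts].
exact: (continuous_comp cp (@mulg_continuous (G i) _)).
Qed.

Let invg_cts : continuous (fun g : prod_group G => (g^-1)%g).
Proof.
apply: prod_cts => i g.
exact: (continuous_comp (@proj_cts i g) (@invg_continuous (G i) _)).
Qed.

HB.instance Definition _ :=
  PreTopologicalGroup_isTopologicalGroup.Build (prod_group G) mulg_cts invg_cts.
End ProdGroup.

Record subgroup (G : groupType) := Subgroup {
  subgroup_set :> set G ;
  subgroup1 : subgroup_set 1%g ;
  subgroupM : forall g h, subgroup_set g -> subgroup_set h ->
    subgroup_set (g * h)%g ;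
  subgroupV : forall g, subgroup_set g -> subgroup_set g^-1%g
}.

HB.instance Definition _ (T : choiceType) (A : set T) :=
  SubChoice.copy (set_type A) {x : T | x \in A}.

Section SubgroupType.
Variables (G : groupType) (H : subgroup G).

Let H_closed : group_closed (fun g => g \in (H : set G)).
Proof.
split=> [|g h /set_mem Hg /set_mem Hh]; apply/mem_set; first exact: subgroup1.
exact: subgroupM (subgroupV _).
Qed.

HB.instance Definition _ :=
  SubChoice_isSubGroup.Build G (fun g => g \in (H : set G)) (set_type H) H_closed.
End SubgroupType.

Definition is_group_action (G : groupType) (T : Type) (a : G -> T -> T) : Prop :=
  (forall x, a 1%g x = x) /\ (forall g h x, a (g * h)%g x = a g (a h x)).

Definition continuous_action (G : topologicalGroupType) (T : topologicalType)
    (a : G -> T -> T) : Prop :=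
  is_group_action a /\ continuous (fun p : G * T => a p.1 p.2).

Definition sigma_compact (T : topologicalType) : Prop :=
  exists2 K : nat -> set T, forall n, compact (K n) & \bigcup_n K n = [set: T].

Section CosetSpace.
Variables (G : topologicalGroupType) (H : subgroup G).

Definition left_coset (g : G) : set G := [set (g * h)%g | h in H].

Definition same_coset (g g' : G) : bool := `[< left_coset g = left_coset g' >].

Lemma same_coset_refl : reflexive same_coset.
Proof. by move=> g; apply/asboolP. Qed.

Lemma same_coset_sym : symmetric same_coset.
Proof. by move=> g g'; apply/asboolP/asboolP => ->. Qed.

Lemma same_coset_trans : transitive same_coset.
Proof. by move=> g g' g'' /asboolP gg' /asboolP ?; apply/asboolP; rewrite gg'. Qed.

Canonical same_coset_equiv :=
  EquivRel same_coset same_coset_refl same_coset_sym same_coset_trans.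

Definition coset_space : Type := quotient_topology {eq_quot same_coset_equiv}.

HB.instance Definition _ := Quotient.on coset_space.
HB.instance Definition _ := Topological.on coset_space.
HB.instance Definition _ :=
  isPointed.Build coset_space (\pi_coset_space 1%g).

Definition coset_translate (g : G) (q : coset_space) : coset_space :=
  \pi_coset_space (g * repr q)%g.

Definition borel_coset_space := g_sigma_algebraType (@open coset_space).

Definition is_discrete : Prop := forall x : H, open [set x].

(* The measure has to be nonzero: the zero measure is always invariant. *)
Definition is_lattice (R : realType) : Prop :=
  is_discrete /\
  exists mu : {measure set borel_coset_space -> \bar R},
    (0 < mu setT < +oo)%E /\
    (forall g (A : set borel_coset_space), measurable A ->
       mu (coset_translate g @^-1` A) = mu A).

Definition is_uniform : Prop := compact [set: coset_space].

End CosetSpace.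

Definition is_irreducible (n : nat) (G : 'I_n -> topologicalGroupType)
    (H : subgroup (prod_group G)) : Prop :=
  forall i, dense [set g i | g in (H : set (prod_group G))].

Section CAT0.
Variables (R : realType) (X : metricType R).
Local Notation d := (@mdist R X).

(* [closed_ball] is the closure of the open ball, which may be smaller. *)
Definition is_proper : Prop :=
  forall (x : X) (r : R), compact [set y | d x y <= r].

Definition is_geodesic (x y : X) (c : R -> X) : Prop :=
  [/\ c 0 = x, c (d x y) = y
    & forall s t, 0 <= s <= d x y -> 0 <= t <= d x y ->
        d (c s) (c t) = `|s - t|].

(* The norm of the library on [R * R] is the sup norm, hence the explicit
   Euclidean distance. *)
Definition euclid_dist (p q : R * R) : R :=
  Num.sqrt ((p.1 - q.1) ^+ 2 + (p.2 - q.2) ^+ 2).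

(* The point of the segment [p, q] at distance [s] from [p], for
   [0 <= s <= euclid_dist p q]; it is [p] when [p = q] since [s / 0 = 0]. *)
Definition euclid_point (p q : R * R) (s : R) : R * R :=
  let u := s / euclid_dist p q in
  (p.1 + u * (q.1 - p.1), p.2 + u * (q.2 - p.2)).

(* A geodesic triangle has vertices [v i] and sides [c i] joining [v i] to
   [v (i + 1 mod 3)]; [w] is its comparison triangle in the Euclidean plane. *)
Definition is_CAT0 : Prop :=
  (forall x y : X, exists c, is_geodesic x y c) /\
  (forall (v : 'I_3 -> X) (c : 'I_3 -> R -> X) (w : 'I_3 -> R * R),
     (forall i, is_geodesic (v i) (v (ordS i)) (c i)) ->
     (forall i j, euclid_dist (w i) (w j) = d (v i) (v j)) ->
     forall i j s t,
       0 <= s <= d (v i) (v (ordS i)) -> 0 <= t <= d (v j) (v (ordS j)) ->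
       d (c i s) (c j t)
         <= euclid_dist (euclid_point (w i) (w (ordS i)) s) (euclid_point (w j) (w (ordS j)) t)).

Record isometric_map := IsometricMap {
  isometric_map_fun :> X -> X ;
  isometric_mapP : forall x y, d (isometric_map_fun x) (isometric_map_fun y) = d x y
}.

(* Only the restriction to [0, +oo[ is meaningful. *)
Record ray := Ray {
  ray_fun :> R -> X ;
  rayP : forall s t, 0 <= s -> 0 <= t -> d (ray_fun s) (ray_fun t) = `|s - t|
}.

HB.instance Definition _ := gen_eqMixin ray.
HB.instance Definition _ := gen_choiceMixin ray.

Definition asymptotic (c c' : ray) : bool :=
  `[< exists K : R, forall t, 0 <= t -> d (c t) (c' t) <= K >].

Lemma asymptotic_refl : reflexive asymptotic.
Proof. by move=> c; apply/asboolP; exists 0 => t _; rewrite mdistxx. Qed.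

Lemma asymptotic_sym : symmetric asymptotic.
Proof.
by move=> c c'; apply/asboolP/asboolP => -[K cK]; exists K => t /cK;
  rewrite metric_sym.
Qed.

Lemma asymptotic_trans : transitive asymptotic.
Proof.
move=> c c' c'' /asboolP[K cK] /asboolP[K' cK']; apply/asboolP.
exists (K + K') => t t0.
exact: le_trans (metric_triangle _ _ _) (lerD (cK t t0) (cK' t t0)).
Qed.

Canonical asymptotic_equiv :=
  EquivRel asymptotic asymptotic_refl asymptotic_sym asymptotic_trans.

Definition boundary : Type := {eq_quot asymptotic_equiv}.

HB.instance Definition _ := Quotient.on boundary.
HB.instance Definition _ := Choice.on boundary.

Definition cone_nbhs (c : ray) (r e : R) : set boundary :=
  [set xi | exists c' : ray,
     [/\ \pi_boundary c' = xi, c' 0 = c 0 & d (c' r) (c r) < e]].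

(* The sets [cone_nbhs c r e] with [c] issuing from a fixed base point generate
   the cone topology, which does not depend on that point; all base points are
   therefore allowed at once. *)
Definition cone_subbase : set (set boundary) :=
  [set U | exists c r e, [/\ 0 < r, 0 < e & U = cone_nbhs c r e]].

HB.instance Definition _ := isSubBaseTopological.Build boundary cone_subbase id.

Lemma isometric_rayP (f : isometric_map) (c : ray) s t :
  0 <= s -> 0 <= t -> d (f (c s)) (f (c t)) = `|s - t|.
Proof. by move=> s0 t0; rewrite isometric_mapP rayP. Qed.

Definition isometric_ray (f : isometric_map) (c : ray) : ray :=
  Ray (isometric_rayP f c).

Definition boundary_map (f : isometric_map) (xi : boundary) : boundary :=
  \pi_boundary (isometric_ray f (repr xi)).

Lemma boundary_mapE f c :
  boundary_map f (\pi_boundary c) = \pi_boundary (isometric_ray f c).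
Proof.
have /eqmodP/asboolP[K cK] : repr (\pi_boundary c) = c %[mod_eq asymptotic_equiv].
  exact: (@reprK _ boundary).
by apply/eqmodP/asboolP; exists K => t t0; rewrite /= isometric_mapP cK.
Qed.

End CAT0.

(* Main.v *)
(** Gamma being discrete and cocompact, there are continuous maps [f : G -> X] with
    [f (g * h) = h^-1 (f g)] for [h] in Gamma. Fix a factor [H] of [G] and let [p]
    be the projection to [H]. Among the maps moving along [ker p] at most as fast
    as a given one, minimize the supremum over [g] of the energies
    [\sum_k d (f (k * g)) (f g) ^ 2], for finite families of [k] in [ker p]. If Gamma
    fixes no point at infinity, there are almost minimizers at bounded distance
    from the given map: otherwise averaging a remote one with its translates along
    [H] would give remote points of [X] moved little by finitely many elements of
    Gamma. By uniform convexity, in the limit the distances between the points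
    [f (h * g0)], [h] in [H], and their geodesic combinations do not change when
    [g0] is moved along [ker p], nor, by density of [p Gamma] in [H], along [H]. So
    [H] acts by isometries on the closed convex hull of [f (H g0)], and this action
    is at bounded distance from that of Gamma through [p]. If the hull is
    unbounded, its boundary at infinity is the required set. If it is bounded,
    circumcenters of the [f (H g)] give an [H]-invariant equivariant map, and the
    next factor is treated. If all factors are bounded, one ends up with a constant
    equivariant map, that is, a fixed point of Gamma. *)

Require Import Defs.
From HB Require Import structures.
From mathcomp Require Import all_boot all_order all_algebra finmap.
From mathcomp Require Import all_classical all_reals all_analysis.
From mathcomp Require Import measurable_realfun ring lra.
From Stdlib Require List.

Set Implicit Arguments.
Unset Strict Implicit.
Unset Printing Implicit Defensive.

Import Order.TTheory GRing.Theory Num.Theory.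
Import numFieldNormedType.Exports.

Local Open Scope classical_set_scope.
Local Open Scope ring_scope.
Local Open Scope quotient_scope.

(** * CAT(0) inequalities *)

(** No minimizer is claimed to exist, and a supremum over [g] need not be attained. Equivariance
    brings every base point back to a compact set [Q], and limits are ultralimits, so that finitely
    many approximate conditions have to be met at a time. This is why the energies involve finitely
    many [k], and why a supremum suffices: an average of finitely many competitors has nearly
    minimal supremum, hence nearly that energy at some point, where all convexity defects are small
    together. The ultralimit is continuous only if the maps are equicontinuous. Along [ker p] this
    is the speed constraint, which survives translations by [H], geodesic averages and limits. Along
    [H] it comes from taking barycenters of translates with a Haar density near 1, which raises
    neither the speed bounds nor the energy bounds. Rigidity is obtained around one base point [g0],
    so that Gamma first enters through conjugates by [p g0]. The hull need not be Gamma-invariant,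
    but maps at bounded distance act alike on asymptotic rays. If Gamma fixes a point at infinity,
    this point with the trivial action is the answer. *)

Section Euclid.
Variable R : realType.

Lemma sqr_euclid_dist (p q : R * R) :
  euclid_dist p q ^+ 2 = (p.1 - q.1) ^+ 2 + (p.2 - q.2) ^+ 2.
Proof. by rewrite sqr_sqrtr// addr_ge0 ?sqr_ge0. Qed.

Lemma euclid_dist_ge0 (p q : R * R) : 0 <= euclid_dist p q.
Proof. exact: sqrtr_ge0. Qed.

Lemma comparison_triangle (a b c : R) : 0 <= a -> 0 <= b -> 0 <= c ->
  a <= b + c -> b <= a + c -> c <= a + b ->
  exists w0 w1 w2 : R * R,
    [/\ euclid_dist w0 w1 = a, euclid_dist w0 w2 = b & euclid_dist w1 w2 = c].
Proof.
move=> a0 b0 c0 abc bac cab.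
have dE (p q : R * R) (r : R) : 0 <= r ->
    (p.1 - q.1) ^+ 2 + (p.2 - q.2) ^+ 2 = r ^+ 2 -> euclid_dist p q = r.
  by move=> r0 e; rewrite /euclid_dist e sqrtr_sqr ger0_norm.
have [a_eq0|a_neq0] := eqVneq a 0.
  exists (0, 0), (0, 0), (b, 0); split; apply: dE => //=; subst a.
  - by ring.
  - by ring.
  - have -> : c = b by apply/eqP; rewrite eq_le; apply/andP; split; lra.
    by ring.
have a_gt0 : 0 < a by rewrite lt_neqAle eq_sym a_neq0.
(* The third vertex is placed by the law of cosines, the side of length [a] lying on the first axis;
   the triangle inequalities give [u ^+ 2 <= b ^+ 2]. *)
pose u := (a ^+ 2 + b ^+ 2 - c ^+ 2) / (2 * a).
have uE : 2 * a * u = a ^+ 2 + b ^+ 2 - c ^+ 2 by rewrite /u; field.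
have u2 : u ^+ 2 <= b ^+ 2.
  have a2 : 0 < 2 * a by lra.
  have h1 : u <= b by rewrite -(ler_pM2l a2) uE; nra.
  have h2 : - b <= u by rewrite -(ler_pM2l a2) uE; nra.
  nra.
pose v := Num.sqrt (b ^+ 2 - u ^+ 2).
have vE : v ^+ 2 = b ^+ 2 - u ^+ 2 by rewrite sqr_sqrtr// subr_ge0.
exists (0, 0), (a, 0), (u, v); split; apply: dE => //=.
- by ring.
- by rewrite !sub0r !sqrrN vE; ring.
- by rewrite sub0r sqrrN vE; lra.
Qed.

(** Stewart's theorem, multiplied out by [L]. *)
Lemma sqr_euclid_dist_point (p q r : R * R) (s : R) : 0 < euclid_dist p q ->
  let L := euclid_dist p q in
  euclid_dist (euclid_point p q s) r ^+ 2 * L =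
  (L - s) * euclid_dist p r ^+ 2 + s * euclid_dist q r ^+ 2 - s * (L - s) * L.
Proof.
move=> L0 L.
have LE : L ^+ 2 = (p.1 - q.1) ^+ 2 + (p.2 - q.2) ^+ 2 by rewrite sqr_euclid_dist.
rewrite !sqr_euclid_dist /euclid_point/= -/L.
have Ln0 : L != 0 by rewrite gt_eqF.
have -> : forall x, s * (L - s) * x = s / L * (1 - s / L) * x * L ^+ 2.
  by move=> x; field.
rewrite LE.
by field.
Qed.

End Euclid.

Section ConvexCombination.
Variables (R : realType) (X : metricType R).
Implicit Types (x y z w p q : X) (s t : R).
Local Notation d := (@mdist R X).
Hypothesis XC : is_CAT0 X.

Lemma mdistxy_ge0 (x y : X) : 0 <= d x y. Proof. exact: mdist_ge0. Qed.

Lemma CN_geodesic (x y z : X) c (s : R) : is_geodesic x y c ->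
  0 <= s <= d x y ->
  d z (c s) ^+ 2 * d x y <=
  (d x y - s) * d z x ^+ 2 + s * d z y ^+ 2 - s * (d x y - s) * d x y.
Proof.
move=> gc sL.
have [L0|Ln0] := eqVneq (d x y) 0.
  have s0 : s = 0 by apply/eqP; rewrite eq_le; move: sL; rewrite L0; lra.
  by rewrite L0 s0 !(mulr0, mul0r, subr0, addr0).
have L0 : 0 < d x y by rewrite lt_neqAle eq_sym Ln0 mdist_ge0.
have [c1 gc1] := XC.1 y z; have [c2 gc2] := XC.1 z x.
have [w0 [w1 [w2 [e01 e02 e12]]]] : exists w0 w1 w2 : R * R,
    [/\ euclid_dist w0 w1 = d x y, euclid_dist w0 w2 = d x z &
        euclid_dist w1 w2 = d y z].
  apply: comparison_triangle; rewrite ?mdist_ge0//.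
  - by rewrite (metric_sym y z); exact: metric_triangle.
  - exact: metric_triangle.
  - by rewrite (metric_sym x y); exact: metric_triangle.
pose v (i : 'I_3) := nth x [:: x; y; z] i.
pose cc (i : 'I_3) := nth c [:: c; c1; c2] i.
pose w (i : 'I_3) := nth w0 [:: w0; w1; w2] i.
have esym (p q : R * R) : euclid_dist p q = euclid_dist q p.
  by rewrite /euclid_dist; congr (Num.sqrt (_ + _)); rewrite -sqrrN opprB.
have exx (p : R * R) : euclid_dist p p = 0.
  by rewrite /euclid_dist !subrr expr0n/= addr0 sqrtr0.
have vg i : is_geodesic (v i) (v (ordS i)) (cc i).
  by case: i => [[|[|[|]]]].
have wv i j : euclid_dist (w i) (w j) = d (v i) (v j).
  by case: i => [[|[|[|]]]]//= ?; case: j => [[|[|[|]]]]//= ?;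
    rewrite /w /v/= ?exx ?mdistxx// esym ?e01 ?e02 ?e12// metric_sym.
have c20 : c2 0 = z by case: gc2.
(* The vertex [z] is the point at time 0 of the third side; comparing two sides thus bounds the
   cevian from [z], which Stewart's theorem computes in the plane. *)
have := @XC.2 v cc w vg wv (@Ordinal 3 0 isT) (@Ordinal 3 2 isT) s 0.
rewrite /v /cc /w/= c20.
have -> : euclid_point w2 (nth w0 [:: w0; w1; w2] (3 %% 3)%N) 0 = w2.
  by rewrite /euclid_point mul0r !mul0r !addr0; case: (w2).
rewrite lexx mdist_ge0 => /(_ sL isT) h.
have := sqr_euclid_dist_point (p := w0) (q := w1) w2 s; rewrite e01 e02 e12.
move=> /(_ L0)/=; rewrite !(metric_sym z) => <-.
by rewrite ler_pM2r// ler_sqr ?nnegrE ?mdist_ge0 ?euclid_dist_ge0.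
Qed.

Definition clamp (t : R) : R := Num.max 0 (Num.min 1 t).

Lemma clamp_itv t : 0 <= clamp t <= 1.
Proof. by rewrite /clamp le_max lexx/= ge_max ler01 ge_min lexx. Qed.

Lemma clamp_id t : 0 <= t <= 1 -> clamp t = t.
Proof.
by move=> /andP[t0 t1]; rewrite /clamp min_r ?max_r.
Qed.

(* Clamping [t] to [0, 1] removes the side conditions from most lemmas. *)
Definition gpt (x y : X) (t : R) : X :=
  xget x [set p | exists c, is_geodesic x y c /\ p = c (clamp t * d x y)].

Lemma gpt_clamp x y t : gpt x y (clamp t) = gpt x y t.
Proof. by rewrite /gpt (clamp_id (clamp_itv t)). Qed.

Lemma gpt_geodesic x y t :
  exists c, is_geodesic x y c /\ gpt x y t = c (clamp t * d x y).
Proof.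
rewrite /gpt; case: xgetP => [p _ //|].
have [c gc] := XC.1 x y; move=> /(_ (c (clamp t * d x y)))[].
by exists c.
Qed.

(** The Bruhat-Tits inequality. The later comparison inequalities are derived from it and no longer
    from triangles. *)
Lemma CN x y z t : 0 <= t <= 1 ->
  d z (gpt x y t) ^+ 2 <=
  (1 - t) * d z x ^+ 2 + t * d z y ^+ 2 - t * (1 - t) * d x y ^+ 2.
Proof.
move=> t01; have [c [gc ->]] := gpt_geodesic x y t; rewrite clamp_id//.
have L0 := mdistxy_ge0 x y.
have [e|Ln0] := eqVneq (d x y) 0.
  have xy : x = y := mdist_positivity _ _ e.
  rewrite e mulr0; case: gc => -> _ _; rewrite -xy expr0n/= mulr0 subr0.
  by rewrite -mulrDl subrK mul1r.
have Lp : 0 < d x y by rewrite lt_neqAle eq_sym Ln0.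
have sL : 0 <= t * d x y <= d x y by nra.
have := CN_geodesic z gc sL; set D := d z _ ^+ 2 => h.
rewrite -(ler_pM2r Lp) (le_trans h)// le_eqVlt; apply/orP; left; apply/eqP.
by ring.
Qed.

Lemma mdist_gptl x y t : 0 <= t <= 1 -> d x (gpt x y t) = t * d x y.
Proof.
move=> t01; have [c [[c0 c1 gc] ->]] := gpt_geodesic x y t.
rewrite clamp_id// -{1}c0 gc ?sub0r ?normrN ?ger0_norm//.
- by rewrite mulr_ge0 ?mdist_ge0//; lra.
- by rewrite lexx mdist_ge0.
- by have := mdistxy_ge0 x y; nra.
Qed.

(** [CN] tested at [p] leaves no room for [d p (gpt x y t)]. Hence the choice of a geodesic in [gpt]
    is immaterial, and isometries commute with [gpt]. *)
Lemma gpt_uniq x y t p : 0 <= t <= 1 ->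
  d x p <= t * d x y -> d p y <= (1 - t) * d x y -> p = gpt x y t.
Proof.
move=> t01 h1 h2; apply: mdist_positivity; apply/eqP.
have := CN x y p t01; rewrite -sqrf_eq0 => h.
apply/eqP/le_anti; rewrite sqr_ge0 andbT (le_trans h)//.
rewrite (metric_sym p x).
have p1 : d x p ^+ 2 <= (t * d x y) ^+ 2.
  by rewrite lerXn2r ?nnegrE ?mdist_ge0// (le_trans _ h1) ?mdist_ge0.
have p2 : d p y ^+ 2 <= ((1 - t) * d x y) ^+ 2.
  by rewrite lerXn2r ?nnegrE ?mdist_ge0// (le_trans _ h2) ?mdist_ge0.
by rewrite !exprMn in p1 p2; nra.
Qed.

Lemma mdist_gptr x y t : 0 <= t <= 1 -> d (gpt x y t) y = (1 - t) * d x y.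
Proof.
move=> t01; have [c [[c0 c1 gc] ->]] := gpt_geodesic x y t.
have := mdistxy_ge0 x y => L0; rewrite clamp_id//.
rewrite -[X in d _ X]c1 gc; last 2 first.
- by nra.
- by rewrite L0 lexx.
rewrite distrC ger0_norm; first by ring.
by nra.
Qed.

Lemma gptC x y t : 0 <= t <= 1 -> gpt x y t = gpt y x (1 - t).
Proof.
move=> t01; apply: gpt_uniq; first by lra.
- by rewrite metric_sym mdist_gptr// (metric_sym y x).
- by rewrite metric_sym mdist_gptl// (metric_sym y x) opprB addrC subrK.
Qed.

Lemma gpt0 x y : gpt x y 0 = x.
Proof.
by apply/esym/gpt_uniq; rewrite ?lexx ?ler01// ?mul0r ?mdistxx// subr0 mul1r.
Qed.

Lemma geodesic_gpt x y c s : is_geodesic x y c -> 0 < d x y ->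
  0 <= s <= d x y -> c s = gpt x y (s / d x y).
Proof.
move=> [c0 c1 gc] L0 sL.
have Ln0 : d x y != 0 by rewrite gt_eqF.
apply: gpt_uniq.
- by rewrite ler_pdivlMr// ler_pdivrMr// mul0r mul1r.
- rewrite divfK// -[X in d X _]c0 gc//; last by lra.
  by rewrite sub0r normrN ger0_norm//; lra.
- rewrite -[X in d _ X]c1 gc//; last by lra.
  rewrite distrC ger0_norm ?subr_ge0; last by lra.
  by rewrite mulrBl mul1r divfK.
Qed.

Lemma ler_sqr_mdist x y (r : R) : 0 <= r -> d x y ^+ 2 <= r ^+ 2 -> d x y <= r.
Proof. by move=> r0; rewrite ler_sqr ?nnegrE ?mdist_ge0. Qed.

(** [CN] is used twice, from [gpt x p t] to the segment [[x, q]] and from [q] to the segment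
    [[x, p]]; the terms in [d x p] and [d x q] cancel. *)
Lemma mdist_gpt_common x p q t : 0 <= t <= 1 ->
  d (gpt x p t) (gpt x q t) <= t * d p q.
Proof.
move=> t01; apply: ler_sqr_mdist; first by rewrite mulr_ge0 ?mdist_ge0//; lra.
have h1 := CN x q (gpt x p t) t01.
have h2 := CN x p q t01.
rewrite (metric_sym (gpt x p t) x) mdist_gptl// in h1.
rewrite (metric_sym q (gpt x p t)) (metric_sym q x) (metric_sym q p) in h2.
rewrite !exprMn in h1 *.
have : t * d (gpt x p t) q ^+ 2 <=
    t * ((1 - t) * d x q ^+ 2 + t * d p q ^+ 2 - t * (1 - t) * d x p ^+ 2).
  by apply: ler_wpM2l => //; lra.
by lra.
Qed.

Lemma mdist_gpt x y x' y' t : 0 <= t <= 1 ->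
  d (gpt x y t) (gpt x' y' t) <= (1 - t) * d x x' + t * d y y'.
Proof.
move=> t01; apply: (le_trans (metric_triangle _ (gpt x y' t) _)).
rewrite addrC lerD ?mdist_gpt_common//.
rewrite [in leLHS]gptC// [gpt x' y' t]gptC//.
by apply: mdist_gpt_common; lra.
Qed.

Lemma mdist_gpt_max x y x' y' t r :
  d x x' <= r -> d y y' <= r -> d (gpt x y t) (gpt x' y' t) <= r.
Proof.
move=> h1 h2; rewrite -(gpt_clamp x) -(gpt_clamp x').
have /andP[c0 c1] := clamp_itv t; set s := clamp t in c0 c1 *.
apply: (le_trans (mdist_gpt _ _ _ _ _)); first by rewrite c0.
by nra.
Qed.

Definition mid (x y : X) : X := gpt x y 2^-1.

Lemma CN_mid x y z :
  d z (mid x y) ^+ 2 <= (d z x ^+ 2 + d z y ^+ 2) / 2 - d x y ^+ 2 / 4.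
Proof.
have h01 : 0 <= (2^-1 : R) <= 1 by lra.
by apply: (le_trans (CN x y z h01)); lra.
Qed.

Lemma quadrilateral x y z w :
  d x z ^+ 2 + d y w ^+ 2 <=
  d x y ^+ 2 + d y z ^+ 2 + d z w ^+ 2 + d w x ^+ 2.
Proof.
have h1 := CN_mid x z y; have h2 := CN_mid x z w.
have h3 := metric_triangle w (mid x z) y.
have : d y w ^+ 2 <= 2 * (d y (mid x z) ^+ 2 + d w (mid x z) ^+ 2).
  have yw0 : 0 <= d w y := mdist_ge0 w y.
  rewrite (metric_sym (mid x z) y) in h3; rewrite (metric_sym y w).
  have : d w y ^+ 2 <= (d y (mid x z) + d w (mid x z)) ^+ 2.
    by rewrite lerXn2r ?nnegrE ?addr_ge0 ?mdist_ge0//; lra.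
  by have := sqr_ge0 (d y (mid x z) - d w (mid x z)); nra.
rewrite (metric_sym y x) (metric_sym w z) in h1 h2 *.
by lra.
Qed.

(* Twice the Berg-Nikolaev quasi-inner product of [xx'] and [yy']. *)
Definition qprod x x' y y' : R :=
  d x y' ^+ 2 + d x' y ^+ 2 - d x y ^+ 2 - d x' y' ^+ 2.

Lemma qprod_addl x w x' y y' : qprod x x' y y' = qprod x w y y' + qprod w x' y y'.
Proof. by rewrite /qprod; ring. Qed.

Lemma qprodC x x' y y' : qprod x x' y y' = qprod y y' x x'.
Proof.
rewrite /qprod (metric_sym y x') (metric_sym y' x) (metric_sym y x).
by rewrite (metric_sym y' x'); ring.
Qed.

Lemma qprod_le_sqr x x' y y' : qprod x x' y y' <= d x x' ^+ 2 + d y y' ^+ 2.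
Proof.
have := quadrilateral x x' y' y.
by rewrite /qprod (metric_sym y' y) (metric_sym y x); lra.
Qed.

Lemma qprod_subdivide (n : nat) x x' y y' (K : R) : (0 < n)%N ->
  (forall w w', d w w' = d x x' / n%:R -> qprod w w' y y' <= K) ->
  qprod x x' y y' <= n%:R * K.
Proof.
move=> n0 hK; have [c [c0 c1 gc]] := XC.1 x x'.
have nR : 0 < n%:R :> R by rewrite ltr0n.
have L0 := mdistxy_ge0 x x'.
have itv k : (k <= n)%N -> 0 <= k%:R * (d x x' / n%:R) <= d x x'.
  move=> kn; have kn' : k%:R <= n%:R :> R by rewrite ler_nat.
  rewrite mulr_ge0 ?divr_ge0//= mulrA ler_pdivrMr// mulrC.
  exact: ler_wpM2l.
have step k : (k <= n)%N ->
    qprod x (c (k%:R * (d x x' / n%:R))) y y' <= k%:R * K.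
  elim: k => [|k IH] kn.
    by rewrite !mul0r c0 /qprod; lra.
  rewrite (qprod_addl _ (c (k%:R * (d x x' / n%:R)))) -natr1 !mulrDl !mul1r.
  apply: lerD; first by apply: IH; exact: ltnW.
  apply: hK; rewrite gc ?itv//; last 2 first.
  - exact: ltnW.
  - by have := itv _ kn; rewrite -natr1 mulrDl mul1r.
  rewrite opprD addrA subrr sub0r normrN ger0_norm//.
  by rewrite divr_ge0.
have := step n (leqnn n).
by rewrite mulrCA divff ?mulr1 ?c1// gt_eqF.
Qed.

(** The Cauchy-Schwarz inequality of Berg and Nikolaev. Quadrilaterals only give [a ^+ 2 + b ^+ 2],
    which is good enough when [a = b]. Cutting the two sides into [n] and [m] pieces gives
    [m * a ^+ 2 / n + n * b ^+ 2 / m], and this is close to [2 * a * b] when [m / n] is close to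
    [b / a]. *)
Lemma qprod_le x x' y y' : qprod x x' y y' <= 2 * d x x' * d y y'.
Proof.
set a := d x x'; set b := d y y'.
have a0 : 0 <= a := mdist_ge0 _ _; have b0 : 0 <= b := mdist_ge0 _ _.
have stepA (w w' : X) (m : nat) : (0 < m)%N ->
    qprod w w' y y' <= m%:R * (d w w' ^+ 2 + (b / m%:R) ^+ 2).
  move=> m0; rewrite qprodC; apply: qprod_subdivide => // z z' e.
  by rewrite qprodC (le_trans (qprod_le_sqr _ _ _ _))// e.
have stepB (n m : nat) : (0 < n)%N -> (0 < m)%N ->
    qprod x x' y y' <= n%:R * (m%:R * ((a / n%:R) ^+ 2 + (b / m%:R) ^+ 2)).
  move=> n0 m0; apply: qprod_subdivide => // z z' e.
  by rewrite (le_trans (stepA _ _ _ m0))// e.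
have [a_eq0|a_neq0] := eqVneq a 0.
  have xx' : x = x' := mdist_positivity _ _ a_eq0.
  by rewrite a_eq0 mulr0 mul0r /qprod xx'; lra.
have ap : 0 < a by rewrite lt_neqAle eq_sym a_neq0.
have [b_eq0|b_neq0] := eqVneq b 0.
  have yy' : y = y' := mdist_positivity _ _ b_eq0.
  by rewrite b_eq0 mulr0 /qprod yy'; lra.
have bp : 0 < b by rewrite lt_neqAle eq_sym b_neq0.
apply/ler_addgt0Pr => e e0.
(* [n] makes the rounding error [a ^+ 2 / n] smaller than [e]; [m] is the first integer above
   [n * b / a]. *)
pose n := (Num.truncn (a ^+ 2 / e)).+1.
have nR : 0 < n%:R :> R by rewrite ltr0n.
have ne : a ^+ 2 / n%:R < e.
  rewrite ltr_pdivrMr// mulrC -ltr_pdivrMr//.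
  exact: truncnS_gt.
pose m := (Num.truncn (n%:R * b / a)).+1.
have mR : 0 < m%:R :> R by rewrite ltr0n.
have m1 : n%:R * b / a < m%:R by exact: truncnS_gt.
have m2 : m%:R <= n%:R * b / a + 1.
  rewrite /m -natr1 lerD2r truncn_le//.
  by rewrite divr_ge0 ?mulr_ge0// ltW.
apply: (le_trans (stepB n m isT isT)).
have -> : n%:R * (m%:R * ((a / n%:R) ^+ 2 + (b / m%:R) ^+ 2)) =
    m%:R * (a ^+ 2 / n%:R) + n%:R * b / m%:R * b.
  by field; rewrite !gt_eqF.
have h1 : n%:R * b / m%:R <= a.
  by rewrite ler_pdivrMr//; move: m1; rewrite ltr_pdivrMr// (mulrC a) => /ltW.
have h2 : m%:R * (a ^+ 2 / n%:R) <= (n%:R * b / a + 1) * (a ^+ 2 / n%:R).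
  by apply: ler_wpM2r => //; rewrite divr_ge0 ?sqr_ge0 ?ltW.
have h3 : (n%:R * b / a + 1) * (a ^+ 2 / n%:R) = a * b + a ^+ 2 / n%:R.
  by field; rewrite !gt_eqF.
have h4 : n%:R * b / m%:R * b <= a * b by apply: ler_wpM2r.
by rewrite h3 in h2; lra.
Qed.

(** [CN] for both midpoints leaves the cross term [qprod x y x' y'], which Cauchy-Schwarz bounds by
    [2 * d x y * d x' y']. The square that is gained compares [d x y] with [d x' y']: it is the
    convexity defect from which rigidity will come. *)
Lemma sqr_mdist_mid x y x' y' :
  d (mid x y) (mid x' y') ^+ 2 <=
  (d x x' ^+ 2 + d y y' ^+ 2) / 2 - (d x y - d x' y') ^+ 2 / 4.
Proof.
have h1 := CN_mid x' y' (mid x y).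
have h2 := CN_mid x y x'; have h3 := CN_mid x y y'.
have h4 := qprod_le x y x' y'; rewrite /qprod in h4.
rewrite (metric_sym (mid x y) x') (metric_sym (mid x y) y') in h1.
rewrite (metric_sym x' x) (metric_sym x' y) in h2.
rewrite (metric_sym y' x) (metric_sym y' y) in h3.
by nra.
Qed.

Lemma sqr_mdist_gpt x y x' y' t : 0 <= t <= 1 ->
  d (gpt x y t) (gpt x' y' t) ^+ 2 <= (1 - t) * d x x' ^+ 2 + t * d y y' ^+ 2.
Proof.
move=> t01; have h := mdist_gpt x y x' y' t01.
have h0 := mdistxy_ge0 (gpt x y t) (gpt x' y' t).
apply: (@le_trans _ _ (((1 - t) * d x x' + t * d y y') ^+ 2)).
  by rewrite lerXn2r ?nnegrE// (le_trans h0).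
have : 0 <= t * (1 - t) * (d x x' - d y y') ^+ 2.
  by rewrite mulr_ge0 ?sqr_ge0//; nra.
by nra.
Qed.

Lemma gpt_isometry (f : isometric_map X) x y t : f (gpt x y t) = gpt (f x) (f y) t.
Proof.
rewrite -gpt_clamp -(gpt_clamp (f x)); have := clamp_itv t; set s := clamp t.
move=> s01; apply: gpt_uniq => //; rewrite !isometric_mapP.
- by rewrite mdist_gptl.
- by rewrite mdist_gptr.
Qed.

End ConvexCombination.

(** * Ultralimits and rays *)

(** Limits of points, rays and maps are taken along such ultrafilters, which replaces diagonal
    extractions. Finite subfamilies are lists with [List.In], as [A] is a bare type without
    decidable equality. *)
Lemma ultra_fip (A I : Type) (P : A -> set I) :
  (forall s : seq A, exists i, forall a, List.In a s -> P a i) ->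
  exists2 U : set_system I, UltraFilter U & forall a, U (P a).
Proof.
move=> hP.
pose F : set_system I :=
  [set Q | exists s : seq A, forall i, (forall a, List.In a s -> P a i) -> Q i].
have FF : ProperFilter F.
  apply: Build_ProperFilter_ex.
    by move=> B [s sB]; have [i Pi] := hP s; exists i; exact: sB.
  split.
  - by exists [::].
  - move=> B C [s sB] [t tC]; exists (s ++ t)%list => i h; split.
      by apply: sB => a ia; apply: h; apply: List.in_or_app; left.
    by apply: tC => a ia; apply: h; apply: List.in_or_app; right.
  - by move=> B C BC [s sB]; exists s => i /sB/BC.
have [U [UU FU]] := ultraFilterLemma FF; exists U => // a; apply: FU.
by exists [:: a] => i; apply; left.
Qed.

Lemma compact_ultra_cvg (T : topologicalType) (I : Type) (U : set_system I)
    (UU : UltraFilter U) (K : set T) (u : I -> T) :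
  compact K -> U (u @^-1` K) -> exists2 l, K l & u @ U --> l.
Proof.
move=> cK UK; have [l [Kl cl]] := cK (u @ U) _ UK.
exists l => // B lB; have [//|h] := in_ultra_setVsetC (u @^-1` B) UU.
by have [p []] : (~` B) `&` B !=set0 by exact: cl.
Qed.

Lemma near_true (T : Type) (F : set_system T) (FF : Filter F) (P : set T) :
  (forall x, P x) -> \forall x \near F, P x.
Proof. by move=> h; apply: filterE. Qed.

Section MetricLimits.
Variables (R : realType) (X : metricType R).
Local Notation d := (@mdist R X).

Lemma mcvgP {T : Type} {F : set_system T} {FF : Filter F} (u : T -> X) (l : X) :
  u @ F --> l <-> forall e, 0 < e -> \forall t \near F, d l (u t) < e.
Proof. exact: metricType_numDomainType.cvgrPdist_lt. Qed.

Lemma ler_mdist_mdist (x y z w : X) : `|d x y - d z w| <= d x z + d y w.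
Proof.
have h1 := metric_triangle x z y; have h2 := metric_triangle z w y.
have h3 := metric_triangle z x w; have h4 := metric_triangle x y w.
rewrite (metric_sym w y) (metric_sym z x) in h2 h3 *.
by rewrite ler_norml; apply/andP; split; lra.
Qed.

Lemma cvg_mdist {T : Type} {F : set_system T} {FF : Filter F}
    (u v : T -> X) (l m : X) :
  u @ F --> l -> v @ F --> m -> (fun t => d (u t) (v t)) @ F --> d l m.
Proof.
move=> /mcvgP ul /mcvgP vm; apply/cvgrPdist_lt => e e0.
have e2 : 0 < e / 2 by lra.
near=> t; apply: (le_lt_trans (ler_mdist_mdist _ _ _ _)).
have h1 : d l (u t) < e / 2 by near: t; exact: ul.
have h2 : d m (v t) < e / 2 by near: t; exact: vm.
lra.
Unshelve. all: by end_near. Qed.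

Lemma lim_mdist_le {T : Type} {F : set_system T} {FF : ProperFilter F}
    (u v : T -> X) (l m : X) (r : R) :
  u @ F --> l -> v @ F --> m ->
  (forall e, 0 < e -> \forall t \near F, d (u t) (v t) <= r + e) -> d l m <= r.
Proof.
move=> ul vm h; apply/ler_addgt0Pr => e e0.
have e2 : 0 < e / 2 by lra.
have := filter_ex (filterI (h _ e2)
  (cvgr_dist_lt _ _ (cvg_mdist ul vm) _ e2)).
by move=> [t [/= h1]]; rewrite ltr_norml => /andP[_ h2]; lra.
Qed.

Lemma mcvg_unique {T : Type} {F : set_system T} {FF : ProperFilter F}
    (u : T -> X) (l m : X) : u @ F --> l -> u @ F --> m -> l = m.
Proof. by apply: cvg_unique; exact: metric_hausdorff. Qed.

Lemma proper_ultra_cvg (I : Type) (U : set_system I) (UU : UltraFilter U)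
    (u : I -> X) (x : X) (r : R) : is_proper X ->
  (\forall i \near U, d x (u i) <= r) -> exists2 l, d x l <= r & u @ U --> l.
Proof. by move=> XP h; exact: compact_ultra_cvg (XP x r) h. Qed.

Lemma cvg_gpt (XC : is_CAT0 X) {T : Type} {F : set_system T} {FF : Filter F}
    (u v : T -> X) (l m : X) (s : R) :
  u @ F --> l -> v @ F --> m -> (fun t => gpt (u t) (v t) s) @ F --> gpt l m s.
Proof.
move=> /mcvgP ul /mcvgP vm; apply/mcvgP => e e0; have e2 : 0 < e / 2 by lra.
near=> t; apply: (@le_lt_trans _ _ (e / 2)); last by lra.
apply: mdist_gpt_max => //; apply: ltW; near: t; [exact: ul|exact: vm].
Unshelve. all: by end_near. Qed.

End MetricLimits.

(** * Asymptotic rays and rays as limits of segments *)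

Section Rays.
Variables (R : realType) (X : metricType R).
Hypotheses (XC : is_CAT0 X) (XP : is_proper X).
Local Notation d := (@mdist R X).
Implicit Types (c e : ray X).

Lemma ray_dist c t : 0 <= t -> d (c 0) (c t) = t.
Proof. by move=> t0; rewrite rayP// sub0r normrN ger0_norm. Qed.

Lemma ray_gpt c (t T : R) : 0 <= t <= T -> c t = gpt (c 0) (c T) (t / T).
Proof.
move=> tT; have T0 : 0 <= T by lra.
have [T_eq0|Tn0] := eqVneq T 0.
  have -> : t = 0 by lra.
  by rewrite T_eq0 mul0r gpt0.
have Tp : 0 < T by rewrite lt_neqAle eq_sym Tn0.
have t0 : 0 <= t by lra.
apply: gpt_uniq => //.
- by rewrite divr_ge0//= ler_pdivrMr// mul1r; lra.
- by rewrite !ray_dist// divfK.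
- rewrite (ray_dist _ T0) rayP// ler_norml mulrBl mul1r divfK//.
  by apply/andP; split; lra.
Qed.

Lemma asymptoticP c c' :
  reflect (exists K, forall t, 0 <= t -> d (c t) (c' t) <= K) (asymptotic c c').
Proof. exact: asboolP. Qed.

Lemma pi_boundaryP c c' :
  (\pi_(boundary X) c = \pi_(boundary X) c') <-> asymptotic c c'.
Proof.
split=> [/eqmodP//|h]; exact/eqmodP.
Qed.

Lemma asymptotic_dist c c' t : asymptotic c c' -> 0 <= t ->
  d (c t) (c' t) <= d (c 0) (c' 0).
Proof.
move=> /asymptoticP[K hK] t0; apply/ler_addgt0Pr => e e0.
have K0 : 0 <= K by apply: le_trans (hK 0 (lexx _)); exact: mdist_ge0.
(* By convexity of the distance on [[0, T]], the bound [K] at time [T] enters with weight [t / T];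
   this [T] makes its contribution at most [e]. *)
pose T := t + t * K / e + 1.
have q0 : 0 <= t * K / e by rewrite divr_ge0 ?mulr_ge0// ltW.
have T0 : 0 < T by rewrite /T; lra.
have tT : 0 <= t <= T.
  by rewrite t0 /T; lra.
rewrite (ray_gpt c tT) (ray_gpt c' tT).
have s01 : 0 <= t / T <= 1.
  by rewrite ler_pdivrMr// mul1r divr_ge0 ?(ltW T0)//; lra.
apply: (le_trans (mdist_gpt XC _ _ _ _ s01)); apply: lerD.
  have := mdist_ge0 (c 0) (c' 0); have : (1 - t / T) <= 1 by lra.
  by move=> h1 h2; rewrite -[leRHS]mul1r; apply: ler_wpM2r.
apply: (@le_trans _ _ (t / T * K)).
  by apply: ler_wpM2l; [lra|apply: hK; exact: ltW].
rewrite mulrAC ler_pdivrMr// mulrC -ler_pdivrMl// mulrC /T mulrC.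
by lra.
Qed.

Lemma asymptotic_eq c c' t : asymptotic c c' -> c 0 = c' 0 -> 0 <= t -> c t = c' t.
Proof.
move=> cc' e t0; apply: mdist_positivity; apply/le_anti; rewrite mdist_ge0 andbT.
by rewrite (le_trans (asymptotic_dist cc' t0))// e mdistxx.
Qed.

Lemma ray_dist_scale c c' (r r' : R) : c 0 = c' 0 -> 0 <= r <= r' -> 0 < r' ->
  d (c r) (c' r) <= r / r' * d (c r') (c' r').
Proof.
move=> e rr' r'0; rewrite (ray_gpt c rr') (ray_gpt c' rr') -e.
by apply: mdist_gpt_common => //; rewrite divr_ge0/= ?ler_pdivrMr ?mul1r//; lra.
Qed.

(* Comparison at a large time [r'] of rays with other origins controls the
   rays issuing from a given point; this is what makes the cone topology
   independent of the base point. *)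
Lemma rays_base_change c1 c2 e1 e2 (r r' : R) :
  e1 0 = e2 0 -> asymptotic e1 c1 -> asymptotic e2 c2 -> 0 <= r <= r' -> 0 < r' ->
  d (e1 r) (e2 r) <=
  r / r' * (d (e1 0) (c1 0) + d (e2 0) (c2 0) + d (c1 r') (c2 r')).
Proof.
move=> e a1 a2 rr' r'0; apply: (le_trans (ray_dist_scale e rr' r'0)).
apply: ler_wpM2l; first by rewrite divr_ge0//; lra.
have h1 := asymptotic_dist a1 (ltW r'0); have h2 := asymptotic_dist a2 (ltW r'0).
have h3 := metric_triangle (e1 r') (c1 r') (e2 r').
have h4 := metric_triangle (c1 r') (c2 r') (e2 r').
by rewrite (metric_sym (c2 r')) in h4; lra.
Qed.

(* Rays are obtained as limits of longer and longer segments. *)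
Lemma segments_limit_ray (I : Type) (U : set_system I) (UU : UltraFilter U)
    (x : X) (z : I -> X) :
  (forall r : R, \forall i \near U, r <= d x (z i)) ->
  exists c : ray X, c 0 = x /\
    forall t, 0 <= t -> (fun i => gpt x (z i) (t / d x (z i))) @ U --> c t.
Proof.
move=> zU.
have big (t : R) : 0 <= t -> \forall i \near U, 0 < d x (z i) /\ 0 <= t / d x (z i) <= 1.
  move=> t0; near=> i.
  have h : t + 1 <= d x (z i) by near: i; exact: zU.
  have p : 0 < d x (z i) by lra.
  by split=> //; rewrite ler_pdivrMr// mul1r divr_ge0 ?(ltW p)//; lra.
have ex (t : R) : exists l : X, 0 <= t ->
    (fun i => gpt x (z i) (t / d x (z i))) @ U --> l.
  have [t0|t0] := leP 0 t; last by exists x.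
  have [||l _ hl] := proper_ultra_cvg UU (u := fun i => gpt x (z i) (t / d x (z i)))
    (x := x) (r := t) => //; last by exists l.
  have := big t t0; apply: filterS => i [p h].
  by rewrite mdist_gptl// divfK// gt_eqF.
have /choice[f fP] := ex.
have fray s t : 0 <= s -> 0 <= t -> d (f s) (f t) = `|s - t|.
  move=> s0 t0; apply: (@cvg_unique _ (@Rhausdorff R) _ _ _ _ (cvg_mdist (fP s s0) (fP t t0))).
  apply: cvg_near_cst.
  near=> i.
  have [p h1] : 0 < d x (z i) /\ 0 <= s / d x (z i) <= 1 by near: i; exact: big.
  have [_ h2] : 0 < d x (z i) /\ 0 <= t / d x (z i) <= 1 by near: i; exact: big.
  have [c [gc _]] := gpt_geodesic XC x (z i) 0.
  have hs : 0 <= s <= d x (z i) by rewrite s0/=; move: h1; rewrite ler_pdivrMr// mul1r => /andP[].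
  have ht : 0 <= t <= d x (z i) by rewrite t0/=; move: h2; rewrite ler_pdivrMr// mul1r => /andP[].
  rewrite -(geodesic_gpt XC gc)// -(geodesic_gpt XC gc)//.
  by case: gc => _ _ ->.
exists (Ray fray); split; last exact: fP.
apply: (mcvg_unique (fP 0 (lexx _))).
apply: cvg_near_cst; apply: near_true => i; by rewrite mul0r gpt0.
Unshelve. all: by end_near. Qed.

Definition gpt_convex (Y : set X) := forall x y t, Y x -> Y y -> Y (gpt x y t).

(** The ray is a limit of segments from [x] to [c i], which convexity and closedness keep in [Y]. It
    stays near [c] because the segments from [x] and from [c 0] to [c i] share an endpoint and their
    lengths differ by at most [d x (c 0)]. *)
Lemma ray_from_asymptotic_in (Y : set X) (x : X) c : closed Y -> gpt_convex Y ->
  Y x -> (forall t, 0 <= t -> Y (c t)) ->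
  exists c' : ray X,
    [/\ c' 0 = x, asymptotic c' c & forall t, 0 <= t -> Y (c' t)].
Proof.
move=> Ycl Ycv Yx Yc.
have [U UU hU] : exists2 U : set_system R, UltraFilter U &
    forall r : R, \forall i \near U, r <= i.
  apply: ultra_fip => s; exists (\big[Num.max/0]_(i <- s) i) => a.
  elim: s => //= b s IH [->|/IH h]; rewrite big_cons le_max ?lexx//.
  by rewrite h orbT.
have dU (r : R) : \forall i \near U, r <= d x (c i).
  near=> i.
  have h : `|r| + d x (c 0) <= i by near: i; exact: hU.
  have i0 : 0 <= i by apply: le_trans h; rewrite addr_ge0 ?mdist_ge0.
  have := metric_triangle (c 0) x (c i); rewrite ray_dist// (metric_sym (c 0)).
  by have := ler_norm r; lra.
have [c' [c'0 hc']] := segments_limit_ray UU dU.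
have Yc' t : 0 <= t -> Y (c' t).
  move=> t0; apply: (closed_cvg Y Ycl _ _ (hc' t t0)).
  near=> i; apply: (Ycv) => //; apply: Yc; near: i; exact: hU.
exists c'; split => //; apply/asymptoticP; exists (d x (c 0)) => t t0.
apply: (lim_mdist_le (hc' t t0) (cvg_cst _)) => e e0.
near=> i.
have hi : t + 1 + d x (c 0) + t * d x (c 0) / e <= i by near: i; exact: hU.
have D0 : 0 <= d x (c 0) := mdist_ge0 _ _.
have q0 : 0 <= t * d x (c 0) / e by rewrite divr_ge0 ?mulr_ge0// ltW.
have ti : 0 <= t <= i by lra.
have i0 : 0 < i by lra.
have hL : t <= d x (c i) by near: i; exact: dU.
have L0 : t + 1 <= d x (c i) by near: i; exact: dU.
have Lp : 0 < d x (c i) by lra.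
have s01 : 0 <= t / d x (c i) <= 1.
  by rewrite ler_pdivrMr// mul1r divr_ge0 ?(ltW Lp)//; lra.
have Li : `|d x (c i) - i| <= d x (c 0).
  have := metric_triangle x (c 0) (c i); rewrite ray_dist ?(ltW i0)// => h1.
  have := metric_triangle (c 0) x (c i); rewrite ray_dist ?(ltW i0)// (metric_sym (c 0)) => h2.
  by rewrite ler_norml; apply/andP; split; lra.
have h1 : d (gpt x (c i) (t / d x (c i))) (gpt (c 0) (c i) (t / d x (c i))) <= d x (c 0).
  by apply: mdist_gpt_max; rewrite ?mdistxx.
have tLi : 0 <= t / d x (c i) * i by rewrite mulr_ge0 ?(ltW i0)//; lra.
have tLi' : t / d x (c i) * i <= i by rewrite -[leRHS]mul1r ler_pM2r//; lra.
(* Both segments are cut in the same proportion, so that [c] is read at a time slightly different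
   from [t]; the shift is at most [e] for large [i]. *)
have e2 : gpt (c 0) (c i) (t / d x (c i)) = c (t / d x (c i) * i).
  rewrite (@ray_gpt c (t / d x (c i) * i) i); last by rewrite tLi.
  by rewrite mulfK// gt_eqF.
apply: (le_trans (metric_triangle _ (gpt (c 0) (c i) (t / d x (c i))) _)).
apply: lerD => //; rewrite e2 rayP//.
have -> : t / d x (c i) * i - t = t / d x (c i) * (i - d x (c i)).
  by rewrite mulrBr divfK// gt_eqF.
rewrite normrM distrC ger0_norm; last by lra.
apply: (@le_trans _ _ (t / d x (c i) * d x (c 0))).
  by apply: ler_wpM2l => //; lra.
rewrite mulrAC ler_pdivrMr// (mulrC e) -ler_pdivrMr//.
by near: i; exact: dU.
Unshelve. all: by end_near. Qed.

Lemma ray_from_asymptotic (x : X) c : exists2 c' : ray X, c' 0 = x & asymptotic c' c.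
Proof.
have [c' [c'0 c'c _]] := @ray_from_asymptotic_in setT x c closedT
  (fun _ _ _ _ _ => I) I (fun _ _ => I).
by exists c'.
Qed.

End Rays.

(** * Barycenters *)

Section Argmin.
Variables (R : realType) (X : metricType R).
Hypotheses (XC : is_CAT0 X) (XP : is_proper X).
Local Notation d := (@mdist R X).
Implicit Types (x y z b : X) (Psi : X -> R).

(** Quadratic growth is part of the notion: it gives uniqueness, and two minimizers are compared by
    testing the growth of each function at the other point. *)
Definition is_argmin Psi b := forall z, Psi b + d z b ^+ 2 <= Psi z.

Definition argmin x0 Psi : X := xget x0 (is_argmin Psi).

Lemma is_argmin_uniq Psi b b' : is_argmin Psi b -> is_argmin Psi b' -> b = b'.
Proof.
move=> h h'; apply: mdist_positivity; apply/eqP; rewrite -sqrf_eq0; apply/eqP/le_anti.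
have := h b'; have := h' b; rewrite (metric_sym b' b) sqr_ge0 => h1 h2.
by rewrite andbT; lra.
Qed.

Lemma argmin_eq x0 Psi b : is_argmin Psi b -> argmin x0 Psi = b.
Proof.
move=> hb; rewrite /argmin; case: xgetP => [b' _ hb'|/(_ _ hb)//].
exact: is_argmin_uniq hb' hb.
Qed.

Definition midconvex_unif Psi := forall x y,
  Psi (mid x y) <= (Psi x + Psi y) / 2 - d x y ^+ 2 / 4.

Definition lower_semicts Psi := forall b (e : R), 0 < e ->
  exists2 r, 0 < r & forall x, d b x < r -> Psi b <= Psi x + e.

(** Growth with constant [n / (n + 1)] at the midpoint of [z] and [b], fed into midconvexity, gives
    growth at [z] with the next constant; these constants tend to 1. *)
Lemma midconvex_argmin Psi b : midconvex_unif Psi -> (forall z, Psi b <= Psi z) ->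
  is_argmin Psi b.
Proof.
move=> UC hb z.
have step n : forall z, n%:R * (d z b ^+ 2 - (Psi z - Psi b)) <= Psi z - Psi b.
  elim: n => [|n IH] {}z; first by rewrite mul0r subr_ge0.
  have := IH (mid z b); have := UC z b; have := hb (mid z b).
  have h01 : 0 <= (2^-1 : R) <= 1 by lra.
  have -> : n.+1%:R = n%:R + 1 :> R by rewrite natr1.
  rewrite (mdist_gptr XC _ _ h01) exprMn; set D := d z b ^+ 2.
  set m := Psi (mid z b); set p := Psi z; set q := Psi b.
  have n0 : 0 <= n%:R :> R by rewrite ler0n.
  move=> h0 h1 h2.
  have h3 : n%:R * ((1 - 2^-1) ^+ 2 * D) <= (n%:R + 1) * ((p + q) / 2 - D / 4 - q).
    apply: (@le_trans _ _ ((n%:R + 1) * (m - q))); first by lra.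
    by apply: ler_wpM2l; lra.
  by nra.
rewrite leNgt; apply/negP => lt.
pose D := d z b ^+ 2 - (Psi z - Psi b); have D0 : 0 < D by rewrite /D; lra.
have := step (Num.truncn ((Psi z - Psi b) / D)).+1 z; rewrite -/D leNgt.
by rewrite -ltr_pdivrMr// truncnS_gt.
Qed.

(** Midconvexity bounds the set of almost minimizers, properness gives them a limit point, and
    semicontinuity makes it a minimizer. *)
Lemma argmin_exists Psi (lb : R) (x0 : X) : midconvex_unif Psi ->
  (forall x, lb <= Psi x) -> lower_semicts Psi -> exists b, is_argmin Psi b.
Proof.
move=> UC hlb lsc.
have hi : has_inf (range Psi).
  by split; [exists (Psi x0), x0|exists lb => _ [x _ <-]].
pose m := inf (range Psi).
have mle x : m <= Psi x by apply: ge_inf; [exact: hi.2|exists x].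
have approx (e : R) : 0 < e -> exists x, Psi x < m + e.
  by move=> e0; have [_ [x _ <-] hx] := inf_adherent e0 hi; exists x.
have [U UU hU] : exists2 U : set_system X, UltraFilter U &
    forall n, U [set x | Psi x <= m + n.+1%:R^-1].
  apply: ultra_fip => s; pose N := (\big[maxn/0]_(n <- s) n)%N.
  have [x hx] : exists x, Psi x < m + N.+1%:R^-1 by apply: approx; rewrite invr_gt0 ltr0n.
  exists x => n ns /=; apply: (le_trans (ltW hx)); rewrite lerD2l lef_pV2 ?posrE ?ltr0n//.
  rewrite ler_nat ltnS /N; elim: s ns {N hx} => //= a s IH [->|/IH h].
    by rewrite big_cons leq_maxl.
  by rewrite big_cons leq_max h orbT.
have [x1 hx1] := filter_ex (hU 0%N).
have [b _ hb] : exists2 b, d x1 b <= 2 & id @ U --> b.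
  apply: (proper_ultra_cvg UU XP).
  move: (hU 0%N); apply: filterS => x /= hx; have := UC x1 x; have := mle (mid x1 x).
  move: hx hx1 => /=; rewrite invr1 => hx hx1 h1 h2.
  by apply: ler_sqr_mdist => //; lra.
exists b; apply: midconvex_argmin => // z; apply: le_trans (mle z).
apply/ler_addgt0Pr => e e0; have e2 : 0 < e / 2 by lra.
have [r r0 hr] := lsc b (e / 2) e2.
have /mcvgP hbr := hb.
have [x [/= hx1' hx2]] := filter_ex (filterI (hbr r r0) (hU (Num.truncn (e / 2)^-1))).
have h3 := hr x hx1'.
have h4 : (Num.truncn (e / 2)^-1).+1%:R^-1 <= e / 2.
  rewrite -[leRHS]invrK lef_pV2 ?posrE ?invr_gt0 ?ltr0n//.
  by rewrite ltW// truncnS_gt.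
by have h5 := le_trans hx2 (lerD (lexx m) h4); lra.
Qed.

End Argmin.

(** * Means and their barycenters *)

Section Mean.
Variables (R : realType) (T : Type).
Implicit Types (S : set T) (D : set (T -> R)) (L : (T -> R) -> R).

(** An abstract probability carried by [S], with [D] as its integrable functions. It covers finite
    weighted sums, where [D] is everything, and normalized Haar averages, where [D] consists of the
    continuous functions. *)
Record is_mean S D L : Prop := IsMean {
  mean_dom_cst : forall a : R, D (fun _ => a);
  mean_dom_lin : forall (a : R) f g, D f -> D g -> D (fun t => a * f t + g t);
  mean_lin : forall (a : R) f g, D f -> D g ->
    L (fun t => a * f t + g t) = a * L f + L g;
  mean_le : forall f g, D f -> D g -> (forall t, S t -> f t <= g t) -> L f <= L g;
  mean_cst1 : L (fun _ => 1) = 1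
}.

Variables (S : set T) (D : set (T -> R)) (L : (T -> R) -> R).
Hypothesis LM : is_mean S D L.

Lemma mean_domD f g : D f -> D g -> D (fun t => f t + g t).
Proof.
move=> Df Dg; have := mean_dom_lin LM 1 Df Dg; congr D.
by apply/funext => t; rewrite mul1r.
Qed.

Lemma mean_domZ (a : R) f : D f -> D (fun t => a * f t).
Proof.
move=> Df; have := mean_dom_lin LM a Df (mean_dom_cst LM 0); congr D.
by apply/funext => t; rewrite addr0.
Qed.

Lemma meanD f g : D f -> D g -> L (fun t => f t + g t) = L f + L g.
Proof.
move=> Df Dg; rewrite -[L f]mul1r -(mean_lin LM)//; congr L.
by apply/funext => t; rewrite mul1r.
Qed.

Lemma mean_cst0 : L (fun _ => 0) = 0.
Proof.
have := mean_lin LM (-1) (mean_dom_cst LM 1) (mean_dom_cst LM 1).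
rewrite (mean_cst1 LM) mulN1r addNr => h; rewrite -[RHS]h; congr L.
Qed.

Lemma meanZ (a : R) f : D f -> L (fun t => a * f t) = a * L f.
Proof.
move=> Df; rewrite -[RHS]addr0 -mean_cst0 -(mean_lin LM)//; last exact: (mean_dom_cst LM).
by congr L; apply/funext => t; rewrite addr0.
Qed.

Lemma mean_cst (a : R) : L (fun _ => a) = a.
Proof.
rewrite -[RHS]mulr1 -(mean_cst1 LM) -meanZ; last exact: (mean_dom_cst LM).
by congr L; apply/funext => t; rewrite mulr1.
Qed.

Lemma meanB f g : D f -> D g -> L (fun t => f t - g t) = L f - L g.
Proof.
move=> Df Dg; rewrite -mulN1r -meanZ// -meanD//; last exact: mean_domZ.
by congr L; apply/funext => t; rewrite mulN1r.
Qed.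

Lemma mean_domB f g : D f -> D g -> D (fun t => f t - g t).
Proof.
move=> Df Dg; have := mean_domD Df (mean_domZ (-1) Dg); congr D.
by apply/funext => t; rewrite mulN1r.
Qed.

Lemma mean_sum (I : Type) (s : seq I) (F : I -> T -> R) : (forall i, D (F i)) ->
  D (fun t => \sum_(i <- s) F i t) /\
  L (fun t => \sum_(i <- s) F i t) = \sum_(i <- s) L (F i).
Proof.
move=> DF; elim: s => [|i s [IH1 IH2]].
  under eq_fun do rewrite big_nil; rewrite big_nil.
  by split; [exact: mean_dom_cst LM _|exact: mean_cst].
under eq_fun do rewrite big_cons; rewrite big_cons; split; first exact: mean_domD.
by rewrite meanD// IH2.
Qed.

End Mean.

Section Barycenter.
Variables (R : realType) (X : metricType R).
Hypotheses (XC : is_CAT0 X) (XP : is_proper X).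
Local Notation d := (@mdist R X).
Variable T : Type.

Definition meansq (L : (T -> R) -> R) (y : T -> X) (z : X) : R :=
  L (fun t => d z (y t) ^+ 2).

Section OneMean.
Variables (S : set T) (D : set (T -> R)) (L : (T -> R) -> R).
Hypothesis LM : is_mean S D L.

Lemma barycenter_exists (y : T -> X) (x0 : X) (r : R) :
  (forall z, D (fun t => d z (y t) ^+ 2)) -> (forall t, S t -> d x0 (y t) <= r) ->
  exists b, is_argmin (meansq L y) b.
Proof.
move=> Dy yr.
have sq (z : X) := mean_domZ LM (2^-1) (Dy z).
apply: (argmin_exists XC XP (lb := 0) x0).
- move=> u v; rewrite /meansq.
  apply: (@le_trans _ _ (L (fun t => (2^-1 * d u (y t) ^+ 2 + 2^-1 * d v (y t) ^+ 2)
      - d u v ^+ 2 / 4))).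
    apply: (mean_le LM) => //.
      by apply: (mean_domB LM); [exact: (mean_domD LM)|exact: mean_dom_cst LM _].
    move=> t St; have := CN_mid XC u v (y t).
    by rewrite !(metric_sym (y t)); lra.
  rewrite (meanB LM)//; [|exact: (mean_domD LM)|exact: mean_dom_cst LM _].
  rewrite (mean_cst LM) (meanD LM)// !(meanZ LM)//.
  by lra.
- move=> z; rewrite -(mean_cst LM 0); apply: (mean_le LM) => //.
    exact: mean_dom_cst LM _.
  by move=> t _; exact: sqr_ge0.
- move=> b e e0; pose M := `|r| + d b x0 + 1.
  have M0 : 0 < M by rewrite /M; have := normr_ge0 r; have := mdist_ge0 b x0; lra.
  pose q := Num.min 1 (e / (2 * M + 2)).
  have q0 : 0 < q by rewrite lt_min ltr01/= divr_gt0//; lra.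
  exists q => // z bz.
  have q1 : q <= 1 by rewrite ge_min lexx.
  have qe : q * (2 * M + 2) <= e.
    by rewrite -ler_pdivlMr; [rewrite ge_min lexx orbT|lra].
  rewrite /meansq -(mean_cst LM e) -(meanD LM)//; last exact: mean_dom_cst LM _.
  apply: (mean_le LM) => //.
    by apply: (mean_domD LM) => //; exact: mean_dom_cst LM _.
  move=> t St; have h1 := yr t St; have h2 := metric_triangle b x0 (y t).
  have h3 := metric_triangle b z (y t); have h4 := ler_norm r.
  have h5 : 0 <= d b z := mdist_ge0 _ _; have h6 : 0 <= d z (y t) := mdist_ge0 _ _.
  have h7 : 0 <= d b (y t) := mdist_ge0 _ _.
  have h8 : d b (y t) <= M by rewrite /M; lra.
  have h9 : d b (y t) - d z (y t) <= q by lra.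
  have [le|lt] := leP (d b (y t)) (d z (y t)).
    by have : d b (y t) ^+ 2 <= d z (y t) ^+ 2; [rewrite lerXn2r|lra].
  have h10 : (d b (y t) - d z (y t)) * (d b (y t) + d z (y t)) <= q * (2 * M).
    by apply: ler_pM; lra.
  by nra.
Qed.

(** Adding the growth inequalities of [b] at [b'] and of [b'] at [b] bounds [2 * d b b' ^+ 2] by the
    mean of [qprod b b' (y t) (y' t)]; the quadrilateral inequality absorbs one of the two
    squares. *)
Lemma barycenter_sqr_mdist (y y' : T -> X) (b b' : X) :
  (forall z, D (fun t => d z (y t) ^+ 2)) -> (forall z, D (fun t => d z (y' t) ^+ 2)) ->
  D (fun t => d (y t) (y' t) ^+ 2) ->
  is_argmin (meansq L y) b -> is_argmin (meansq L y') b' ->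
  d b b' ^+ 2 <= L (fun t => d (y t) (y' t) ^+ 2).
Proof.
move=> Dy Dy' Dyy' hb hb'.
have h1 := hb b'; have h2 := hb' b; rewrite (metric_sym b' b) in h1.
have h3 : L (fun t => (d b (y' t) ^+ 2 + d b' (y t) ^+ 2) -
    (d b (y t) ^+ 2 + d b' (y' t) ^+ 2)) <=
    L (fun t => d b b' ^+ 2 + d (y t) (y' t) ^+ 2).
  apply: (mean_le LM).
  - by apply: (mean_domB LM); exact: (mean_domD LM).
  - by apply: (mean_domD LM) => //; exact: mean_dom_cst LM _.
  - move=> t _; have := qprod_le_sqr XC b b' (y t) (y' t); rewrite /qprod.
    by lra.
rewrite (meanB LM) in h3; [|exact: (mean_domD LM)|exact: (mean_domD LM)].
rewrite !(meanD LM) ?(mean_cst LM) in h3 => //; last exact: mean_dom_cst LM _.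
by rewrite /meansq in h1 h2; lra.
Qed.

Lemma barycenter_mdist_le (y : T -> X) (b z : X) (r : R) :
  (forall z, D (fun t => d z (y t) ^+ 2)) -> is_argmin (meansq L y) b ->
  0 <= r -> (forall t, S t -> d z (y t) <= r) -> d z b <= r.
Proof.
move=> Dy hb r0 zr; apply: ler_sqr_mdist => //.
have h1 := hb z.
have h2 : 0 <= meansq L y b.
  rewrite -(mean_cst LM 0); apply: (mean_le LM) => //; first exact: mean_dom_cst LM _.
  by move=> t _; exact: sqr_ge0.
have h3 : meansq L y z <= r ^+ 2.
  rewrite -(mean_cst LM (r ^+ 2)); apply: (mean_le LM) => //.
    exact: mean_dom_cst LM _.
  by move=> t St; rewrite lerXn2r ?nnegrE ?mdist_ge0 ?zr.
by lra.
Qed.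

End OneMean.

(** The sum of the two growth inequalities is [L - L'] applied to
    [d b' (y t) ^+ 2 - d b (y t) ^+ 2], a function bounded by [d b b' * (2 * r)]; dividing by
    [d b b'] makes the estimate linear in [e]. *)
Lemma barycenter_close (S : set T) (D : set (T -> R)) (L L' : (T -> R) -> R)
    (y : T -> X) (b b' : X) (r e : R) :
  is_mean S D L -> is_mean S D L' ->
  (forall z, D (fun t => d z (y t) ^+ 2)) ->
  is_argmin (meansq L y) b -> is_argmin (meansq L' y) b' ->
  (forall t, S t -> d b (y t) <= r /\ d b' (y t) <= r) -> 0 <= r -> 0 <= e ->
  (forall f (B : R), D f -> 0 <= B -> (forall t, S t -> `|f t| <= B) -> L f - L' f <= e * B) ->
  d b b' <= e * r.
Proof.
move=> LM LM' Dy hb hb' yr r0 e0 LL'.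
have h1 := hb b'; have h2 := hb' b; rewrite (metric_sym b' b) in h1.
have bb0 : 0 <= d b b' := mdist_ge0 _ _.
have h3 := LL' (fun t => d b' (y t) ^+ 2 - d b (y t) ^+ 2) (d b b' * (2 * r)).
have {}h3 : L (fun t => d b' (y t) ^+ 2 - d b (y t) ^+ 2) -
    L' (fun t => d b' (y t) ^+ 2 - d b (y t) ^+ 2) <= e * (d b b' * (2 * r)).
  apply: h3; first exact: (mean_domB LM).
    by rewrite mulr_ge0//; lra.
  move=> t St; have [t1 t2] := yr t St.
  rewrite subr_sqr normrM ler_pM//.
    have := ler_mdist_mdist b' (y t) b (y t).
    by rewrite mdistxx addr0 (metric_sym b' b).
  by rewrite ger0_norm ?addr_ge0 ?mdist_ge0//; lra.
rewrite (meanB LM)// (meanB LM')// in h3.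
rewrite /meansq in h1 h2.
have h4 : d b b' * d b b' <= d b b' * (e * r) by nra.
have [bb|bb] := eqVneq (d b b') 0; first by rewrite bb mulr_ge0.
by rewrite ler_pM2l// in h4; rewrite lt_neqAle eq_sym bb.
Qed.

End Barycenter.

(** * The boundary at infinity *)

Section ConeTopology.
Variables (R : realType) (X : metricType R).
Hypotheses (XC : is_CAT0 X) (XP : is_proper X).
Local Notation d := (@mdist R X).
Local Notation bd := (boundary X).
Implicit Types (c : ray X) (xi eta : bd) (r e t : R).

Lemma ray_at (x : X) xi : exists2 c : ray X, c 0 = x & \pi_bd c = xi.
Proof.
have [c c0 ce] := ray_from_asymptotic XC XP x (repr xi).
exists c => //; rewrite -(reprK xi); exact/pi_boundaryP.
Qed.

Lemma cone_cvg (F : set_system bd) (FF : Filter F) xi :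
  (forall c r e, 0 < r -> 0 < e -> cone_nbhs c r e xi -> F (cone_nbhs c r e)) ->
  F --> xi.
Proof.
move=> h A; rewrite nbhsE => -[_ [[B sB <-] [C BC Ct]] sUBA].
rewrite nbhs_filterE; apply: filterS sUBA _; apply: (@filterS _ _ _ C).
  by move=> ? ?; exists C.
have /sB [D sD IDeC] := BC; rewrite -IDeC; apply: filter_bigI => E DE.
have /sD := DE; rewrite inE => -[c [r [e [r0 e0 EE]]]].
rewrite EE; apply: h => //; rewrite -EE.
by move: Ct; rewrite -IDeC; exact.
Qed.

Lemma nbhs_cone_nbhs c r e xi : 0 < r -> 0 < e -> cone_nbhs c r e xi ->
  nbhs xi (cone_nbhs c r e).
Proof.
move=> r0 e0 h; rewrite nbhsE; exists (cone_nbhs c r e) => //; split => //.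
exists [set cone_nbhs c r e]; last by rewrite bigcup_set1.
move=> _ ->; exists [fset cone_nbhs c r e]%fset.
  by move=> ?; rewrite inE inE => /eqP ->; exists c, r, e.
rewrite predeqE => eta; split=> [h1|h1 B]; last by rewrite /= inE => /eqP ->.
by apply: (h1 (cone_nbhs c r e)); rewrite /= inE.
Qed.

Lemma cone_nbhsxx c r e xi : 0 < e -> \pi_bd c = xi -> cone_nbhs c r e xi.
Proof. by move=> e0 cxi; exists c; rewrite mdistxx. Qed.

(** One ray and tolerance 1 suffice: by [rays_base_change], what happens at a far time [r'] is
    shrunk by [r / r'] at time [r], whatever the origins. *)
Lemma cone_cvg_at (T : Type) (F : set_system T) (FF : Filter F) (u : T -> bd) c xi :
  \pi_bd c = xi -> (forall r, 0 < r -> \forall t \near F, cone_nbhs c r 1 (u t)) ->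
  u @ F --> xi.
Proof.
move=> cxi h; apply: cone_cvg => c1 r e r0 e0 [c1' [c1'xi c1'0 c1'r]].
pose K := d (c1 0) (c 0).
have K0 : 0 <= K := mdist_ge0 _ _.
pose eps := e - d (c1' r) (c1 r).
have eps0 : 0 < eps by rewrite /eps subr_gt0.
(* [2 * K + 1] collects two changes of origin and the tolerance 1; its fraction [r / r'] must be
   less than the room [eps] left by [c1']. *)
pose r' := r + r * (2 * K + 1) / eps + 1.
have q0 : 0 <= r * (2 * K + 1) / eps.
  by rewrite divr_ge0 ?(ltW eps0)// mulr_ge0 ?(ltW r0)//; lra.
have r'0 : 0 < r' by rewrite /r'; lra.
have := h r' r'0; apply: filterS => t [c' [c't c'0 c'r]].
have [e1 e10 e1t] := ray_at (c1 0) (u t).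
exists e1; split => //.
have a1 : asymptotic e1 c' by apply/pi_boundaryP; rewrite e1t.
have a2 : asymptotic c1' c by apply/pi_boundaryP; rewrite c1'xi.
have rr' : 0 <= r <= r' by rewrite /r'; lra.
have e1c : e1 0 = c1' 0 by rewrite e10.
have := rays_base_change XC e1c a1 a2 rr' r'0.
rewrite e10 c1'0 c'0 -/K => h1.
have h2 : r / r' * (K + K + d (c' r') (c r')) <= r / r' * (2 * K + 1).
  by apply: ler_wpM2l; [rewrite divr_ge0// ltW|lra].
have h3 : r / r' * (2 * K + 1) < eps.
  rewrite mulrAC ltr_pdivrMr// mulrC -ltr_pdivrMl// mulrC /r'; lra.
have h4 := metric_triangle (e1 r) (c1' r) (c1 r).
by rewrite /eps in h3; lra.
Qed.

Lemma closed_boundary (C : set bd) :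
  (forall xi, ~ C xi -> exists c r e,
     [/\ 0 < r, 0 < e, \pi_bd c = xi & cone_nbhs c r e `&` C = set0]) -> closed C.
Proof.
move=> h xi cl; apply: contrapT => nC; have [c [r [e [r0 e0 cxi h0]]]] := h xi nC.
have [eta [Ceta ceta]] := cl _ (nbhs_cone_nbhs r0 e0 (cone_nbhsxx r e0 cxi)).
by have : (cone_nbhs c r e `&` C) eta by []; rewrite h0.
Qed.

Lemma boundary_ray_eq c c' xi t : \pi_bd c = xi -> \pi_bd c' = xi -> c 0 = c' 0 ->
  0 <= t -> c t = c' t.
Proof.
move=> cxi c'xi; apply: asymptotic_eq => //; apply/pi_boundaryP.
by rewrite cxi.
Qed.

Lemma closed_boundary1 xi : [set: X] !=set0 -> closed [set xi].
Proof.
move=> [x _]; apply: closed_boundary => eta /= ne.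
have [c c0 ceta] := ray_at x eta; have [c' c'0 c'xi] := ray_at x xi.
have [r r0 cr] : exists2 r, 0 < r & c r <> c' r.
  apply: contrapT => nr; apply: ne; rewrite -ceta -c'xi; apply/pi_boundaryP.
  apply/asymptoticP; exists 0 => t t0; have [->|tn0] := eqVneq t 0.
    by rewrite c0 c'0 mdistxx.
  have -> : c t = c' t; last by rewrite mdistxx.
  by apply: contrapT => nt; apply: nr; exists t => //; rewrite lt_neqAle eq_sym tn0.
exists c, r, (d (c r) (c' r)); split => //.
  by rewrite mdist_gt0; exact/eqP.
apply/seteqP; split=> // zeta [[e [ezeta e0 er]] /= zxi].
have := @boundary_ray_eq e c' xi r; rewrite ezeta => /(_ zxi c'xi).
rewrite e0 c0 c'0 => /(_ erefl (ltW r0)) E; move: er.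
by rewrite E metric_sym ltxx.
Qed.

(* Limits of segments from [x0] to points moved sublinearly give rays moved a
   bounded amount. *)
Lemma fixed_point_at_infinity_or_displacement (A : Type) (m : A -> isometric_map X)
    (x0 : X) :
  (exists xi, forall a, boundary_map (m a) xi = xi) \/
  (exists (s : seq A) (k K : R), 0 < k /\ forall z, K <= d x0 z ->
     exists2 a, List.In a s & k * d x0 z < d (m a z) z).
Proof.
have [h|h] := pselect (exists (s : seq A) (k K : R), 0 < k /\ forall z, K <= d x0 z ->
     exists2 a, List.In a s & k * d x0 z < d (m a z) z); [by right|left].
have far (s : seq A) (k K : R) : 0 < k -> exists2 z, K <= d x0 z &
    forall a, List.In a s -> d (m a z) z <= k * d x0 z.
  move=> k0; apply: contrapT => hz; apply: h; exists s, k, K; split => // z Kz.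
  apply: contrapT => ha; apply: hz; exists z => // a sa; rewrite leNgt.
  by apply/negP => lt; apply: ha; exists a.
(* The pairs [(None, n)] send [z] to infinity; the pairs [(Some a, n)] make its displacement under
   [m a] sublinear. *)
pose P (p : option A * nat) (z : X) := p.2%:R <= d x0 z /\
  if p.1 is Some a then d (m a z) z <= p.2.+1%:R^-1 * d x0 z else True.
have [U UU hU] : exists2 U : set_system X, UltraFilter U & forall p, U (P p).
  apply: ultra_fip => s.
  pose N := (\big[maxn/0]_(p <- s) p.2)%N.
  have leN p : List.In p s -> (p.2 <= N)%N.
    rewrite /N; elim: s {N} => //= b s IH [->|/IH hp]; rewrite big_cons.
      by rewrite leq_maxl.
    by rewrite leq_max hp orbT.
  have N0 : 0 < N.+1%:R^-1 :> R by rewrite invr_gt0.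
  have [z z1 z2] := far (pmap fst s) N.+1%:R^-1 N%:R N0.
  exists z => -[oa n] /[dup] /leN /= nN sp; split => /=.
    by apply: le_trans z1; rewrite ler_nat.
  case: oa sp => // a sp; apply: (@le_trans _ _ (N.+1%:R^-1 * d x0 z)).
    apply: z2; elim: s sp {leN N0 z1 N nN} => //= -[[b|] k] s IH [[]//|/IH hp].
    - by move=> -> _; left.
    - by right.
    - by [].
  apply: ler_wpM2r; first exact: mdist_ge0.
  by rewrite lef_pV2 ?posrE ?ltr0n// ler_nat ltnS.
have [r|c [c0 hc]] := segments_limit_ray XC XP UU (x := x0) (z := id).
  have := hU (None, (Num.truncn r).+1); apply: filterS => z [/= + _].
  by apply: le_trans; rewrite ltW// truncnS_gt.
exists (\pi_bd c) => a; rewrite boundary_mapE; apply/pi_boundaryP/asymptoticP.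
exists (d (m a x0) x0) => t t0.
have hmc : (fun z => m a (gpt x0 z (t / d x0 z))) @ U --> m a (c t).
  apply/mcvgP => e e0; have /mcvgP/(_ e e0) := hc t t0.
  by apply: filterS => z /=; rewrite isometric_mapP.
apply: (lim_mdist_le hmc (hc t t0)) => e e0.
near=> z.
pose n := Num.truncn (t / e).
have [/= _ z1] : P (Some a, n) z by near: z; exact: hU.
have [/= z2 _] : P (None, (Num.truncn (t + 1)).+1) z by near: z; exact: hU.
have tz : t + 1 < d x0 z by apply: lt_le_trans z2; exact: truncnS_gt.
have z0 : 0 < d x0 z by lra.
have s01 : 0 <= t / d x0 z <= 1 by rewrite divr_ge0 ?(ltW z0)//= ler_pdivrMr// mul1r; lra.
rewrite gpt_isometry//; apply: (le_trans (mdist_gpt XC _ _ _ _ s01)).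
apply: lerD.
  by rewrite -[leRHS]mul1r; apply: ler_wpM2r; [exact: mdist_ge0|lra].
apply: (@le_trans _ _ (t / d x0 z * (n.+1%:R^-1 * d x0 z))).
  by apply: ler_wpM2l => //; lra.
rewrite mulrCA divfK ?gt_eqF// mulrC ler_pdivrMr ?ltr0n// mulrC -ler_pdivrMr//.
by rewrite ltW// truncnS_gt.
Unshelve. all: by end_near. Qed.

End ConeTopology.

(** * Boundaries of convex sets and actions on them *)

Section BoundaryAction.
Variables (R : realType) (X : metricType R).
Hypotheses (XC : is_CAT0 X) (XP : is_proper X).
Local Notation d := (@mdist R X).
Local Notation bd := (boundary X).
Implicit Types (c : ray X) (xi eta : bd) (r e t : R).

Definition ray_in (Y : set X) c := forall t, 0 <= t -> Y (c t).

Definition boundary_of (Y : set X) : set bd :=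
  [set xi | exists2 c, ray_in Y c & \pi_bd c = xi].

Section ConvexSet.
Variables (Y : set X) (y0 : X).
Hypotheses (Ycl : closed Y) (Ycv : gpt_convex Y) (Yy0 : Y y0).

Lemma boundary_of_ray_at xi y : boundary_of Y xi -> Y y ->
  exists c, [/\ c 0 = y, \pi_bd c = xi & ray_in Y c].
Proof.
move=> [c cY cxi] Yy.
have [c' [c'0 c'c c'Y]] := ray_from_asymptotic_in XC XP Ycl Ycv Yy cY.
by exists c'; split => //; rewrite -cxi; exact/pi_boundaryP.
Qed.

Lemma boundary_of_neq0 : (forall r, exists2 y, Y y & r <= d y0 y) ->
  boundary_of Y !=set0.
Proof.
move=> far.
have [U UU hU] : exists2 U : set_system X, UltraFilter U &
    forall r, U [set z | Y z /\ r <= d y0 z].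
  apply: ultra_fip => s.
  have [z Yz hz] := far (\big[Num.max/0]_(r <- s) r).
  exists z => r sr; split=> //; apply: le_trans hz.
  elim: s sr => //= b s IH [->|/IH h]; rewrite big_cons le_max ?lexx//.
  by rewrite h orbT.
have [r|c [c0 hc]] := segments_limit_ray XC XP UU (x := y0) (z := id).
  by have := hU r; apply: filterS => z [].
exists (\pi_bd c), c => // t t0; apply: (closed_cvg Y Ycl _ _ (hc t t0)).
by have := hU 0; apply: filterS => z [Yz _]; exact: Ycv.
Qed.

(** A ray from [y0] with class outside this set leaves [Y] at some time [r]. So do the rays from
    [y0] close to it at time [r], whereas a ray from [y0] with class in the set stays in [Y]. *)
Lemma closed_boundary_of : closed (boundary_of Y).
Proof.
apply: closed_boundary => // xi nC.
have [c c0 cxi] := ray_at XC XP y0 xi.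
have [r r0 nY] : exists2 r, 0 < r & ~ Y (c r).
  apply: contrapT => h; apply: nC; exists c => // t t0.
  have [->|tn0] := eqVneq t 0; first by rewrite c0.
  by apply: contrapT => nY; apply: h; exists t => //; rewrite lt_neqAle eq_sym tn0.
have : nbhs (c r) (~` Y) by apply: open_nbhs_nbhs; split => //; exact: closed_openC.
rewrite -metricType_numDomainType.filter_from_mdist_nbhs => -[e /= e0 he].
exists c, r, e; split => //; apply/seteqP; split => // eta [[c' [c'eta c'0 c'r]] Ceta].
have [c1 [c10 c1eta c1Y]] := boundary_of_ray_at Ceta Yy0.
apply: (he (c' r)); first by rewrite /= metric_sym.
have -> : c' r = c1 r; last exact: c1Y (ltW r0).
by apply: (boundary_ray_eq XC c'eta c1eta) (ltW r0); rewrite c'0 c0 c10.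
Qed.

End ConvexSet.

(** [H] acts on a class through its rays inside [Y]. On [Y], [m g] is only at bounded distance from
    the action of [q g], and [Y] need not be stable under it; asymptotic classes do not see the
    difference. *)
Lemma boundary_extension (H : topologicalGroupType) (A : Type)
    (m : A -> isometric_map X) (q : A -> H) (Y : set X) (y0 : X) (a : H -> X -> X) :
  closed Y -> gpt_convex Y -> Y y0 -> (forall r, exists2 y, Y y & r <= d y0 y) ->
  (forall h y, Y y -> Y (a h y)) ->
  (forall y, Y y -> a 1%g y = y) ->
  (forall h h' y, Y y -> a (h * h')%g y = a h (a h' y)) ->
  (forall h y y', Y y -> Y y' -> d (a h y) (a h y') = d y y') ->
  (forall y, Y y -> continuous (fun h => a h y)) ->
  (forall g, exists B, forall y, Y y -> d (m g y) (a (q g) y) <= B) ->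
  exists C : set bd, [/\ C !=set0, closed C,
    (forall g, boundary_map (m g) @` C = C) &
    exists b : H -> C -> C, continuous_action b /\
      forall g (xi : C), val (b (q g) xi) = boundary_map (m g) (val xi)].
Proof.
move=> Ycl Ycv Yy0 far aY a1 aM aI aC mB.
pose C := boundary_of Y.
pose mkC x (h : x \in C) : C := exist (fun x => x \in C) x h.
have aray h c : ray_in Y c -> exists2 c' : ray X, ray_in Y c' &
    forall t, 0 <= t -> c' t = a h (c t).
  move=> cY.
  have cP s t : 0 <= s -> 0 <= t -> d (a h (c s)) (a h (c t)) = `|s - t|.
    by move=> s0 t0; rewrite aI ?rayP//; exact: cY.
  by exists (Ray cP) => t t0 //=; apply: aY; exact: cY.
have Bex (p : H * C) : exists eta : C, exists c c' : ray X,
    [/\ ray_in Y c, \pi_bd c = val p.2, \pi_bd c' = val eta &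
        forall t, 0 <= t -> c' t = a p.1 (c t)].
  case: p => h [xi /= xiC]; have /set_mem[c cY cxi] := xiC.
  have [c' c'Y c'E] := aray h c cY.
  have c'C : \pi_bd c' \in C by apply/mem_set; exists c'.
  by exists (mkC _ c'C), c, c'.
have /choice[b bP] := Bex.
have bE h (xi : C) c c' : ray_in Y c -> \pi_bd c = val xi ->
    (forall t, 0 <= t -> c' t = a h (c t)) -> val (b (h, xi)) = \pi_bd c'.
  move=> cY cxi c'E; have [c1 [c1' [c1Y /= c1xi <- c1'E]]] := bP (h, xi).
  apply/pi_boundaryP/asymptoticP.
  have /pi_boundaryP/asymptoticP[K hK] : \pi_bd c1 = \pi_bd c by rewrite c1xi.
  exists K => t t0; rewrite c1'E// c'E// aI; [exact: hK|exact: c1Y|exact: cY].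
have Cray (xi : C) y : Y y -> exists c, [/\ c 0 = y, \pi_bd c = val xi & ray_in Y c].
  by apply: boundary_of_ray_at => //; exact: set_mem (valP xi).
have bm g (xi : C) : val (b (q g, xi)) = boundary_map (m g) (val xi).
  have [c [_ cxi cY]] := Cray xi y0 Yy0.
  have [c' c'Y c'E] := aray (q g) c cY.
  rewrite (bE _ _ c c')// -cxi boundary_mapE; apply/pi_boundaryP/asymptoticP.
  have [B hB] := mB g; exists B => t t0; rewrite c'E// metric_sym; apply: hB.
  exact: cY.
have b1 (xi : C) : b (1%g, xi) = xi.
  have [c [_ cxi cY]] := Cray xi y0 Yy0; apply: val_inj.
  by rewrite (bE _ _ c c)// => t t0; rewrite a1//; exact: cY.
have bM h h' (xi : C) : b ((h * h')%g, xi) = b (h, b (h', xi)).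
  have [c [_ cxi cY]] := Cray xi y0 Yy0; apply: val_inj.
  have [c' c'Y c'E] := aray h' c cY; have [c'' c''Y c''E] := aray h c' c'Y.
  rewrite (bE _ _ c c'')//; last first.
    by move=> t t0; rewrite aM ?c''E ?c'E//; exact: cY.
  by rewrite (bE _ _ c' c'')//; rewrite (bE _ _ c c').
exists C; split.
- exact: boundary_of_neq0 Yy0 far.
- exact: closed_boundary_of Yy0.
- move=> g; apply/seteqP; split=> [_ [xi Cxi <-]|xi Cxi].
    have xiC : xi \in C by apply/mem_set.
    by have := bm g (mkC xi xiC) => /= <-; exact: set_mem (valP _).
  have xiC : xi \in C by apply/mem_set.
  pose eta := b ((q g)^-1%g, mkC xi xiC).
  exists (val eta); first exact: set_mem (valP eta).
  by rewrite -bm /eta -bM mulgV b1.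
exists (fun h (xi : C) => b (h, xi)); split; last exact: bm.
split; first by split=> [xi|h h' xi]; [exact: b1|exact: bM].
apply: continuous_comp_initial => -[h0 xi0] /=.
have [c0 [c00 c0xi c0Y]] := Cray xi0 y0 Yy0.
have [b0 b0Y b0E] := aray h0 c0 c0Y.
pose eta0 := val (b (h0, xi0)).
have b0eta : \pi_bd b0 = eta0 by rewrite /eta0 (bE _ _ c0 b0).
have [e0 e00 e0eta] := ray_at XC XP y0 eta0.
suff: (fun p : H * C => val (b (p.1, p.2))) @ nbhs (h0, xi0) --> eta0 by [].
apply: (cone_cvg_at XC XP _ e0eta) => r r0.
pose D := d y0 (a h0 y0); have D0 : 0 <= D := mdist_ge0 _ _.
(* The origins are moved by at most [D] and less than [D + 1], and the image rays are less than 2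
   apart at time [r']; the total is below [2 * D + 4 = r' / r]. *)
pose r' := r * (2 * D + 4).
have rr' : 0 <= r <= r' by rewrite (ltW r0)/= /r'; nra.
have r'0 : 0 < r' by lra.
have c0r'Y : Y (c0 r') by apply: c0Y; exact: ltW.
have N1 y : Y y -> nbhs (h0, xi0) [set p : H * C | d (a h0 y) (a p.1 y) < 1].
  move=> Yy; have /mcvgP/(_ 1 ltr01) h := aC y Yy h0.
  by apply: (cvg_fst (F := nbhs h0) (G := nbhs xi0)) h.
have N2 : nbhs (h0, xi0) [set p : H * C | cone_nbhs c0 r' 1 (val p.2)].
  have h : nbhs xi0 [set xi : C | cone_nbhs c0 r' 1 (val xi)].
    have vc : {for xi0, continuous (fun x : C => val x)} by exact: initial_continuous.
    by apply: vc; apply: nbhs_cone_nbhs => //; exact: cone_nbhsxx.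
  by apply: (cvg_snd (F := nbhs h0) (G := nbhs xi0)) h.
apply: filterS _ (filterI (filterI (N1 _ Yy0) (N1 _ c0r'Y)) N2) => -[h xi] /= [[h1 h2] [c1 [c1xi
  c10 c1r']]].
have c1Y : ray_in Y c1.
  have [c2 [c20 c2xi c2Y]] := Cray xi y0 Yy0.
  move=> t t0; have -> : c1 t = c2 t; last exact: c2Y.
  by apply: (boundary_ray_eq XC c1xi c2xi) t0; rewrite c10 c00 c20.
have [b1' b1'Y b1'E] := aray h c1 c1Y.
have b1'eta : \pi_bd b1' = val (b (h, xi)) by rewrite (bE _ _ c1 b1').
have [e1 e10 e1eta] := ray_at XC XP y0 (val (b (h, xi))).
exists e1; rewrite e10 e00; split => //.
have as1 : asymptotic e1 b1' by apply/pi_boundaryP; rewrite e1eta.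
have as0 : asymptotic e0 b0 by apply/pi_boundaryP; rewrite e0eta.
have e10' : e1 0 = e0 0 by rewrite e10.
apply: (le_lt_trans (rays_base_change XC e10' as1 as0 rr' r'0)).
rewrite e10 e00 !b1'E ?lexx ?(ltW r'0)// !b0E ?lexx ?(ltW r'0)// c10 c00.
have l1 := metric_triangle y0 (a h0 y0) (a h y0).
have l2 := metric_triangle (a h (c1 r')) (a h (c0 r')) (a h0 (c0 r')).
have Yc1r' : Y (c1 r') by apply: c1Y; exact: ltW.
rewrite aI// (metric_sym (a h (c0 r'))) in l2.
rewrite mulrAC ltr_pdivrMr// mul1r /r'.
by rewrite ltr_pM2l// -/D; rewrite -/D in l1; lra.
Qed.

End BoundaryAction.

(** * Topological groups and uniform lattices *)

Section Compactness.
Variable T : topologicalType.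

(** Otherwise some ultrafilter on [A] avoids every [O i], but it has a limit in [A], one of whose
    neighbourhoods is an [O i]. *)
Lemma compact_finite_cover (I : Type) (A : set T) (O : I -> set T) : compact A ->
  (forall x, A x -> exists i, nbhs x (O i)) ->
  exists s : seq I, forall x, A x -> exists2 i, List.In i s & O i x.
Proof.
move=> cA AO; apply: contrapT => h.
pose P (o : option I) : set T := if o is Some i then A `&` ~` O i else A.
have [U UU hU] : exists2 U : set_system T, UltraFilter U & forall o, U (P o).
  apply: ultra_fip => s.
  apply: contrapT => hs; apply: h; exists (pmap id s) => x Ax.
  apply: contrapT => hx; apply: hs; exists x => -[i|] si //=; split => // Oix.
  apply: hx; exists i => //; elim: s si => //= -[j|] s IH [] // .
  - by move=> [->]; left.
  - by move=> /IH; right.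
have [l Al lU] := compact_ultra_cvg UU (u := id) cA (hU None).
have [i li] := AO l Al.
have UO : U (O i) := lU _ li.
by have [x [Ox [_ /(_ Ox)]]] := filter_ex (filterI UO (hU (Some i))).
Qed.

Lemma locally_compact_nbhs (x : T) : locally_compact [set: T] ->
  exists K, [/\ nbhs x K, compact K & closed K].
Proof.
move=> /(_ x I)[K xK [cK clK]]; exists K; split => //.
by move: xK; rewrite /within/=; apply: filterS => y; exact.
Qed.

End Compactness.

Section TopologicalGroup.
Variable G : topologicalGroupType.
Implicit Types (x y g : G) (U V W K : set G).

Lemma cvg_mulg {T : Type} {F : set_system T} {FF : Filter F} (f h : T -> G) x y :
  f @ F --> x -> h @ F --> y -> (fun t => (f t * h t)%g) @ F --> (x * y)%g.
Proof.
move=> fx hy; exact: (cvg_comp _ _ (cvg_pair fx hy) (@mulg_continuous G (x, y))).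
Qed.

Lemma cvg_invg {T : Type} {F : set_system T} {FF : Filter F} (f : T -> G) x :
  f @ F --> x -> (fun t => (f t)^-1%g) @ F --> x^-1%g.
Proof. by move=> fx; exact: (cvg_comp _ _ fx (@invg_continuous G x)). Qed.

Lemma continuous_mulgl g : continuous (fun x => (g * x)%g).
Proof. by move=> x; apply: cvg_mulg; [exact: cvg_cst|exact: cvg_id]. Qed.

Lemma continuous_mulgr g : continuous (fun x => (x * g)%g).
Proof. by move=> x; apply: cvg_mulg; [exact: cvg_id|exact: cvg_cst]. Qed.

Lemma nbhs1_div U : nbhs 1%g U ->
  exists2 V, nbhs 1%g V & forall x y, V x -> V y -> U (x^-1 * y)%g /\ U (x * y^-1)%g.
Proof.
move=> U1.
have c1 : (fun p : G * G => (p.1^-1 * p.2)%g) @ (1%g, 1%g) --> (1 : G)%g.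
  rewrite -[X in _ --> X](mulVg (1 : G)%g).
  by apply: cvg_mulg; [apply: cvg_invg; exact: cvg_fst|exact: cvg_snd].
have c2 : (fun p : G * G => (p.1 * p.2^-1)%g) @ (1%g, 1%g) --> (1 : G)%g.
  rewrite -[X in _ --> X](mulgV (1 : G)%g).
  by apply: cvg_mulg; [exact: cvg_fst|apply: cvg_invg; exact: cvg_snd].
have n1 : nbhs ((1%g, 1%g) : G * G) [set p | U (p.1^-1 * p.2)%g] := c1 _ U1.
have n2 : nbhs ((1%g, 1%g) : G * G) [set p | U (p.1 * p.2^-1)%g] := c2 _ U1.
have [[A B] /= [A1 B1] h] := filterI n1 n2.
exists (A `&` B); first exact: filterI.
by move=> x y [Ax _] [_ By]; have := h (x, y) (conj Ax By).
Qed.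

Lemma nbhs_mulgl g U : nbhs 1%g U -> nbhs g [set x | U (g^-1 * x)%g].
Proof. by move=> U1; apply: (@continuous_mulgl g^-1%g g); rewrite mulVg. Qed.

Lemma nbhs_mulgr g U : nbhs 1%g U -> nbhs g [set x | U (x * g^-1)%g].
Proof. by move=> U1; apply: (@continuous_mulgr g^-1%g g); rewrite mulgV. Qed.

Lemma nbhs1_compact U : locally_compact [set: G] -> nbhs 1%g U ->
  exists K, [/\ nbhs 1%g K, compact K & K `<=` U].
Proof.
move=> lc U1; have [K [K1 cK clK]] := locally_compact_nbhs 1%g lc.
have [V V1 VU] := nbhs1_div U1.
exists (K `&` closure V); split.
- by apply: filterI => //; apply: filterS V1; exact: subset_closure.
- by apply: compact_closedI => //; exact: closed_closure.
- move=> x [_ clV]; have [y [Vy /= Vxy]] := clV _ (nbhs_mulgl x V1).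
  by have [_] := VU _ _ Vy Vxy; rewrite invgM invgK mulVKg.
Qed.

Lemma nbhs1_bump (R : realType) U : locally_compact [set: G] -> hausdorff_space G ->
  nbhs 1%g U -> exists chi : G -> R,
    [/\ continuous chi, forall x, 0 <= chi x, chi 1%g = 1 & forall x, chi x != 0 -> U x].
Proof.
move=> lc hG; rewrite nbhsE => -[W [oW W1] WU].
have clW : closed (~` W) by exact: open_closedC.
have nW : ~ (~` W) 1%g by apply.
have [f [fc f01 f0 f1]] := (@uniform_separatorP _ R _ _).1
  (@locally_compact_completely_regular G R lc hG 1%g _ clW nW).
exists (fun x => 1 - f x); split.
- by move=> x; apply: cvgB; [exact: cvg_cst|exact: fc].
- move=> x; have : `[0, 1]%classic (f x) by apply: f01; exists x.
  by rewrite /= in_itv/= subr_ge0 => /andP[].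
- have -> : f 1%g = 0 by apply: f0; exists 1%g.
  by rewrite subr0.
- move=> x fx; apply: WU; apply: contrapT => nWx.
  have fx1 : f x = 1 by apply: f1; exists x.
  by move: fx; rewrite fx1 subrr eqxx.
Qed.

(** That is, [U] injects into the quotient of [G] by [Gam]. *)
Definition separates (Gam U : set G) :=
  forall x y, U x -> U y -> Gam (x^-1 * y)%g -> x = y.

Lemma discrete_separates (Gam : subgroup G) : is_discrete Gam ->
  exists2 U, nbhs 1%g U & separates Gam U.
Proof.
move=> dG.
have [W oW WE] := dG 1%g.
have W1 : nbhs 1%g W.
  apply: open_nbhs_nbhs; split => //.
  by have : (val @^-1` W) (1%g : Gam) by rewrite WE.
have [V V1 VW] := nbhs1_div W1; exists V => // x y Vx Vy xy.
have mem : (x^-1 * y)%g \in (Gam : set G) by apply/mem_set.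
have : (val @^-1` W) (exist (fun z => z \in (Gam : set G)) _ mem : Gam).
  by have [h _] := VW _ _ Vx Vy.
rewrite WE /= => /(congr1 val) /= h.
by apply/esym/eqP; rewrite -(inj_eq (mulgI x^-1%g)) h mulVg.
Qed.

Lemma discrete_subgroup_closed (Gam : subgroup G) : hausdorff_space G -> is_discrete Gam ->
  closed (Gam : set G).
Proof.
move=> hG dG x clx.
have [U U1 US] := discrete_separates dG.
have [y [Gy Uy]] := clx _ (nbhs_mulgl x U1).
suff -> : x = y by [].
apply: hG => A B xA yB; have [z Gz [Uz Az]] : exists2 z, subgroup_set Gam z & U (x^-1 * z)%g /\ A z.
  have [z [Gz [? ?]]] := clx _ (filterI (nbhs_mulgl x U1) xA).
  by exists z.
exists z; split => //; suff -> : z = y by exact: nbhs_singleton.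
have : (x^-1 * z)%g = (x^-1 * y)%g.
  apply: US => //; rewrite invgM invgK mulgA mulgK.
  by apply: subgroupM => //; exact: subgroupV.
by move/mulgI.
Qed.

Lemma compact_mul_closed (K A : set G) : compact K -> closed A ->
  closed [set x | exists2 k, K k & A (k^-1 * x)%g].
Proof.
move=> cK clA x clx; apply: contrapT => h.
have /compact_near_coveringP nc := cK.
have : \forall y \near nbhs x, K `<=` (fun k => ~ A (k^-1 * y)%g).
  apply: (nc _ _ (fun y k => ~ A (k^-1 * y)%g)) => k Kk.
  have nA : ~ A (k^-1 * x)%g by move=> Akx; apply: h; exists k.
  have c : (fun p : G * G => (p.1^-1 * p.2)%g) @ (k, x) --> (k^-1 * x)%g.
    by apply: cvg_mulg; [apply: cvg_invg; exact: cvg_fst|exact: cvg_snd].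
  apply: (c (~` A)); apply: open_nbhs_nbhs; split => //; exact: closed_openC.
move=> /clx [y [[k Kk Aky] /(_ k Kk)]]; exact.
Qed.


(** * Transfer of functions supported near 1 to the coset space *)

Section Lattice.
Variable Gam : subgroup G.
Local Notation Gm := (subgroup_set Gam).

Lemma subgroup_div x y g : Gm (g^-1 * x)%g -> Gm (g^-1 * y)%g -> Gm (x^-1 * y)%g.
Proof.
move=> gx gy; have := subgroupM (subgroupV gx) gy.
by rewrite invgM invgK mulgA mulgK.
Qed.

Lemma subgroup_mulC x y : Gm (x^-1 * y)%g -> Gm (y^-1 * x)%g.
Proof. by move=> /subgroupV; rewrite invgM invgK. Qed.

Lemma pi_cosetP x y :
  \pi_(coset_space Gam) x = \pi_(coset_space Gam) y <-> Gm (x^-1 * y)%g.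
Proof.
split=> [/eqmodP/asboolP e|xy].
  have : left_coset Gam y y by exists 1%g; rewrite ?mulg1//; exact: subgroup1.
  by rewrite -e => -[h Gh <-]; rewrite mulKg.
apply/eqmodP/asboolP/seteqP; split=> _ [h Gh <-].
- exists (y^-1 * x * h)%g; first by apply: subgroupM => //; exact: subgroup_mulC.
  by rewrite !mulgA mulgV mul1g.
- exists (x^-1 * y * h)%g; first exact: subgroupM.
  by rewrite !mulgA mulgV mul1g.
Qed.

Lemma repr_coset x : Gm (x^-1 * repr (\pi_(coset_space Gam) x))%g.
Proof. by apply/pi_cosetP; rewrite reprK. Qed.

(** The images of finitely many translates of a compact neighbourhood of 1 cover the compact
    quotient; [Q] is the union of these translates. *)
Lemma uniform_fundamental_set : locally_compact [set: G] -> is_uniform Gam ->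
  exists2 Q : set G, compact Q & forall g, exists2 x, Q x & Gm (x^-1 * g)%g.
Proof.
move=> lc uG; have [K [K1 cK clK]] := locally_compact_nbhs 1%g lc.
pose W (q : coset_space Gam) : set G := [set x | K ((repr q)^-1 * x)%g].
pose O q := [set \pi_(coset_space Gam) x | x in (W q)°].
have [q _|s hs] := compact_finite_cover (O := O) uG.
  exists q; apply: open_nbhs_nbhs; split.
    rewrite /open/= /quotient_open openE => y /= [x Wx /esym/pi_cosetP yx].
    have n1 : nbhs (y * (y^-1 * x))%g (W q)°.
      by rewrite mulVKg; apply: open_nbhs_nbhs; split => //; exact: open_interior.
    have n2 : nbhs y [set z | (W q)° (z * (y^-1 * x))%g] := continuous_mulgr n1.
    apply: filterS n2 => z Wz; exists (z * (y^-1 * x))%g => //.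
    by apply/esym/pi_cosetP; rewrite mulKg.
  exists (repr q); last by rewrite reprK.
  exact: nbhs_mulgl.
exists [set x | exists2 q, List.In q s & W q x].
  elim: s {hs} => [|q s IH].
    by rewrite (_ : mkset _ = set0); [exact: compact0|apply/seteqP; split=> // x []].
  rewrite (_ : mkset _ = (fun x => (repr q * x)%g) @` K `|`
      [set x | exists2 q, List.In q s & W q x]).
    apply: compactU => //; apply: continuous_compact => //.
    by apply: continuous_subspaceT; exact: continuous_mulgl.
  apply/seteqP; split=> [x [q' /= [<- Wx|sq' Wx]]|x [[k Kk <-]|[q' sq' Wx]]].
  - by left; exists ((repr q)^-1 * x)%g; rewrite ?mulVKg.
  - by right; exists q'.
  - by exists q; [left|rewrite /W/= mulKg].
  - by exists q' => //; right.
move=> g; have [q sq [x Wx /pi_cosetP xg]] := hs (\pi_(coset_space Gam) g) I.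
exists x => //; exists q => //; exact: interior_subset Wx.
Qed.

Variables (R : realType) (U K : set G).
Hypotheses (oU : open U) (US : separates Gm U) (cK : compact K) (KU : K `<=` U).
Hypothesis clG : closed Gm.

Definition lifts g : set G := [set y | K y /\ Gm (g^-1 * y)%g].

(** For [F] supported in [K], this is the sum of [F (g * h)] over [h] in [Gam], a sum with at most
    one nonzero term because [K] lies in the separating set [U]. *)
Definition coset_lift (F : G -> R) g : R :=
  if `[< lifts g !=set0 >] then F (xget g (lifts g)) else 0.

Lemma lifts_uniq g x y : lifts g x -> lifts g y -> x = y.
Proof.
move=> [Kx gx] [Ky gy]; apply: US; [exact: KU|exact: KU|].
exact: subgroup_div gx gy.
Qed.

Lemma coset_liftE F g y : lifts g y -> coset_lift F g = F y.
Proof.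
move=> gy; rewrite /coset_lift asboolT; last by exists y.
by congr F; case: xgetP => [z _ gz|/(_ y)//]; exact: lifts_uniq gz gy.
Qed.

Lemma coset_lift0 F g : ~ (lifts g !=set0) -> coset_lift F g = 0.
Proof. by move=> h; rewrite /coset_lift asboolF. Qed.

Lemma coset_liftP F g : (exists2 y, lifts g y & coset_lift F g = F y) \/
  (~ (lifts g !=set0) /\ coset_lift F g = 0).
Proof.
have [[y gy]|h] := pselect (lifts g !=set0); last by right; rewrite coset_lift0.
by left; exists y => //; exact: coset_liftE.
Qed.

Lemma lifts_coset g g' y : Gm (g^-1 * g')%g -> lifts g y -> lifts g' y.
Proof.
move=> gg' [Ky gy]; split=> //; apply: subgroup_div gg' gy.
Qed.

Lemma coset_lift_eq F g g' : Gm (g^-1 * g')%g -> coset_lift F g = coset_lift F g'.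
Proof.
move=> gg'; have [[y gy ->]|[h ->]] := coset_liftP F g.
  by rewrite (coset_liftE F (lifts_coset gg' gy)).
rewrite coset_lift0// => -[y gy]; apply: h; exists y.
by apply: lifts_coset gy; exact: subgroup_mulC.
Qed.

Definition supported_in (F : G -> R) := continuous F /\ forall x, F x != 0 -> K x.

(** The point [g' * (g^-1 * y)] is congruent to [y'] and still lies in [U] when [g'] is near [g], so
    separation identifies the two. *)
Lemma near_lifts g y : lifts g y -> \forall g' \near nbhs g, forall y',
  lifts g' y' -> y' = (g' * (g^-1 * y))%g.
Proof.
move=> [Ky gy]; have n1 : nbhs (g * (g^-1 * y))%g U.
  by rewrite mulVKg; apply: open_nbhs_nbhs; split=> //; exact: KU.
have n2 : nbhs g [set g' | U (g' * (g^-1 * y))%g] := continuous_mulgr n1.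
apply: filterS n2 => g' Ug' y' [Ky' g'y'].
apply: US => //; first exact: KU.
have := subgroupM (subgroupV g'y') gy.
by rewrite !invgM !invgK !mulgA.
Qed.

Lemma near_nolifts g : ~ (lifts g !=set0) ->
  \forall g' \near nbhs g, ~ (lifts g' !=set0).
Proof.
move=> h; have clKG := compact_mul_closed cK clG.
have : nbhs g (~` [set x | exists2 k, K k & Gm (k^-1 * x)%g]).
  apply: open_nbhs_nbhs; split; first exact: closed_openC.
  move=> [k Kk kg]; apply: h; exists k; split=> //; exact: subgroup_mulC.
apply: filterS => g' h' [y [Ky g'y]]; apply: h'; exists y => //.
exact: subgroup_mulC.
Qed.

Lemma coset_lift_continuous F : supported_in F -> continuous (coset_lift F).
Proof.
move=> [Fc FK] g.
have [[y gy]|h] := pselect (lifts g !=set0); last first.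
  rewrite /continuous_at coset_lift0//; apply: cvg_near_cst.
  by apply: filterS (near_nolifts h) => g' h'; rewrite coset_lift0.
rewrite /continuous_at (coset_liftE F gy) -[y in F y](mulVKg g).
have : (fun g' => F (g' * (g^-1 * y))%g) @ g --> F (g * (g^-1 * y))%g.
  by apply: continuous_comp; [exact: continuous_mulgr|exact: Fc].
apply: cvg_trans; apply: near_eq_cvg.
apply: filterS (near_lifts gy) => g' h'.
have [[y' g'y' ->]|[n ->]] := coset_liftP F g'; first by rewrite (h' _ g'y').
apply/eqP/negPn/negP => Fn; apply: n; exists (g' * (g^-1 * y))%g.
split; first exact: FK.
by rewrite mulKg; case: gy.
Qed.

End Lattice.

End TopologicalGroup.

(** * A Haar functional near 1 from the invariant measure *)

Section HaarNearOne.
Variables (R : realType) (G : topologicalGroupType) (Gam : subgroup G).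
Local Notation Gm := (subgroup_set Gam).
Local Notation GG := (coset_space Gam).
Local Notation BGG := (borel_coset_space Gam).
Variable mu : {measure set BGG -> \bar R}.
Hypotheses (muT : (0 < mu setT < +oo)%E)
  (muI : forall g (A : set BGG), measurable A -> mu (coset_translate g @^-1` A) = mu A)
  (uG : is_uniform Gam).

Lemma measurable_continuous_coset (h : GG -> R) : continuous h ->
  measurable_fun [set: BGG] (h : BGG -> R).
Proof.
move=> /continuousP ch; apply: (measurability _ (RGenOpens.measurableE R)).
move=> _ [_ [a [b ->] <-]]; rewrite setTI; apply: sub_sigma_algebra.
apply: ch; exact: interval_open.
Qed.

Lemma coset_bounded (h : GG -> R) : continuous h -> exists B, forall q, `|h q| <= B.
Proof.
move=> ch.
have [q _|s hs] := compact_finite_cover (O := fun n : nat => [set q : GG | `|h q| < n%:R]) uG.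
  exists (Num.truncn (`|h q| + 1)).+1.
  have := @cvgr_lt _ _ _ _ _ (`|h q|) (cvg_norm (ch q)) (Num.truncn (`|h q| + 1)).+1%:R.
  apply; apply: (lt_trans _ (truncnS_gt _)); lra.
exists (\big[Num.max/0]_(n <- s) n%:R) => q; have [n sn /ltW hn] := hs q I.
apply: (le_trans hn); elim: s sn {hs} => //= b s IH [->|/IH h']; rewrite big_cons le_max ?lexx//.
by rewrite h' orbT.
Qed.

Lemma integrable_continuous_coset (h : GG -> R) : continuous h ->
  mu.-integrable [set: BGG] (EFin \o (h : BGG -> R)).
Proof.
move=> ch; apply: measurable_bounded_integrable => //.
- by case/andP: muT.
- exact: measurable_continuous_coset.
- have [B hB] := coset_bounded ch; exists B; split; first exact: num_real.
  by move=> M /ltW BM q _; exact: le_trans (hB q) BM.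
Qed.

Lemma coset_translateE g x :
  coset_translate g (\pi_GG x) = \pi_GG (g * x)%g.
Proof.
apply/pi_cosetP; apply: subgroup_mulC; rewrite invgM -mulgA mulKg.
exact: repr_coset.
Qed.

Lemma continuous_coset_translate g : continuous (coset_translate g : GG -> GG).
Proof.
apply/quotient_continuous.
have -> : coset_translate g \o \pi_GG = \pi_GG \o (fun x => (g * x)%g).
  by apply/funext => x /=; rewrite coset_translateE.
move=> x; apply: continuous_comp; first exact: continuous_mulgl.
exact: pi_continuous.
Qed.

Lemma open_coset_translate g (V : set GG) : open V -> open (coset_translate g @^-1` V).
Proof. by move/continuousP: (@continuous_coset_translate g); apply. Qed.

Definition coset_integral (h : GG -> R) : R := \int[mu]_(q in [set: BGG]) h q.

Lemma coset_integral_translate g (h : GG -> R) : continuous h ->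
  coset_integral (h \o coset_translate g) = coset_integral h.
Proof.
move=> ch; rewrite /coset_integral /Rintegral; congr fine.
have mphi : measurable_fun [set: BGG] (coset_translate g : BGG -> BGG).
  apply: (measurability (@open GG : set (set BGG))) => // _ [V oV <-]; rewrite setTI.
  apply: sub_sigma_algebra; exact: open_coset_translate.
have hc : continuous (h \o coset_translate g).
  by move=> q; apply: continuous_comp; [exact: continuous_coset_translate|exact: ch].
have := @integral_pushforward _ _ _ _ R _ mphi mu setT (EFin \o (h : BGG -> R)).
rewrite preimage_setT => /(_ _ _ measurableT) <-.
- apply/esym; apply: eq_measure_integral => A mA _; exact/esym/muI.
- by apply/measurable_EFinP; exact: measurable_continuous_coset.
- exact: (integrable_continuous_coset hc).
Qed.

(** The open set [V] cannot be null: its translates, all of the same measure, cover the compact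
    quotient, and finitely many of them suffice. *)
Lemma coset_integral_gt0 (h : GG -> R) q : continuous h -> (forall q, 0 <= h q) ->
  0 < h q -> 0 < coset_integral h.
Proof.
move=> ch h0 hq; pose V : set BGG := [set q' | h q / 2 < h q'].
have oV : open (V : set GG).
  rewrite (_ : (V : set GG) = h @^-1` [set x | h q / 2 < x]) //.
  by move/continuousP : ch; apply; exact: open_gt.
have mO (A : set GG) : open A -> measurable (A : set BGG).
  by move=> oA; apply: sub_sigma_algebra.
have cpre g : open (coset_translate g @^-1` (V : set GG)).
  exact: open_coset_translate.
have muV : (0 < mu V)%E.
  rewrite lt_neqAle measure_ge0 andbT; apply/eqP => /esym V0.
  have cov (q' : GG) : exists g, nbhs q' (coset_translate g @^-1` (V : set GG)).
    exists (repr q * (repr q')^-1)%g; apply: open_nbhs_nbhs; split=> //=.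
    by rewrite -[q'](reprK) coset_translateE reprK mulgVK reprK /V/=; lra.
  have [s hs] := compact_finite_cover uG (fun q' _ => cov q').
  suff : mu setT = 0%E by move=> T0; move: muT; rewrite T0 ltxx.
  have -> : [set: BGG] = \big[setU/set0]_(g <- s) (coset_translate g @^-1` V).
    apply/esym; rewrite -subTset => q' _; have [g sg Vg] := hs q' I.
    elim: s sg {hs} => //= b s IH [->|/IH h']; rewrite big_cons; first by left.
    by right.
  suff : measurable (\big[setU/set0]_(g <- s) (coset_translate g @^-1` V : set BGG)) /\
    mu (\big[setU/set0]_(g <- s) (coset_translate g @^-1` V)) = 0%E by case.
  elim: s {hs} => [|g s [IH1 IH2]]; first by rewrite big_nil.
  rewrite big_cons; have mg := mO _ (cpre g).
  split; first exact: measurableU.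
  by apply: null_set_setU => //; rewrite muI//; exact: mO.
have mh := measurable_continuous_coset ch.
have fin := integrable_fin_num measurableT (integrable_continuous_coset ch).
rewrite /coset_integral /Rintegral -lte_fin fineK//.
apply: (@lt_le_trans _ _ (\int[mu]_(q' in V) (h q / 2)%:E)%E).
  rewrite integral_cst; last exact: mO.
  by rewrite mule_gt0// lte_fin divr_gt0.
apply: (@le_trans _ _ (\int[mu]_(q' in V) (h q')%:E)%E).
  apply: ge0_le_integral => //; first exact: mO.
  - by move=> q' _; rewrite lee_fin; lra.
  - by apply/measurable_EFinP; apply: measurable_funS mh.
  - by move=> q' Vq'; rewrite lee_fin; exact: ltW.
apply: ge0_subset_integral => //; first exact: mO.
- exact/measurable_EFinP.
- by move=> q' _; rewrite lee_fin.
Qed.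

(* Only functions supported near 1 are needed, for which integrating a Haar
   measure amounts to integrating over [G / Gam]. *)
Record is_local_haar (K : set G) (M : (G -> R) -> R) : Prop := IsLocalHaar {
  haar_lin : forall a F F', supported_in K F -> supported_in K F' ->
    M (fun x => a * F x + F' x) = a * M F + M F';
  haar_ge0 : forall F, supported_in K F -> (forall x, 0 <= F x) -> 0 <= M F;
  haar_gt0 : forall F, supported_in K F -> (forall x, 0 <= F x) -> 0 < F 1%g -> 0 < M F;
  haar_translate : forall g F, supported_in K F ->
    supported_in K (fun x => F (g * x)%g) -> M (fun x => F (g * x)%g) = M F
}.

(** [M F] is the integral of [coset_lift F] over the quotient, for a compact [K] inside an open
    separating set; it inherits invariance from the measure. *)
Lemma local_haar_exists : locally_compact [set: G] -> hausdorff_space G ->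
  is_discrete Gam ->
  exists K M, nbhs 1%g K /\ is_local_haar K M.
Proof.
move=> lc hG dG.
have [U0 U01 US0] := discrete_separates dG.
have clG : closed Gm := @discrete_subgroup_closed G Gam hG dG.
pose U := U0°.
have oU : open U := open_interior _.
have US : separates Gm U by move=> x y /interior_subset ? /interior_subset ?; exact: US0.
have U1 : nbhs 1%g U by exact: nbhs_interior.
have [K [K1 cK KU]] := nbhs1_compact lc U1.
pose hat (F : G -> R) (q : GG) : R := coset_lift Gam K F (repr q).
have hatpi F x : hat F (\pi_GG x) = coset_lift Gam K F x.
  apply/esym/(coset_lift_eq US KU); exact: repr_coset.
have hatc F : supported_in K F -> continuous (hat F).
  move=> sF; apply: repr_comp_continuous; first exact: (coset_lift_continuous oU US cK KU clG).
  move=> x y /eqP/pi_cosetP xy; apply/eqP; exact: (coset_lift_eq US KU).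
have int F (sF : supported_in K F) := integrable_continuous_coset (hatc F sF).
exists K, (fun F => coset_integral (hat F)); split=> //; split.
- move=> a F F' sF sF'; rewrite /coset_integral.
  rewrite -(RintegralZl _ _ (int F sF))// -RintegralD//; last 2 first.
  + have := integrableZl measurableT a (int F sF).
    by apply: eq_integrable => // q _; rewrite /= EFinM.
  + exact: int.
  congr Rintegral; apply/funext => q; rewrite /hat.
  have [[y gy ->]|[h ->]] := coset_liftP US KU (fun x => a * F x + F' x) (repr q).
    by rewrite !(coset_liftE US KU _ gy).
  by rewrite !coset_lift0// mulr0 addr0.
- move=> F sF F0; apply: Rintegral_ge0 => q _; rewrite /hat.
  by have [[y gy ->]|[h ->]] := coset_liftP US KU F (repr q).
- move=> F sF F0 F1; apply: (@coset_integral_gt0 _ (\pi_GG 1%g)) => //.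
  + exact: hatc.
  + by move=> q; rewrite /hat; have [[y gy ->]|[h ->]] := coset_liftP US KU F (repr q).
  + rewrite hatpi (coset_liftE US KU F (y := 1%g))//; split; first exact: nbhs_singleton.
    by rewrite mulVg; exact: subgroup1.
- move=> g F sF sFg; rewrite -(coset_integral_translate g (hatc F sF)).
  congr coset_integral; apply/funext => q /=; rewrite -[q]reprK coset_translateE !hatpi.
  (* Since [F] and its translate are both supported in [K], a nonzero value of either lift provides
     representatives for both. *)
  set x := repr q.
  have [[y xy ->]|[h ->]] := coset_liftP US KU (fun x => F (g * x)%g) x.
    have [Fgy|Fgy] := eqVneq (F (g * y)%g) 0.
      rewrite Fgy; have [[y' gy' ->]|[_ ->]//] := coset_liftP US KU F (g * x)%g.
      apply/esym/eqP/negPn/negP => Fy'.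
      have xy' : lifts Gam K x (g^-1 * y')%g.
        split; first by apply: sFg.2; rewrite mulVKg.
        by case: gy' => _; rewrite invgM -mulgA.
      move: Fy'; rewrite -(mulVKg g y') (lifts_uniq US KU xy' xy) Fgy eqxx//.
    rewrite (coset_liftE US KU F (y := (g * y)%g))//; split; first exact: sF.2.
    by case: xy => _; rewrite invgM -mulgA mulKg.
  have [[y' gy' ->]|[_ ->]//] := coset_liftP US KU F (g * x)%g.
  apply/esym/eqP/negPn/negP => Fy'; apply: h; exists (g^-1 * y')%g.
  split; first by apply: sFg.2; rewrite mulVKg.
  by case: gy' => _; rewrite invgM -mulgA.
Qed.

End HaarNearOne.

(** * Equivariant maps *)

Lemma In_nth (T : Type) (x0 x : T) (s : seq T) : List.In x s ->
  exists i : 'I_(size s), nth x0 s i = x.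
Proof.
elim: s => [//|y s IH] /= [<-|/IH[i <-]]; first by exists ord0.
by exists (lift ord0 i).
Qed.

Lemma cvg_sumR (R : realType) (T I : Type) (F : set_system T) (s : seq I)
    (u : I -> T -> R) (l : I -> R) : Filter F -> (forall i, u i @ F --> l i) ->
  (fun t => \sum_(i <- s) u i t) @ F --> \sum_(i <- s) l i.
Proof.
move=> FF h; elim: s => [|i s IH].
  by rewrite big_nil; under eq_fun do rewrite big_nil; exact: cvg_cst.
by rewrite big_cons; under eq_fun do rewrite big_cons; apply: cvgD.
Qed.

Section Equivariant.
Variables (R : realType) (X : metricType R).
Hypotheses (XC : is_CAT0 X) (XP : is_proper X).
Local Notation d := (@mdist R X).
Variables (G : topologicalGroupType) (Gam : subgroup G) (m : G -> isometric_map X).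
Local Notation Gm := (subgroup_set Gam).

Definition equivariant (f : G -> X) := forall g h, Gm h -> f (g * h)%g = m h^-1%g (f g).

Hypotheses (m1 : forall x, m 1%g x = x)
  (mM : forall g h x, Gm g -> Gm h -> m (g * h)%g x = m g (m h x)).

Lemma equivariant_mdist f f' g h : equivariant f -> equivariant f' -> Gm h ->
  d (f (g * h)%g) (f' (g * h)%g) = d (f g) (f' g).
Proof. by move=> ef ef' Gh; rewrite ef// ef'// isometric_mapP. Qed.

(** Left translation by [x] commutes with the right action of Gamma, so this distance lives on the
    quotient; estimates uniform in [g] then follow from compactness of [Q]. *)
Lemma equivariant_mdist_mull f f' x g h : equivariant f -> equivariant f' -> Gm h ->
  d (f (x * (g * h))%g) (f' (g * h)%g) = d (f (x * g)%g) (f' g).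
Proof. by move=> ef ef' Gh; rewrite mulgA (ef (x * g)%g)// (ef' g)// isometric_mapP. Qed.

Section Existence.
Hypotheses (lcG : locally_compact [set: G]) (hG : hausdorff_space G) (dG : is_discrete Gam).
Variable Q : set G.
Hypotheses (cQ : compact Q) (QG : forall g, exists2 x, Q x & Gm (x^-1 * g)%g).

(** Whenever [w i g] is nonzero, [c i g] is the element of Gamma with [g * c i g] in [gi i * K]. The
    map is the barycenter of the points [m (c i g) x0] with weights [w i g]: the points are
    equivariant, the weights invariant, and their sum is positive because [Q] meets every coset. *)
Lemma equivariant_exists (x0 : X) : exists f, continuous f /\ equivariant f.
Proof.
have [U0 U01 U0S] := discrete_separates dG.
pose U := interior U0.
have oU : open U by exact: open_interior.
have US : separates Gm U by move=> x y Ux Uy; apply: U0S; exact: interior_subset.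
have nU : nbhs 1%g U by apply: open_nbhs_nbhs; split => //;
  exact: nbhs_singleton (nbhs_interior U01).
have clG := discrete_subgroup_closed hG dG.
have [K [nK cK KU]] := nbhs1_compact lcG nU.
have [chi [cchi chi0 chi1 chiK]] := nbhs1_bump R lcG hG nK.
have [s hs] : exists s : seq G, forall x, Q x -> exists2 i, List.In i s & 0 < chi (i^-1 * x)%g.
  apply: (@compact_finite_cover _ _ _ (fun i => [set x | 0 < chi (i^-1 * x)%g]) cQ) => x _;
    exists x.
  have h : (fun y => chi (x^-1 * y)%g) @ x --> chi (x^-1 * x)%g.
    apply: (@continuous_comp _ _ _ (fun y => (x^-1 * y)%g) chi); last exact: cchi.
    exact: continuous_mulgl.
  rewrite mulVg chi1 in h.
  by move/cvgrPdist_lt/(_ _ ltr01): h; apply: filterS => y /=; rewrite ltr_norml; lra.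
pose N := size s; pose gi (i : 'I_N) : G := nth 1%g s i.
pose w (i : 'I_N) g : R := coset_lift Gam K chi ((gi i)^-1 * g)%g.
pose c (i : 'I_N) g : G := (g^-1 * (gi i * xget 1 (lifts Gam K ((gi i)^-1 * g))))%g.
pose y g (i : 'I_N) : X := m (c i g) x0.
pose W g := \sum_i w i g.
pose L g (phi : 'I_N -> R) := (\sum_i w i g * phi i) / W g.
have sK : supported_in K chi by split.
have w0 i g : 0 <= w i g.
  by rewrite /w; case: (coset_liftP US KU chi ((gi i)^-1 * g)%g) => [[z _ ->]|[_ ->]].
have cw i : continuous (w i).
  move=> g; apply: (@continuous_comp _ _ _ (fun g => ((gi i)^-1 * g)%g)).
    exact: continuous_mulgl.
  exact: (coset_lift_continuous oU US cK KU clG sK).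
have cW : continuous W by move=> g; apply: (@cvg_sumR _ _ _ _ _ w) => i; exact: cw.
have W0 g : 0 < W g.
  have [x Qx xg] := QG g; have [z zs hz] := hs x Qx.
  have [i zi] := In_nth 1%g zs.
  rewrite /W (bigD1 i)//= ltr_pwDl//; last by apply: sumr_ge0.
  rewrite /w (@coset_liftE _ _ _ _ _ US KU _ _ (z^-1 * x)%g)//.
  split; first by apply: chiK; rewrite gt_eqF.
  rewrite /gi zi invgM invgK mulgA mulgK.
  by apply: subgroup_mulC.
have LM g : is_mean setT setT (L g).
  split=> //.
  - move=> a f h _ _; rewrite /L mulrA -mulrDl mulr_sumr -big_split/=; congr (_ / _).
    by apply: eq_bigr => i _; ring.
  - move=> f h _ _ fh; rewrite /L ler_pM2r ?invr_gt0//; apply: ler_sum => i _.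
    by rewrite ler_wpM2l// fh.
  - rewrite /L; under eq_bigr do rewrite mulr1.
    by apply: divff; rewrite gt_eqF//; exact: W0.
have bex (g : G) (p : 'I_N -> X) : exists b, is_argmin (meansq (L g) p) b.
  apply: (barycenter_exists XC XP (LM g) (r := \sum_i d x0 (p i)) (x0 := x0)) => // i _.
  by rewrite (bigD1 i)//= lerDl sumr_ge0// => j _; exact: mdist_ge0.
pose f g := argmin x0 (meansq (L g) (y g)).
have fP g : is_argmin (meansq (L g) (y g)) (f g).
  by have [b hb] := bex g (y g); rewrite /f (argmin_eq x0 hb).
have wl i g : w i g != 0 -> lifts Gam K ((gi i)^-1 * g)%g !=set0.
  by rewrite /w; case: (coset_liftP US KU chi ((gi i)^-1 * g)%g) => [[z zl _] _|[_ ->]];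
    [exists z|rewrite eqxx].
have Wl i g l : lifts Gam K ((gi i)^-1 * g)%g l -> xget 1%g (lifts Gam K ((gi i)^-1 * g)%g) = l.
  by move=> hl; apply: (lifts_uniq US KU (g := ((gi i)^-1 * g)%g)) => //;
    exact: xgetPex (ex_intro _ l hl).
exists f; split.
  move=> g.
  (* The elements [c i] are locally constant where they count, so that near [g] only the weights
     vary and [barycenter_close] applies. *)
  have same : \forall g' \near g, forall i, w i g' != 0 -> c i g' = c i g.
    apply: filter_forall => i.
    have cl : (fun g' => ((gi i)^-1 * g')%g) @ g --> ((gi i)^-1 * g)%g by exact: continuous_mulgl.
    case: (pselect (lifts Gam K ((gi i)^-1 * g)%g !=set0)) => [[l hl]|nl].
      have n1 : nbhs g [set g' | forall y', lifts Gam K ((gi i)^-1 * g')%g y' ->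
          y' = ((gi i)^-1 * g' * (((gi i)^-1 * g)^-1 * l))%g].
        exact: cl _ (near_lifts oU US KU hl).
      apply: filterS n1 => g' hg' /wl[l' hl'].
      rewrite /c (Wl _ _ _ hl) (Wl _ _ _ hl') (hg' _ hl') !invgM !invgK !mulgA.
      by rewrite mulgK mulVg mul1g.
    have n1 : nbhs g [set g' | ~ (lifts Gam K ((gi i)^-1 * g')%g !=set0)].
      exact: cl _ (near_nolifts cK clG nl).
    by apply: filterS n1 => g' hg' /wl.
  pose r := \sum_i d x0 (y g i).
  have r0 : 0 <= r by apply: sumr_ge0 => i _; exact: mdist_ge0.
  have yr i : d x0 (y g i) <= r.
    by rewrite /r (bigD1 i)//= lerDl sumr_ge0// => j _; exact: mdist_ge0.
  pose e g' := \sum_i `|w i g / W g - w i g' / W g'|.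
  have ce : e @ g --> 0.
    have -> : 0 = \sum_(i < N) `|w i g / W g - w i g / W g| :> R.
      by rewrite big1// => i _; rewrite subrr normr0.
    apply: (@cvg_sumR _ _ _ _ _ (fun i g' => `|w i g / W g - w i g' / W g'|)) => i;
      apply: cvg_norm; apply: cvgB; first exact: cvg_cst.
    apply: cvgM; first exact: cw.
    by apply: cvgV; [rewrite gt_eqF|exact: cW].
  have close : \forall g' \near g, d (f g) (f g') <= e g' * (2 * r).
    move: same; apply: filterS => g' hg'.
    have ee : meansq (L g') (y g') = meansq (L g') (y g).
      apply/funext => z; rewrite /meansq /L; congr (_ / _); apply: eq_bigr => i _.
      by have [->|/hg' h] := eqVneq (w i g') 0; rewrite ?mul0r// /y h.
    have hb' : is_argmin (meansq (L g') (y g)) (f g') by rewrite -ee; exact: fP.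
    have fr : d x0 (f g) <= r by exact: (barycenter_mdist_le (LM g) _ (fP g)).
    have fr' : d x0 (f g') <= r by exact: (barycenter_mdist_le (LM g') _ hb').
    apply: (barycenter_close (LM g) (LM g') _ (fP g) hb') => //.
    - move=> i _; have hi := yr i; split.
        by apply: le_trans (metric_triangle _ x0 _) _; rewrite (metric_sym _ x0); lra.
      by apply: le_trans (metric_triangle _ x0 _) _; rewrite (metric_sym _ x0); lra.
    - by rewrite mulr_ge0.
    - by apply: sumr_ge0.
    - move=> phi B _ B0 hphi; rewrite /L !mulr_suml -sumrB; apply: ler_sum => i _.
      rewrite [X in X <= _](_ : _ = (w i g / W g - w i g' / W g') * phi i); last by field;
        rewrite !gt_eqF.
      by apply: le_trans (ler_norm _) _; rewrite normrM ler_wpM2l// hphi.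
  have {}ce : (fun g' => e g' * (2 * r)) @ g --> 0.
    by rewrite -(mul0r (2 * r)); apply: cvgM => //; exact: cvg_cst.
  apply/mcvgP => eps eps0; move/cvgrPdist_lt/(_ _ eps0): ce => ce.
  apply: filterS2 close ce => g' h1; rewrite sub0r normrN => h2.
  exact: le_lt_trans h1 (le_lt_trans (ler_norm _) h2).
move=> g h Gh; apply: (argmin_eq x0).
have wh i : w i (g * h)%g = w i g.
  by apply/esym/(coset_lift_eq US KU); rewrite invgM invgK mulgA mulgK mulKg.
have vh z : meansq (L (g * h)%g) (y (g * h)%g) z = meansq (L g) (y g) (m h z).
  rewrite /meansq /L /W; under eq_bigr do rewrite wh.
  congr (_ / _); last by apply: eq_bigr => i _; exact: wh.
  apply: eq_bigr => i _; have [->|wi] := eqVneq (w i g) 0; first by rewrite !mul0r.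
  have [l hl] := wl _ _ wi.
  have hl' : lifts Gam K ((gi i)^-1 * (g * h))%g l.
    by apply: (lifts_coset _ hl); rewrite invgM invgK mulgA mulgK mulKg.
  have Gc : Gm (g^-1 * (gi i * l))%g by case: hl => _; rewrite invgM invgK mulgA.
  have GV := @subgroupV _ Gam.
  congr (_ * _ ^+ 2); rewrite /y /c (Wl _ _ _ hl) (Wl _ _ _ hl') invgM -mulgA.
  rewrite (mM _ (GV _ Gh) Gc) -(isometric_mapP (m h)) -(mM _ Gh (GV _ Gh)) mulgV m1.
  by [].
move=> z; rewrite !vh -(isometric_mapP (m h) z) -(mM _ Gh (subgroupV Gh)) mulgV m1.
exact: fP.
Qed.

End Existence.

Section Uniformity.
Variable Q : set G.
Hypotheses (cQ : compact Q) (QG : forall g, exists2 x, Q x & Gm (x^-1 * g)%g).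

Lemma equivariant_unif f (e : R) : continuous f -> equivariant f -> 0 < e ->
  \forall x \near 1%g, forall g, d (f (x * g)%g) (f g) < e.
Proof.
move=> cf ef e0.
have n1 : \forall x \near (1%g : G), Q `<=` (fun g => d (f (x * g)%g) (f g) < e).
  apply: (proj1 (compact_near_coveringP Q) cQ) => q Qq.
  have h : (fun z : G * G => d (f (z.2 * z.1)%g) (f z.1)) @ (nbhs q, nbhs (1%g : G)) --> d (f (1
    * q)%g) (f q).
    apply: cvg_mdist; last by apply: cvg_comp; [exact: cvg_fst|exact: cf].
    apply: cvg_comp; last exact: cf.
    by apply: cvg_mulg; [exact: cvg_snd|exact: cvg_fst].
  rewrite mul1g mdistxx in h; move/cvgrPdist_lt/(_ _ e0): h; apply: filterS => z.
  by rewrite sub0r normrN; exact: le_lt_trans (ler_norm _).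
apply: filterS n1 => x hx g; have [y Qy yg] := QG g.
have := hx y Qy; rewrite -(equivariant_mdist_mull x y ef ef yg).
by rewrite !mulVKg.
Qed.

Lemma equivariant_bounded f f' x : continuous f -> continuous f' -> equivariant f ->
  equivariant f' -> exists2 B, 0 < B & forall g, d (f (x * g)%g) (f' g) <= B.
Proof.
move=> cf cf' ef ef'.
have n1 : \forall B \near +oo, Q `<=` (fun g => d (f (x * g)%g) (f' g) <= B).
  apply: (proj1 (compact_near_coveringP Q) cQ) => q Qq.
  have h : (fun g => d (f (x * g)%g) (f' g)) @ q --> d (f (x * q)%g) (f' q).
    apply: cvg_mdist; last exact: cf'.
    by apply: (@continuous_comp _ _ _ (fun z => (x * z)%g) f); [exact: continuous_mulgl|exact: cf].
  have h1 : \forall g \near q, d (f (x * g)%g) (f' g) < d (f (x * q)%g) (f' q) + 1.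
    move/cvgrPdist_lt/(_ _ ltr01): h; apply: filterS => z; rewrite ltr_norml; lra.
  exists ([set g | d (f (x * g)%g) (f' g) < d (f (x * q)%g) (f' q) + 1],
          [set B | d (f (x * q)%g) (f' q) + 1 <= B]).
    by split; [exact: h1|apply: nbhs_pinfty_ge; exact: num_real].
  by move=> [g B] /= [/ltW]; exact: le_trans.
near +oo_R => B; exists B; first by near: B; exact: nbhs_pinfty_gt.
have hB : Q `<=` (fun g => d (f (x * g)%g) (f' g) <= B) by near: B.
move=> g; have [y Qy yg] := QG g.
have := hB y Qy; rewrite -(equivariant_mdist_mull x y ef ef' yg).
by rewrite !mulVKg.
Unshelve. all: by end_near.
Qed.

End Uniformity.
End Equivariant.

(** * Minimizing the energy along one factor *)

(* Formal geodesic combinations of points of an orbit of [H]. *)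
Inductive word (R : realType) (H : Type) : Type :=
  Leaf of H | Node of word R H & word R H & R.

Arguments Leaf {R H}.

Section Words.
Variables (R : realType) (X : metricType R) (G H : topologicalGroupType) (io : H -> G).

Fixpoint ev (w : word R H) (f : G -> X) (g : G) : X :=
  match w with
  | Leaf h => f (io h * g)%g
  | Node v v' t => gpt (ev v f g) (ev v' f g) t
  end.

Fixpoint wmul (w : word R H) (q : H) : word R H :=
  match w with
  | Leaf h => Leaf (h * q)%g
  | Node v v' t => Node (wmul v q) (wmul v' q) t
  end.

Lemma ev_wmul w q f g : (forall a b, io (a * b)%g = (io a * io b)%g) ->
  ev (wmul w q) f g = ev w f (io q * g)%g.
Proof.
by move=> ioM; elim: w => [h|v IH v' IH' t] /=; rewrite ?IH ?IH'// ioM mulgA.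
Qed.

End Words.

Section Stage.
Variables (R : realType) (X : metricType R).
Hypotheses (XC : is_CAT0 X) (XP : is_proper X).
Local Notation d := (@mdist R X).
Variables (G H : topologicalGroupType) (Gam : subgroup G) (m : G -> isometric_map X).
Local Notation Gm := (subgroup_set Gam).
Hypotheses (m1 : forall x, m 1%g x = x)
  (mM : forall g h x, Gm g -> Gm h -> m (g * h)%g x = m g (m h x)).
Variable Q : set G.
Hypotheses (cQ : compact Q) (QG : forall g, exists2 x, Q x & Gm (x^-1 * g)%g).

Variables (io : H -> G) (p : G -> H).
Hypotheses (ioM : forall a b, io (a * b)%g = (io a * io b)%g) (cio : continuous io)
  (pM : forall a b, p (a * b)%g = (p a * p b)%g) (cp : continuous p)
  (pio : forall h, p (io h) = h)
  (ioC : forall h k, p k = 1%g -> (io h * k)%g = (k * io h)%g).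

Variable f0 : G -> X.
Hypotheses (cf0 : continuous f0) (ef0 : equivariant Gam m f0).

Lemma io1 : io 1%g = 1%g.
Proof. by apply: (mulgI (io 1%g)); rewrite -ioM !mulg1. Qed.

Lemma ioV h : io h^-1%g = (io h)^-1%g.
Proof. by apply: (mulgI (io h)); rewrite -ioM !mulgV io1. Qed.

Lemma p1 : p 1%g = 1%g.
Proof. by apply: (mulgI (p 1%g)); rewrite -pM !mulg1. Qed.

Lemma pV g : p g^-1%g = (p g)^-1%g.
Proof. by apply: (mulgI (p g)); rewrite -pM !mulgV p1. Qed.

Definition kpart g := ((io (p g))^-1 * g)%g.

Lemma p_kpart g : p (kpart g) = 1%g.
Proof. by rewrite /kpart pM pV pio mulVg. Qed.

Lemma kpartE g : g = (io (p g) * kpart g)%g.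
Proof. by rewrite /kpart mulVKg. Qed.

Lemma continuous_kpart : continuous kpart.
Proof.
move=> g; apply: cvg_mulg; last exact: cvg_id.
apply: cvg_invg; apply: cvg_comp; [exact: cp|exact: cio].
Qed.

(* [f] moves along the kernel of [p] at most as fast as [f0]. *)
Definition tame f := forall k, p k = 1%g -> forall B,
  (forall g, d (f0 (k * g)%g) (f0 g) <= B) -> forall g, d (f (k * g)%g) (f g) <= B.

Definition admissible f := [/\ continuous f, equivariant Gam m f & tame f].

Lemma admissible0 : admissible f0. Proof. by split. Qed.

(** Tameness transfers the uniform continuity of [f0] to all tame maps at once. *)
Lemma tame_kpart (e : R) : 0 < e ->
  \forall x \near 1%g, forall f, tame f -> forall g, d (f (kpart x * g)%g) (f g) <= e.
Proof.
move=> e0; have n1 := equivariant_unif cQ QG cf0 ef0 e0.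
have h : kpart @ 1%g --> 1%g.
  have k1 : kpart 1%g = 1%g by rewrite /kpart p1 io1 mulVg.
  by rewrite -{2}k1; exact: continuous_kpart.
have n2 : nbhs (1%g : G) [set x | forall g, d (f0 (kpart x * g)%g) (f0 g) < e] by exact: h _ n1.
apply: filterS n2 => x hx f tf; apply: tf; first exact: p_kpart.
by move=> g; rewrite ltW// hx.
Qed.

Lemma tame_equicontinuous (V : set H) (e : R) : nbhs 1%g V -> 0 < e ->
  \forall x \near 1%g, forall f, tame f ->
    (forall h g, V h -> d (f (io h * g)%g) (f g) <= e) ->
    forall g, d (f (x * g)%g) (f g) <= 2 * e.
Proof.
move=> nV e0.
have h : p @ 1%g --> 1%g by rewrite -{1}p1; exact: cp.
have n2 : nbhs (1%g : G) [set x | V (p x)] by exact: h.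
apply: filterS2 (tame_kpart e0) n2 => x hx Vx f tf hf g.
rewrite {1}(kpartE x) -mulgA; apply: le_trans (metric_triangle _ (f (kpart x * g)%g) _) _.
by rewrite mulr2n mulrDl !mul1r lerD ?hf ?hx.
Qed.

Lemma unif_continuous (f : G -> X) :
  (forall e : R, 0 < e -> \forall x \near (1%g : G), forall g, d (f (x * g)%g) (f g) <= e) ->
  continuous f.
Proof.
move=> h g; apply/mcvgP => e e0.
have e2 : 0 < e / 2 by rewrite divr_gt0.
have := nbhs_mulgr g (h _ e2); apply: filterS => x /= /(_ g).
rewrite mulgVK metric_sym; lra.
Qed.

Lemma admissible_bounded f : admissible f -> exists2 B, 0 < B & forall g, d (f g) (f0 g) <= B.
Proof.
move=> [cf ef _]; have [B B0 hB] := equivariant_bounded cQ QG 1%g cf cf0 ef ef0.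
by exists B => // g; have := hB g; rewrite mul1g.
Qed.

Lemma continuous_gpt (f f' : G -> X) t : continuous f -> continuous f' ->
  continuous (fun g => gpt (f g) (f' g) t).
Proof. by move=> cf cf' g; apply: cvg_gpt => //; [exact: cf|exact: cf']. Qed.

Lemma admissible_gpt f f' t : admissible f -> admissible f' ->
  admissible (fun g => gpt (f g) (f' g) t).
Proof.
move=> [cf ef tf] [cf' ef' tf']; split; first exact: continuous_gpt.
- by move=> g h Gh; rewrite ef// ef'// gpt_isometry.
- by move=> k pk B hB g; apply: mdist_gpt_max => //; [exact: tf|exact: tf'].
Qed.

Lemma admissible_translate f h : admissible f -> admissible (fun g => f (io h * g)%g).
Proof.
move=> [cf ef tf]; split.
- by move=> g; apply: (@continuous_comp _ _ _ (fun z => (io h * z)%g) f);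
  [exact: continuous_mulgl|exact: cf].
- by move=> g a Ga; rewrite mulgA ef.
- by move=> k pk B hB g; rewrite mulgA (ioC _ pk) -mulgA; exact: tf.
Qed.

Definition energy (ks : seq G) (f : G -> X) g := \sum_(k <- ks) d (f (k * g)%g) (f g) ^+ 2.

(** * Equicontinuity along [H] by Haar averages *)

Section Smoothing.
Variables (lcG : locally_compact [set: G]) (hG : hausdorff_space G).
Variables (K : set G) (M : (G -> R) -> R).
Hypotheses (nK : nbhs 1%g K) (HM : is_local_haar K M).

Lemma haar_le F F' : supported_in K F -> supported_in K F' -> (forall x, F x <= F' x) ->
  M F <= M F'.
Proof.
move=> sF sF' FF'; have := haar_lin HM (-1) sF sF'.
have s1 : supported_in K (fun x => -1 * F x + F' x).
  split; first by move=> x; apply: cvgD; [apply: cvgM; [exact: cvg_cst|exact: sF.1]|exact: sF'.1].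
  move=> x; have [->|h _] := eqVneq (F x) 0; last exact: sF.2.
  by rewrite mulr0 add0r; exact: sF'.2.
move=> h; have := haar_ge0 HM s1; rewrite h mulN1r addrC subr_ge0; apply=> x.
by rewrite mulN1r addrC subr_ge0.
Qed.

(* [P f g] is the barycenter of the points [f (io (p u)^-1 * g)], [u] close to 1,
   for a Haar measure: it is equicontinuous along [H], uniformly in [f]. *)
Lemma smoothing_exists : exists P : (G -> X) -> G -> X,
  [/\ forall f, admissible f -> admissible (P f),
      forall f r, admissible f -> (forall g, d (f g) (f0 g) <= r) ->
        forall g, d (P f g) (f0 g) <= r + 1,
      forall f ks s, admissible f -> (forall k, List.In k ks -> p k = 1%g) ->
        (forall g, energy ks f g <= s) -> forall g, energy ks (P f) g <= s &
      forall e, 0 < e -> \forall h \near (1%g : H), forall f r, admissible f ->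
        (forall g, d (f g) (f0 g) <= r) ->
        forall g, d (P f (io h * g)%g) (P f g) <= e * (r + 1)].
Proof.
have cip : continuous (fun u => (io (p u))^-1%g).
  by move=> u; apply: cvg_invg; apply: cvg_comp; [exact: cp|exact: cio].
have ip1 : (io (p 1%g))^-1%g = 1%g by rewrite p1 io1 invg1.
(* Averaging over this neighbourhood displaces [f0] by less than 1, whence the bound [r + 1] for
   [P f]. *)
have n0 : nbhs (1%g : G) [set u | forall g, d (f0 ((io (p u))^-1 * g)%g) (f0 g) < 1].
  have h : (fun u => (io (p u))^-1%g) @ (1%g : G) --> (io (p 1))^-1%g := cip 1%g.
  rewrite ip1 in h.
  exact: h _ (equivariant_unif cQ QG cf0 ef0 ltr01).
have [K1 [nK1 cK1 K1K]] := nbhs1_compact lcG (filterI nK n0).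
have [tau0 [ctau tau00 tau01 tauK]] := nbhs1_bump R lcG hG nK1.
pose W2 := [set u | 1 / 2 < tau0 u].
have nW2 : nbhs (1%g : G) W2.
  have h : tau0 @ (1%g : G) --> tau0 1%g := ctau 1%g; rewrite tau01 in h.
  have h2 : 0 < 1 / 2 :> R by rewrite divr_gt0.
  move/cvgrPdist_lt/(_ _ h2): h; apply: filterS => u; rewrite /W2 /= ltr_norml; lra.
have W2K : W2 `<=` K1.
  by move=> u hu; apply: tauK; rewrite gt_eqF// (lt_trans _ hu)// divr_gt0.
have [W nW WW] := nbhs1_div nW2.
have W1 := nbhs_singleton nW.
have WW2 : W `<=` W2 by move=> u Wu; have [] := WW 1%g u W1 Wu; rewrite invg1 mul1g.
(* [ro] is the averaging density. It vanishes off [W], so that its translates by elements of [W]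
   vanish off [W2], where [2 * tau0] is at least 1 and can dominate their difference. *)
have [ro [cro ro0 ro1 roW]] := nbhs1_bump R lcG hG nW.
have sup (r : G -> R) phi : continuous r -> continuous phi -> (forall u, r u != 0 -> W2 u) ->
    supported_in K (fun u => r u * phi u).
  move=> cr cphi rW2; split; first by move=> u; apply: cvgM; [exact: cr|exact: cphi].
  move=> u h; apply: (K1K _ (W2K _ (rW2 _ _))).1; apply: contra_neq h => ->.
  by rewrite mul0r.
have Mro0 : 0 < M ro.
  apply: (haar_gt0 HM) => //; last by rewrite ro1.
  by split=> // u /roW/WW2/W2K/K1K[].
have mean_of (r : G -> R) : continuous r -> (forall u, r u != 0 -> W2 u) ->
    (forall u, 0 <= r u) -> M r = M ro ->
    is_mean W2 [set phi : G -> R | continuous phi] (fun phi => M (fun u => r u * phi u) / M ro).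
  move=> cr rW2 r0 Mr; split => /=.
  - by move=> a u; exact: cvg_cst.
  - by move=> a phi psi c1 c2 u; apply: cvgD; [apply: cvgM; [exact: cvg_cst|exact: c1]|exact: c2].
  - move=> a phi psi c1 c2; rewrite mulrA -mulrDl; congr (_ / _).
    rewrite -(haar_lin HM); [|exact: sup|exact: sup].
    by congr M; apply/funext => u; ring.
  - move=> phi psi c1 c2 h; rewrite ler_pM2r ?invr_gt0//.
    apply: haar_le; [exact: sup|exact: sup|move=> u].
    have [->|ru] := eqVneq (r u) 0; first by rewrite !mul0r.
    by rewrite ler_wpM2l// h//; exact: rW2.
  - by under eq_fun do rewrite mulr1; rewrite Mr divff// gt_eqF.
pose L phi := M (fun u => ro u * phi u) / M ro.
have roW2 u : ro u != 0 -> W2 u by move=> /roW/WW2.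
have LM : is_mean W2 [set phi : G -> R | continuous phi] L by exact: mean_of.
(* The functional [M] lives on [G], but only [p u] enters, so the average runs along [H]. Thanks to
   the inverse, moving [g] by [io h] is the same as translating [u]. *)
pose y (f : G -> X) g u := f ((io (p u))^-1 * g)%g.
have cy f g : continuous f -> continuous (y f g).
  move=> cf u; apply: cvg_comp; last exact: cf.
  by apply: cvg_mulg; [exact: cip|exact: cvg_cst].
have cd (v w : G -> X) : continuous v -> continuous w -> continuous (fun u => d (v u) (w u) ^+ 2
  : R).
  move=> cv cw u; under eq_fun do rewrite expr2.
  by apply: cvgM; apply: cvg_mdist; solve [exact: cv|exact: cw].
have cdc (v : G -> X) z : continuous v -> continuous (fun u => d z (v u) ^+ 2 : R).
  by move=> cv; apply: cd => // u; exact: cvg_cst.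
have yr f r g u : (forall g, d (f g) (f0 g) <= r) -> W2 u -> d (f0 g) (y f g u) <= r + 1.
  move=> hr /W2K/K1K[_ /= /(_ g)/ltW h]; rewrite metric_sym.
  by apply: le_trans (metric_triangle _ (f0 ((io (p u))^-1 * g)%g) _) _; rewrite lerD// hr.
pose P f g := argmin (f0 g) (meansq L (y f g)).
have PP f g : admissible f -> is_argmin (meansq L (y f g)) (P f g).
  move=> af; have [B B0 hB] := admissible_bounded af; have [cf _ _] := af.
  have [b hb] : exists b, is_argmin (meansq L (y f g)) b.
    apply: (barycenter_exists XC XP LM (r := B + 1) (x0 := f0 g)).
      by move=> z; apply: cdc; exact: cy.
    by move=> u; exact: yr.
  by rewrite /P (argmin_eq (f0 g) hb).
have sqP f f' g g' : admissible f -> admissible f' ->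
    d (P f g) (P f' g') ^+ 2 <= L (fun u => d (y f g u) (y f' g' u) ^+ 2).
  move=> af af'; have [cf _ _] := af; have [cf' _ _] := af'.
  apply: (barycenter_sqr_mdist XC LM _ _ _ (PP _ _ af) (PP _ _ af')).
  - by move=> z; apply: cdc; exact: cy.
  - by move=> z; apply: cdc; exact: cy.
  - by apply: cd; exact: cy.
have yk f g k u : p k = 1%g -> y f (k * g)%g u = f (k * ((io (p u))^-1 * g))%g.
  by move=> pk; rewrite /y mulgA -ioV (ioC _ pk) -mulgA.
have rP f r : admissible f -> (forall g, d (f g) (f0 g) <= r) ->
    forall g, d (P f g) (f0 g) <= r + 1.
  move=> af hr g; have [cf _ _] := af.
  have r0 : 0 <= r := le_trans (mdist_ge0 _ _) (hr 1%g).
  rewrite metric_sym; apply: (barycenter_mdist_le LM _ (PP f g af)).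
  - by move=> z; apply: cdc; exact: cy.
  - by rewrite addr_ge0.
  - by move=> u; exact: yr.
have eP f : admissible f -> equivariant Gam m (P f).
  move=> af g h Gh; apply: argmin_eq => z.
  have [cf ef _] := af.
  have mh x : m h (m h^-1%g x) = x by rewrite -(mM _ Gh (subgroupV Gh)) mulgV m1.
  have vh z' : meansq L (y f (g * h)%g) z' = meansq L (y f g) (m h z').
    rewrite /meansq; congr L; apply/funext => u; rewrite /y mulgA ef//.
    by rewrite -(isometric_mapP (m h)) mh.
  rewrite !vh mh -(isometric_mapP (m h) z) mh; exact: PP.
have tP f : admissible f -> tame (P f).
  move=> af k pk B hB g; have [cf ef tf] := af.
  have B0 : 0 <= B := le_trans (mdist_ge0 _ _) (hB 1%g).
  apply: ler_sqr_mdist => //; apply: le_trans (sqP _ _ _ _ af af) _.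
  rewrite -(mean_cst LM (B ^+ 2)); apply: (mean_le LM).
  - by apply: cd; exact: cy.
  - exact: mean_dom_cst LM _.
  - move=> u _; rewrite yk// lerXn2r ?nnegrE ?mdist_ge0//.
    exact: tf.
have mP (e : R) : 0 < e -> \forall h \near (1%g : H), forall f r, admissible f ->
    (forall g, d (f g) (f0 g) <= r) -> forall g, d (P f (io h * g)%g) (P f g) <= e * (r + 1).
  move=> e0; pose tau u := 2 * tau0 u.
  have stau : supported_in K tau.
    split; first by move=> u; apply: cvgM; [exact: cvg_cst|exact: ctau].
    move=> u h; apply: (K1K _ (tauK _ _)).1; apply: contra_neq h => h.
    by rewrite /tau h mulr0.
  have Mtau0 : 0 < M tau.
    by apply: (haar_gt0 HM) => // [u|]; rewrite /tau ?tau01 ?mulr1// mulr_ge0.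
  (* If [ro] and its translate differ by at most [e' * tau], their means differ by the factor
     [e / 2]; the points lie within [2 * (r + 1)] of the barycenters, which gives [e * (r + 1)]. *)
  pose e' := e * M ro / (2 * M tau).
  have e'0 : 0 < e' by rewrite divr_gt0 ?mulr_gt0.
  have n1 : \forall x \near (1%g : G), K1 `<=` (fun u => `|ro u - ro (x * u)%g| < e').
    apply: (proj1 (compact_near_coveringP K1) cK1) => q Kq.
    have h : (fun z : G * G => ro z.1 - ro (z.2 * z.1)%g) @ (nbhs q, nbhs (1%g : G)) -->
        ro q - ro (1 * q)%g.
      apply: cvgB; first by apply: cvg_comp; [exact: cvg_fst|exact: cro].
      apply: cvg_comp; last exact: cro.
      by apply: cvg_mulg; [exact: cvg_snd|exact: cvg_fst].
    rewrite mul1g subrr in h; move/cvgrPdist_lt/(_ _ e'0): h; apply: filterS => z.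
    by rewrite sub0r normrN.
  have cio1 : io @ (1%g : H) --> (1%g : G) by rewrite -{1}io1; exact: cio.
  have n2 : nbhs (1%g : H) [set h | W (io h) /\
      K1 `<=` (fun u => `|ro u - ro (io h * u)%g| < e')].
    exact: cio1 _ (filterI nW n1).
  apply: filterS n2 => h [Wh hro] f r af hr g.
  have [cf _ _] := af; have r0 : 0 <= r := le_trans (mdist_ge0 _ _) (hr 1%g).
  pose rh u := ro (io h * u)%g.
  have crh : continuous rh.
    by move=> u; apply: (@continuous_comp _ _ _ (fun z => (io h * z)%g) ro);
      [exact: continuous_mulgl|exact: cro].
  have rhW2 u : rh u != 0 -> W2 u by move=> /roW /(WW _ _ Wh)[]; rewrite mulKg.
  have HT phi : continuous phi -> M (fun u => rh u * phi u) =
      M (fun u => ro u * phi ((io h)^-1 * u)%g).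
    move=> cphi.
    have s1 : supported_in K (fun u => ro u * phi ((io h)^-1 * u)%g).
      apply: sup => // u; apply: (@continuous_comp _ _ _ (fun z => ((io h)^-1 * z)%g) phi);
        [exact: continuous_mulgl|exact: cphi].
    have h1 := haar_translate HM (g := io h) s1.
    rewrite -h1; first by congr M; apply/funext => u; rewrite mulKg.
    by rewrite (_ : (fun _ => _) = (fun u => rh u * phi u));
      [exact: sup|apply/funext => u; rewrite mulKg].
  have Mrh : M rh = M ro.
    have c1 : continuous (fun _ : G => 1 : R) by move=> u; exact: cvg_cst.
    have e1 (r' : G -> R) : (fun u => r' u * 1) = r' by apply/funext => u; rewrite mulr1.
    by have := HT (fun _ => 1) c1; rewrite !e1.
  pose L' (phi : G -> R) := M (fun u => rh u * phi u) / M ro.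
  have LM' : is_mean W2 [set phi : G -> R | continuous phi] L'.
    by apply: mean_of => // u; exact: ro0.
  have vh z : meansq L (y f (io h * g)%g) z = meansq L' (y f g) z.
    rewrite /meansq /L' HT; last by apply: cdc; exact: cy.
    rewrite /L; congr (M _ / _); apply/funext => u; congr (_ * d _ _ ^+ 2).
    by rewrite /y pM pV pio ioM ioV invgM invgK mulgA.
  have hb' : is_argmin (meansq L' (y f g)) (P f (io h * g)%g).
    by move=> z; rewrite -!vh; exact: PP.
  have Dy z : continuous (fun u => d z (y f g u) ^+ 2 : R) by apply: cdc; exact: cy.
  have r10 : 0 <= r + 1 by rewrite addr_ge0.
  have f0b : d (f0 g) (P f g) <= r + 1.
    by apply: (barycenter_mdist_le LM _ (PP f g af)) => // u; exact: yr.
  have f0b' : d (f0 g) (P f (io h * g)%g) <= r + 1.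
    by apply: (barycenter_mdist_le LM' _ hb') => // u; exact: yr.
  rewrite metric_sym (_ : e * (r + 1) = e / 2 * (2 * (r + 1))); last by field.
  apply: (barycenter_close LM LM' Dy (PP f g af) hb') => //.
  - move=> u W2u; have hu := yr f r g u hr W2u.
    split; apply: le_trans (metric_triangle _ (f0 g) _) _; rewrite (metric_sym _ (f0 g)); lra.
  - by rewrite mulr_ge0.
  - by rewrite ltW// divr_gt0.
  move=> phi B cphi B0 hphi; rewrite /L /L' -mulrBl ler_pdivrMr//.
  have sB : supported_in K (fun u => e' * B * tau u + 0).
    split; first by move=> u; apply: cvgD; [apply: cvgM;
      [exact: cvg_cst|exact: stau.1]|exact: cvg_cst].
    by move=> u; rewrite addr0 => h1; apply: stau.2; apply: contra_neq h1 => ->; rewrite mulr0.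
  have s0 : supported_in K (fun _ => 0 : R) by split; [move=> u; exact: cvg_cst|move=> u;
    rewrite eqxx].
  have M00 : M (fun _ => 0) = 0.
    have := haar_lin HM 1 s0 s0; rewrite !mul1r addr0; lra.
  have sro := sup _ _ cro cphi roW2; have srh := sup _ _ crh cphi rhW2.
  have h2 : M (fun u => ro u * phi u) - M (fun u => rh u * phi u) =
      M (fun u => -1 * (rh u * phi u) + ro u * phi u).
    by rewrite (haar_lin HM)// mulN1r addrC.
  have h3 : M (fun u => e' * B * tau u + 0) = e' * B * M tau.
    by rewrite (haar_lin HM)// M00 addr0.
  rewrite h2 (_ : e / 2 * B * M ro = e' * B * M tau); last first.
    by rewrite /e'; field; rewrite gt_eqF.
  rewrite -h3; apply: haar_le => //.
    split; last first.
      move=> u h4; have [W2u|nW2u] := pselect (W2 u); first exact: (K1K _ (W2K _ W2u)).1.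
      have e1 : rh u = 0 by apply: contra_notP nW2u => /eqP; exact: rhW2.
      have e2 : ro u = 0 by apply: contra_notP nW2u => /eqP; exact: roW2.
      by move: h4; rewrite e1 e2 !mul0r mulr0 addr0 eqxx.
    by move=> u; apply: cvgD; [apply: cvgM; [exact: cvg_cst|exact: srh.1]|exact: sro.1].
  move=> u; rewrite addr0 mulN1r addrC -mulrBl.
  have [W2u|nW2u] := pselect (W2 u); last first.
    have e1 : rh u = 0 by apply: contra_notP nW2u => /eqP; exact: rhW2.
    have e2 : ro u = 0 by apply: contra_notP nW2u => /eqP; exact: roW2.
    rewrite e1 e2 subrr mul0r; apply: mulr_ge0; first by rewrite mulr_ge0// ltW.
    by rewrite /tau mulr_ge0.
  apply: le_trans (ler_norm _) _; rewrite normrM.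
  have t1 : 1 <= tau u by move: W2u; rewrite /tau /W2/=; lra.
  rewrite -[leLHS]mulr1 ler_pM// ?mulr_ge0// ler_pM// ?hphi//.
  by rewrite ltW// hro//; exact: W2K.
exists P; split => //.
  move=> f af; split; [|exact: eP|exact: tP].
  have [B B0 hB] := admissible_bounded af.
  apply: unif_continuous => e e0.
  have e1 : 0 < e / 2 / (B + 1) by rewrite !divr_gt0// addr_gt0.
  have := tame_equicontinuous (mP _ e1) (divr_gt0 e0 (ltr0n _ 2)).
  apply: filterS => x /(_ _ (tP f af)) hx g.
  apply: le_trans (hx _ g) _; last by lra.
  move=> h g' /= /(_ _ _ af hB g'); rewrite mulfVK// gt_eqF// addr_gt0//.
(* As [k] commutes with the image of [io], the energy of [P f] at [g] is at most the mean of the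
   energies of [f] at the translated points. *)
move=> f ks s af pks hs g; have [cf ef tf] := af.
apply: le_trans (_ : \sum_(k <- ks) L (fun u => d (y f (k * g)%g u) (y f g u) ^+ 2) <= _).
  by apply: ler_sum => k _; exact: sqP.
have [D1 <-] := mean_sum LM ks (F := fun k u => d (y f (k * g)%g u) (y f g u) ^+ 2)
  (fun k => cd _ _ (cy f (k * g)%g cf) (cy f g cf)).
rewrite -(mean_cst LM s); apply: (mean_le LM) => //; first exact: mean_dom_cst LM _.
move=> u _; apply: le_trans (hs ((io (p u))^-1 * g)%g).
rewrite le_eqVlt; apply/orP; left; apply/eqP.
rewrite /energy; elim: {hs D1} ks pks => [|k ks IH] pks; first by rewrite !big_nil.
rewrite !big_cons IH; last by move=> k' hk'; apply: pks; right.
by rewrite yk//; apply: pks; left.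
Qed.
End Smoothing.

(** Midpoints are taken successively with all members of [l], which pair a map with its gain; each
    keeps weight at least [2 ^- size l]. Hence, where [E A] is close to [S], all gains are small
    simultaneously. *)
Lemma averaging (cl : (G -> X) -> Prop) (E : (G -> X) -> G -> R) (S : R)
    (l : seq ((G -> X) * (G -> R))) F0 :
  (forall F F', cl F -> cl F' -> cl (fun g => mid (F g) (F' g))) ->
  (forall F F' g, E (fun g => mid (F g) (F' g)) g <= (E F g + E F' g) / 2) ->
  cl F0 -> (forall g, E F0 g <= S) ->
  (forall x, List.In x l -> cl x.1 /\ forall g, 0 <= x.2 g /\ E x.1 g <= S - x.2 g) ->
  exists2 A, cl A & forall g, E A g <= S /\
    forall x, List.In x l -> E A g <= S - x.2 g / 2 ^+ size l.
Proof.
move=> clm Em cF0 EF0; elim: l => [|x l IH] hl; first by exists F0.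
have [A cA hA] : exists2 A, cl A & forall g, E A g <= S /\
    forall x, List.In x l -> E A g <= S - x.2 g / 2 ^+ size l.
  by apply: IH => y hy; apply: hl; right.
have [cx hx] := hl x (or_introl erefl).
exists (fun g => mid (x.1 g) (A g)); first exact: clm.
move=> g; have h1 := Em x.1 A g; have [x0 h2] := hx g; have [h3 h4] := hA g.
have p0 n : 0 <= ((2 : R) ^+ n)^-1 <= 1.
  by rewrite invr_ge0 exprn_ge0//= invf_le1 ?exprn_gt0// exprn_ege1// ler1n.
split; first by lra.
move=> y [<-|yl] /=.
  have := p0 (size l); rewrite exprS invfM; set c := (_ ^+ _)^-1; nra.
have := h4 y yl; rewrite exprS invfM; set c := (_ ^+ _)^-1; lra.
Qed.

Lemma compact_displacement_bound (f : G -> X) Z : continuous f -> equivariant Gam m f ->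
  compact Z -> exists2 B, 0 <= B & forall x g, Z x -> d (f (x * g)%g) (f g) <= B.
Proof.
move=> cf ef cZ.
have [s hs] : exists s : seq G, forall x, Z x ->
    exists2 i, List.In i s & forall g, d (f (x * i^-1 * g)%g) (f g) < 1.
  apply: (@compact_finite_cover _ _ _ (fun i => [set x | forall g, d (f (x * i^-1 * g)%g) (f g)
    < 1]) cZ) => x _.
  exists x; have n1 := nbhs_mulgr x (equivariant_unif cQ QG cf ef ltr01).
  exact: n1.
have [B B0 hB] : exists2 B, 0 <= B & forall i, List.In i s -> forall g, d (f (i * g)%g) (f g) <= B.
  elim: s {hs} => [|i s [B B0 hB]]; first by exists 0.
  have [B' B'0 hB'] := equivariant_bounded cQ QG i cf cf ef ef.
  exists (B + B'); first by rewrite addr_ge0// ltW.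
  move=> j [<- g|js g]; first by have := hB' g; lra.
  by have := hB _ js g; lra.
exists (1 + B); first by rewrite addr_ge0.
move=> x g Zx; have [i si hi] := hs x Zx.
apply: le_trans (metric_triangle _ (f (i * g)%g) _) _; rewrite lerD ?hB//.
by have := hi (i * g)%g; rewrite -mulgA mulKg => /ltW.
Qed.

Lemma energy_translate ks f h g : (forall k, List.In k ks -> p k = 1%g) ->
  energy ks (fun g => f (io h * g)%g) g = energy ks f (io h * g)%g.
Proof.
move=> pks; rewrite /energy; elim: ks pks => [|k ks IH] pks; first by rewrite !big_nil.
rewrite !big_cons IH; last by move=> k' hk'; apply: pks; right.
by congr (d _ _ ^+ 2 + _); rewrite mulgA (ioC _ (pks _ (or_introl erefl))) -mulgA.
Qed.

(** [sqr_mdist_mid] summed over [ks]. For almost minimizers [F] and [F'] the defect must be small: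
    [d (F g) (F' g)] hardly changes along [ks]. *)
Lemma energy_mid ks F F' g :
  energy ks (fun g => mid (F g) (F' g)) g <= (energy ks F g + energy ks F' g) / 2 -
    (\sum_(k <- ks) (d (F (k * g)%g) (F' (k * g)%g) - d (F g) (F' g)) ^+ 2) / 4.
Proof.
rewrite /energy; elim: ks => [|k ks IH]; first by rewrite !big_nil; lra.
have := sqr_mdist_mid XC (F (k * g)%g) (F' (k * g)%g) (F g) (F' g).
by rewrite !big_cons; lra.
Qed.

Lemma continuous_compact_bounded (f : G -> X) Z x0 : continuous f -> compact Z ->
  exists2 C, 0 <= C & forall q, Z q -> d x0 (f q) <= C.
Proof.
move=> cf cZ.
have [s hs] : exists s : seq G, forall q, Z q -> exists2 i, List.In i s & d (f i) (f q) < 1.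
  apply: (@compact_finite_cover _ _ _ (fun i => [set q | d (f i) (f q) < 1]) cZ) => q _.
  by exists q; have /mcvgP/(_ _ ltr01) := cf q.
have [C C0 hC] : exists2 C, 0 <= C & forall i, List.In i s -> d x0 (f i) <= C.
  elim: s {hs} => [|i s [C C0 hC]]; first by exists 0.
  have i0 := mdist_ge0 x0 (f i).
  exists (C + d x0 (f i)); first by rewrite addr_ge0.
  by move=> j [<-|js]; [|have := hC j js]; lra.
exists (C + 1); first by rewrite addr_ge0.
move=> q /hs[i si hi]; apply: le_trans (metric_triangle _ (f i) _) _.
by rewrite lerD ?hC// ltW.
Qed.

(** * Bounded almost minimizers and their limit *)

Section Minimizing.
Variable P : (G -> X) -> G -> X.
Hypotheses (PA : forall f, admissible f -> admissible (P f))
  (Pr : forall f r, admissible f -> (forall g, d (f g) (f0 g) <= r) ->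
     forall g, d (P f g) (f0 g) <= r + 1)
  (PE : forall f ks s, admissible f -> (forall k, List.In k ks -> p k = 1%g) ->
     (forall g, energy ks f g <= s) -> forall g, energy ks (P f) g <= s)
  (Punif : forall e, 0 < e -> \forall h \near (1%g : H), forall f r, admissible f ->
     (forall g, d (f g) (f0 g) <= r) ->
     forall g, d (P f (io h * g)%g) (P f g) <= e * (r + 1)).
Variables (x0 : X) (S0 : seq G) (kap K0 : R).
Hypotheses (GS0 : forall a, List.In a S0 -> Gm a) (kap0 : 0 < kap)
  (disp : forall z, K0 <= d x0 z -> exists2 a, List.In a S0 & kap * d x0 z < d (m a z) z).

(** For equivariant [F] and [a] in Gamma, [m a (F q) = F (q * a^-1) = F (w a q * q)]: near [F q],
    acting by [a] is left translation by [w a q]. *)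
Let w (a q : G) := (q * a^-1 * q^-1)%g.

Let cw a : continuous (w a).
Proof.
move=> q; apply: cvg_mulg; last by apply: cvg_invg; exact: cvg_id.
by apply: cvg_mulg; [exact: cvg_id|exact: cvg_cst].
Qed.

(** By compactness of [Q], finitely many translates along [H] account for all [w a q] up to [V];
    only these are averaged in [far_minimizer]. *)
Lemma finite_net V : nbhs (1%g : H) V -> exists J : seq H, forall a q,
  List.In a S0 -> Q q -> exists2 j, List.In j J & V (p (w a q) * j^-1)%g.
Proof.
move=> nV; elim: S0 => [|a s [J hJ]]; first by exists [::].
have [J' hJ'] : exists J' : seq H, forall q, Q q ->
    exists2 j, List.In j J' & V (p (w a q) * j^-1)%g.
  apply: (@compact_finite_cover _ _ _ (fun j => [set q | V (p (w a q) * j^-1)%g]) cQ) => q _.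
  exists (p (w a q)).
  have h : (fun q' => p (w a q')) @ q --> p (w a q) by apply: cvg_comp; [exact: cw|exact: cp].
  exact: h _ (nbhs_mulgr (p (w a q)) nV).
exists (J' ++ J) => b q [<-|bs] Qq.
  by have [j jJ hj] := hJ' q Qq; exists j => //; apply: List.in_or_app; left.
by have [j jJ hj] := hJ b q bs Qq; exists j => //; apply: List.in_or_app; right.
Qed.

Lemma kpart_net : exists2 B, 0 <= B & forall a q g,
  List.In a S0 -> Q q -> d (f0 (kpart (w a q) * g)%g) (f0 g) <= B.
Proof.
elim: S0 => [|a s [B B0 hB]]; first by exists 0.
have cwk : continuous (kpart \o w a).
  by move=> q; apply: cvg_comp; [exact: cw|exact: continuous_kpart].
have cZ : compact ((kpart \o w a) @` Q).
  by apply: continuous_compact cQ; exact: continuous_subspaceT.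
have [B' B'0 hB'] := compact_displacement_bound cf0 ef0 cZ.
exists (B + B'); first by rewrite addr_ge0.
move=> b q g [<-|bs] Qq; last by have := hB b q g bs Qq; lra.
have h1 : ((kpart \o w a) @` Q) (kpart (w a q)) by exists q.
by have := hB' _ g h1; lra.
Qed.

(* Averaging [F] with its translates by [J] gives minimizers, which are far from
   [f0] somewhere; there the averaged values must be close to each other. *)
Lemma far_minimizer ks s (J : seq H) D R0 F : (forall k, List.In k ks -> p k = 1%g) ->
  0 <= D -> 1 + D <= R0 -> admissible F -> (forall g, energy ks F g <= s) ->
  (forall g, d (F g) (f0 g) <= R0 + 2) ->
  (forall j, List.In j J -> forall g, d (f0 (io j * g)%g) (f0 g) <= D) ->
  (forall A, admissible A -> (forall g, energy ks A g <= s) ->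
    exists g, R0 - 1 < d (A g) (f0 g)) ->
  let T := 2 ^+ (size J).+1 * (3 * (3 + D)) in
  exists q, [/\ Q q, R0 ^+ 2 - T * R0 <= d (F q) (f0 q) ^+ 2 &
    forall j, List.In j J -> d (F q) (F (io j * q)%g) ^+ 2 <= 4 * (T * R0)].
Proof.
move=> pks D0 R0p aF EF rF hD far T.
(* [S] bounds the squared distance to [f0] of [F], and of its translates by [J], for which [f0]
   itself moves by at most [D]. *)
pose S := (R0 + 2 + D) ^+ 2.
have SR : R0 ^+ 2 <= S by rewrite lerXn2r ?nnegrE; lra.
pose cl F' := admissible F' /\ forall g, energy ks F' g <= s.
pose E (F' : G -> X) g := d (F' g) (f0 g) ^+ 2.
pose tr j g := F (io j * g)%g.
(* The first entry will force [F] to be far from [f0] at the chosen point, the others will force it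
   to be close to its translates there. *)
pose l := (F, fun g => S - d (F g) (f0 g) ^+ 2) ::
  [seq ((fun g => mid (F g) (tr j g)), fun g => d (F g) (tr j g) ^+ 2 / 4) | j <- J].
have clm F1 F2 : cl F1 -> cl F2 -> cl (fun g => mid (F1 g) (F2 g)).
  move=> [a1 e1] [a2 e2]; split; first exact: admissible_gpt.
  move=> g; apply: le_trans (energy_mid _ _ _ _) _; have := e1 g; have := e2 g.
  have : 0 <= \sum_(k <- ks) (d (F1 (k * g)%g) (F2 (k * g)%g) - d (F1 g) (F2 g)) ^+ 2.
    by apply: sumr_ge0 => k _; exact: sqr_ge0.
  by lra.
have cltr j : cl (tr j).
  by split; [exact: admissible_translate|move=> g; rewrite energy_translate].
have Em F1 F2 g : E (fun g => mid (F1 g) (F2 g)) g <= (E F1 g + E F2 g) / 2.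
  rewrite /E !(metric_sym _ (f0 g)); have := CN_mid XC (F1 g) (F2 g) (f0 g).
  by have := sqr_ge0 (d (F1 g) (F2 g)); lra.
have sqS a b : d a b <= R0 + 2 + D -> d a b ^+ 2 <= S.
  by move=> h; rewrite lerXn2r ?nnegrE ?mdist_ge0//; lra.
have FS g : d (F g) (f0 g) ^+ 2 <= S by apply: sqS; have := rF g; lra.
have trS j g : List.In j J -> d (tr j g) (f0 g) ^+ 2 <= S.
  move=> jJ; apply: sqS; apply: le_trans (metric_triangle _ (f0 (io j * g)%g) _) _.
  by have := rF (io j * g)%g; have := hD j jJ g; rewrite /tr; lra.
have [c c0 cE] : exists2 c : R, 0 < c & c = 2 ^+ size l by exists (2 ^+ size l); rewrite ?exprn_gt0.
have TE : T = c * (3 * (3 + D)) by rewrite cE /l /= size_map.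
have [A [aA EA] hA] : exists2 A, cl A & forall g, E A g <= S /\
    forall x, List.In x l -> E A g <= S - x.2 g / c.
  rewrite cE; apply: (averaging clm Em (conj aF EF) FS).
  move=> x [<-|/List.in_map_iff[j [<- jJ]]] /=.
    by split; [split|move=> g; rewrite subr_ge0 FS /E; split=> //; lra].
  split; first by apply: clm; split => //; [exact: (cltr j).1|exact: (cltr j).2].
  move=> g; split; first by rewrite divr_ge0// sqr_ge0.
  rewrite /E !(metric_sym _ (f0 g)); have := CN_mid XC (F g) (tr j g) (f0 g).
  have := FS g; have := trS j g jJ; rewrite !(metric_sym _ (f0 g)); lra.
have [g hg] := far A aA EA; clear cE.
have lowA : (R0 - 1) ^+ 2 <= E A g by rewrite lerXn2r ?nnegrE ?mdist_ge0 ?(ltW hg)//; lra.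
(* The gap between the upper bound [S] and the lower bound [(R0 - 1) ^+ 2] is linear in [R0], hence
   negligible against [R0 ^+ 2]. *)
have e1 : S = (R0 - 1) ^+ 2 + (3 + D) * (2 * R0 + 1 + D) by rewrite /S; ring.
have e2 : (3 + D) * (2 * R0 + 1 + D) <= (3 + D) * (3 * R0) by rewrite ler_wpM2l; lra.
have low x : List.In x l -> x.2 g <= T * R0.
  move=> /(proj2 (hA g)) h.
  have h1 : x.2 g / c <= (3 + D) * (3 * R0).
    by move: h lowA e2; rewrite e1; move: (x.2 g / _) (E A g) => q' e'; lra.
  rewrite ler_pdivrMr// in h1; apply: le_trans h1 _; rewrite TE.
  by rewrite le_eqVlt; apply/orP; left; apply/eqP; ring.
pose q := xget 1%g [set q | Q q /\ Gm (q^-1 * g)%g].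
have [Qq qg] : Q q /\ Gm (q^-1 * g)%g.
  by apply: (@xgetPex _ 1%g [set q | Q q /\ Gm (q^-1 * g)%g]); have [x Qx xg] := QG g; exists x.
have [_ eF _] := aF.
have gE : g = (q * (q^-1 * g))%g by rewrite mulVKg.
exists q; split=> // [|j jJ].
  rewrite -(equivariant_mdist q eF ef0 qg) -gE.
  by have := low _ (or_introl erefl) => /= h; lra.
have [[_ etrj _] _] := cltr j; rewrite -/(tr j q).
rewrite -(equivariant_mdist q eF etrj qg) -gE.
have := low (_, _) (or_intror (proj2 (List.in_map_iff _ _ _) (ex_intro _ j (conj erefl jJ)))) =>
  /= h.
by lra.
Qed.

(** [R0] is the infimum of the possible distances to [f0]. If it were large, smoothing a nearly
    closest map and averaging its translates by [J] would give a point [F q] of [X] at distance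
    about [R0] or at least [R0 / 2] from [f0 q], moved by every [a] in [S0] less than [disp]
    allows. *)
Lemma bounded_minimizers : exists2 B, 0 <= B & forall ks s,
  (forall k, List.In k ks -> p k = 1%g) ->
  (exists2 f, admissible f & forall g, energy ks f g <= s) ->
  exists f, [/\ admissible f, forall g, energy ks f g <= s & forall g, d (f g) (f0 g) <= B].
Proof.
have [C1 C10 hC1] : exists2 C, 0 <= C & forall q, Q q -> d x0 (f0 q) <= C.
  exact: continuous_compact_bounded.
(* Two moves of about [ep * R0] cost [kap * R0 / 4], half of the displacement [kap * R0 / 2]
   demanded by [disp]; the other half pays for [B2], [C1] and rounding. *)
pose ep := kap / 8.
have ep0 : 0 < ep by rewrite divr_gt0.
have [J hJ] := finite_net (Punif ep0).
have [B2 B20 hB2] := kpart_net.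
have [D D0 hD] : exists2 D, 0 <= D & forall j, List.In j J -> forall g,
    d (f0 (io j * g)%g) (f0 g) <= D.
  elim: {hJ} J => [|j J [D D0 hD]]; first by exists 0.
  have [D' D'0 hD'] := equivariant_bounded cQ QG (io j) cf0 cf0 ef0 ef0.
  exists (D + D'); first by rewrite addr_ge0// ltW.
  move=> j' [<- g|js g]; first by have := hD' g; lra.
  by have := hD _ js g; lra.
pose T : R := 2 ^+ (size J).+1 * (3 * (3 + D)).
have T0 : 0 <= T by rewrite !mulr_ge0 ?exprn_ge0 ?addr_ge0.
pose Rb := 1 + D + 4 * T / ep ^+ 2 + 2 * T + 2 * (C1 + `|K0|) +
  4 * (B2 + kap / 4 + kap * C1) / kap.
have large R0 : Rb < R0 -> [/\ 1 + D <= R0, R0 / 2 - C1 >= `|K0|,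
    (R0 / 2) ^+ 2 <= R0 ^+ 2 - T * R0, 4 * (T * R0) <= (ep * R0) ^+ 2 &
    B2 + ep * (R0 + 2) + ep * R0 <= kap * (R0 / 2 - C1)].
  have t1 : 0 <= 4 * T / ep ^+ 2 by rewrite divr_ge0 ?sqr_ge0// mulr_ge0.
  have t2 : 0 <= 4 * (B2 + kap / 4 + kap * C1) / kap.
    have k1 : 0 <= kap by exact: ltW.
    by rewrite divr_ge0// mulr_ge0// !addr_ge0// ?mulr_ge0// divr_ge0.
  have t3 : 0 <= `|K0| by exact: normr_ge0.
  rewrite /Rb => h; have h1 : 1 + D <= R0 by lra.
  have h2 : 4 * T / ep ^+ 2 <= R0 by lra.
  have h3 : 4 * (B2 + kap / 4 + kap * C1) / kap <= R0 by lra.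
  have h4 : 2 * T <= R0 by lra.
  rewrite ler_pdivrMr ?exprn_gt0// in h2; rewrite ler_pdivrMr// in h3.
  split=> //; [lra|nra| |rewrite /ep; lra].
  have R1 : 0 <= R0 by lra.
  have -> : (ep * R0) ^+ 2 = R0 * ep ^+ 2 * R0 by ring.
  by rewrite mulrA; exact: ler_wpM2r.
exists (`|Rb| + 1) => [|ks s pks [f1 af1 Ef1]]; first by rewrite addr_ge0.
pose RR := [set r : R | 0 <= r /\ exists f,
  [/\ admissible f, forall g, energy ks f g <= s & forall g, d (f g) (f0 g) <= r]].
have hiR : has_inf RR.
  split; last by exists 0 => r [].
  have [B B0 hB] := admissible_bounded af1.
  by exists B; split; [exact: ltW|exists f1].
have RRlow r : RR r -> inf RR <= r by move=> h; apply: ge_inf => //; exact: hiR.2.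
have [r [r0 [f [af Ef rf]]] hr] := inf_adherent ltr01 hiR.
set R0 := inf RR in hr RRlow.
have [R0b|/large[R0p zK half small ineq]] := leP R0 Rb.
  exists f; split=> // g; apply: le_trans (rf g) _.
  by have := ler_norm Rb; lra.
exfalso.
have aF := PA af; have EF := PE af pks Ef; have rF := Pr af rf.
set F := P f in aF EF rF.
have [|A aA EA|q [Qq far near]] := far_minimizer pks D0 R0p aF EF _ hD.
- by move=> g; have := rF g; lra.
- apply: contrapT => h; suff /RRlow : RR (R0 - 1) by lra.
  split; first by lra.
  by exists A; split=> // g; rewrite leNgt; apply/negP => hg; apply: h; exists g.
have R00 : 0 <= R0 by lra.
have {}far : R0 / 2 <= d (F q) (f0 q).
  rewrite -(ler_pXn2r (n := 2)) ?nnegrE ?mdist_ge0 ?divr_ge0//.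
  exact: le_trans half far.
have {}near j : List.In j J -> d (F q) (F (io j * q)%g) <= ep * R0.
  move=> jJ; apply: ler_sqr_mdist; first by rewrite mulr_ge0// ltW.
  exact: le_trans (near j jJ) small.
have zfar : R0 / 2 - C1 <= d x0 (F q).
  have := hC1 q Qq; have := metric_triangle (F q) x0 (f0 q).
  by rewrite (metric_sym (F q) x0); lra.
have [|a aS hz] := @disp (F q).
  exact: le_trans (ler_norm _) (le_trans zK zfar).
have [_ eF _] := aF.
have [j jJ Vj] := hJ a q aS Qq.
pose v := (p (w a q) * j^-1)%g.
(* The translation by [w a q] is split into three: by [j], short by averaging; by the small [v],
   short by smoothing; by the kernel part, bounded by tameness. *)
have ha : m a (F q) = F (kpart (w a q) * (io v * (io j * q)))%g.
  have Ga := GS0 aS; have -> : m a (F q) = F (q * a^-1)%g by rewrite (eF _ _ (subgroupV Ga)) invgK.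
  congr F; rewrite (mulgA (io v)) -ioM mulgVK mulgA -(ioC _ (p_kpart _)) -kpartE.
  by rewrite /w mulgVK.
have b1 : d (m a (F q)) (F (io v * (io j * q))%g) <= B2.
  by rewrite ha; case: aF => _ _; apply => [|g']; [exact: p_kpart|exact: hB2].
have b2 : d (F (io v * (io j * q))%g) (F (io j * q)%g) <= ep * (R0 + 2).
  by apply: le_trans (Vj f r af rf (io j * q)%g) _; rewrite ler_pM2l//; lra.
suff : d (m a (F q)) (F q) <= kap * d x0 (F q) by rewrite leNgt hz.
apply: le_trans (metric_triangle _ (F (io v * (io j * q))%g) _) _.
apply: le_trans (lerD b1 (metric_triangle _ (F (io j * q)%g) _)) _.
rewrite (metric_sym _ (F q)); apply: le_trans (lerD (lexx _) (lerD b2 (near j jJ))) _.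
by rewrite addrA; apply: le_trans ineq _; rewrite ler_pM2l.
Qed.

(** Applied to an almost minimizer, two such operators give maps with the same energy bound, so that
    their midpoint cannot gain much. *)
Definition stable_operator (W : (G -> X) -> G -> X) := forall f, admissible f ->
  admissible (W f) /\ forall ks s, (forall k, List.In k ks -> p k = 1%g) ->
    (forall g, energy ks f g <= s) -> forall g, energy ks (W f) g <= s.

(* An average of almost minimizers has almost maximal energy at some point, and
   there its uniform convexity defects are small. *)
Lemma near_minimizers : exists Bd V, [/\ 0 <= Bd, forall e : R, 0 < e -> nbhs (1%g : H) (V e) &
  forall (ks : seq G) (L : seq (((G -> X) -> G -> X) * ((G -> X) -> G -> X))) (de : R),
  (forall k, List.In k ks -> p k = 1%g) ->
  (forall W, List.In W L -> stable_operator W.1 /\ stable_operator W.2) -> 0 < de ->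
  exists f g, [/\ Q g, admissible f, forall g, d (f g) (f0 g) <= Bd,
    forall e h g, 0 < e -> V e h -> d (f (io h * g)%g) (f g) <= e &
    forall W k, List.In W L -> List.In k ks ->
      (d (W.1 f (k * g)%g) (W.2 f (k * g)%g) - d (W.1 f g) (W.2 f g)) ^+ 2 <= de]].
Proof.
have [Bd Bd0 hBd] := bounded_minimizers.
(* [V] is fixed before [ks], [L] and [de]: this uniformity makes the ultralimit continuous along
   [H]. *)
pose V e := [set h | forall f, admissible f -> (forall g, d (f g) (f0 g) <= Bd) ->
  forall g, d (P f (io h * g)%g) (P f g) <= e].
exists (Bd + 1), V; split; first by rewrite addr_ge0.
  move=> e e0; have e1 : 0 < e / (Bd + 1) by rewrite divr_gt0//; lra.
  have := Punif e1; apply: filterS => h hh f af bf g.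
  by have := hh f Bd af bf g; rewrite mulfVK// gt_eqF//; lra.
move=> ks L de pks Lst de0.
pose SS := [set s : R | exists2 f, admissible f & forall g, energy ks f g <= s].
have [B1 hB1] : exists B, forall g, energy ks f0 g <= B.
  rewrite /energy; elim: ks {pks SS} => [|k ks [B hB]].
    by exists 0 => g; rewrite big_nil.
  have [B' B'0 hB'] := equivariant_bounded cQ QG k cf0 cf0 ef0 ef0.
  exists (B' ^+ 2 + B) => g; rewrite big_cons lerD//.
  by rewrite lerXn2r ?nnegrE ?mdist_ge0 ?hB'// ltW.
have hiS : has_inf SS.
  split; first by exists B1, f0 => //; exact: admissible0.
  exists 0 => s [f _ /(_ 1%g)]; apply: le_trans.
  by apply: sumr_ge0 => k _; exact: sqr_ge0.
(* A gain [df / 4] of weight [2 ^- N] has to fit in a window of width [2 * et] around the infimum,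
   which gives [df <= de]. *)
pose N := size L; pose et := de / (8 * 2 ^+ N).
have p2 : 0 < 2 ^+ N :> R by rewrite exprn_gt0.
have et0 : 0 < et by rewrite divr_gt0// mulr_gt0.
have [s sS hs] := inf_adherent et0 hiS.
have [f [af Ef bf]] := hBd ks s pks sS.
have aF := PA af; have EF := PE af pks Ef; have bF := Pr af bf.
pose df W g := \sum_(k <- ks)
  (d (W.1 (P f) (k * g)%g) (W.2 (P f) (k * g)%g) - d (W.1 (P f) g) (W.2 (P f) g)) ^+ 2.
have df0 W g : 0 <= df W g by apply: sumr_ge0 => k _; exact: sqr_ge0.
have clm F1 F2 : admissible F1 -> admissible F2 -> admissible (fun g => mid (F1 g) (F2 g)).
  exact: admissible_gpt.
have Em F1 F2 g : energy ks (fun g => mid (F1 g) (F2 g)) g <= (energy ks F1 g + energy ks F2 g) / 2.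
  apply: le_trans (energy_mid _ _ _ _) _; rewrite gerBl divr_ge0//.
  by apply: sumr_ge0 => k _; exact: sqr_ge0.
pose l := [seq ((fun g => mid (W.1 (P f) g) (W.2 (P f) g)), fun g => df W g / 4) | W <- L].
have [A aA hA] : exists2 A, admissible A & forall g, energy ks A g <= s /\
    forall x, List.In x l -> energy ks A g <= s - x.2 g / 2 ^+ size l.
  apply: (averaging clm Em aF EF) => x /List.in_map_iff[W [<- WL]] /=.
  have [/(_ _ aF)[a1 e1] /(_ _ aF)[a2 e2]] := Lst W WL.
  split; first exact: clm.
  move=> g; split; first by rewrite divr_ge0.
  have := energy_mid ks (W.1 (P f)) (W.2 (P f)) g; rewrite -/(df W g).
  have := e1 ks s pks EF g; have := e2 ks s pks EF g; lra.
have [g hg] : exists g, inf SS - et < energy ks A g.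
  apply: contrapT => h.
  suff : inf SS <= inf SS - et by lra.
  apply: ge_inf; first exact: hiS.2.
  exists A => // g; rewrite leNgt; apply/negP => hg; apply: h; by exists g.
have [q Qq qg] := QG g; have gE : g = (q * (q^-1 * g))%g by rewrite mulVKg.
exists (P f), q; split => //.
  by move=> e h g' _; apply.
move=> W k WL kks; have [/(_ _ aF)[[_ e1 _] _] /(_ _ aF)[[_ e2 _] _]] := Lst W WL.
have -> : d (W.1 (P f) q) (W.2 (P f) q) = d (W.1 (P f) g) (W.2 (P f) g).
  by rewrite -(equivariant_mdist q e1 e2 qg) -gE.
have -> : d (W.1 (P f) (k * q)%g) (W.2 (P f) (k * q)%g) = d (W.1 (P f) (k * g)%g) (W.2 (P f) (k
  * g)%g).
  by rewrite -(equivariant_mdist (k * q)%g e1 e2 qg) -mulgA -gE.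
apply: (@le_trans _ _ (df W g)).
  rewrite /df; elim: ks kks {pks SS B1 hB1 hiS sS hs Ef EF df df0 Em l A aA hA hg} => [//|k' ks'
    IH] [->|h].
    by rewrite big_cons lerDl sumr_ge0// => k'' _; exact: sqr_ge0.
  by rewrite big_cons; apply: le_trans (IH h) _; rewrite lerDr sqr_ge0.
have := (hA g).2 (_, _) (proj2 (List.in_map_iff _ _ _) (ex_intro _ W (conj erefl WL))) => /=.
rewrite size_map -/N => h.
have : df W g / 4 / 2 ^+ N <= 2 * et by move: h hg hs; set q1 := _ / 2 ^+ N; lra.
rewrite ler_pdivrMr// (_ : 2 * et * 2 ^+ N = de / 4); first by lra.
by rewrite /et; field; rewrite gt_eqF.
Qed.

Lemma admissible_ev u f : admissible f -> admissible (ev io u f).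
Proof.
by move=> af; elim: u => [h|v IH v' IH' t]; [exact: admissible_translate|exact: admissible_gpt].
Qed.

(** Translating along [H] only moves the point where the energy is read, and energy is convex along
    geodesics. *)
Lemma ev_stable u : stable_operator (ev io u).
Proof.
move=> f af; split; first exact: admissible_ev.
move=> ks s pks Es; elim: u => [h|v IH v' IH' t] g /=.
  by rewrite [leLHS]energy_translate.
have h01 := clamp_itv t; set c := clamp t in h01.
apply: (@le_trans _ _ ((1 - c) * energy ks (ev io v f) g + c * energy ks (ev io v' f) g)).
  rewrite /energy; elim: ks {pks Es IH IH'} => [|k ks IHk].
    by rewrite !big_nil !mulr0 addr0.
  have := sqr_mdist_gpt XC (ev io v f (k * g)%g) (ev io v' f (k * g)%g)
    (ev io v f g) (ev io v' f g) h01.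
  by rewrite !gpt_clamp !big_cons; lra.
have := IH g; have := IH' g; case/andP: h01 => c0 c1.
set e1 := energy _ _ _; set e2 := energy _ _ _; nra.
Qed.

(** The ultralimit is over pairs of a map and a base point in [Q], finitely many words, elements [k]
    and tolerances being handled at a time by [near_minimizers]. *)
Lemma limit_map : exists f g0, admissible f /\ forall u u' k, p k = 1%g ->
  d (ev io u f (k * g0)%g) (ev io u' f (k * g0)%g) = d (ev io u f g0) (ev io u' f g0).
Proof.
have [Bd [V [Bd0 nV near]]] := near_minimizers.
pose regular (i : (G -> X) * G) := [/\ Q i.2, admissible i.1,
  forall g, d (i.1 g) (f0 g) <= Bd &
  forall e h g, 0 < e -> V e h -> d (i.1 (io h * g)%g) (i.1 g) <= e].
pose dist u u' (f : G -> X) g : R := d (ev io u f g) (ev io u' f g).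
pose cond (c : word R H * word R H * G * R) (i : (G -> X) * G) :=
  let: (u, u', k, e) := c in regular i /\
  (p k = 1%g -> 0 < e -> `|dist u u' i.1 (k * i.2)%g - dist u u' i.1 i.2| <= e).
have [U UU hU] : exists2 U : set_system ((G -> X) * G), UltraFilter U & forall c, U (cond c).
  apply: ultra_fip => s.
  have [de de0 hde] : exists2 de : R, 0 < de & forall c, List.In c s -> 0 < c.2 -> de <= c.2 ^+ 2.
    elim: s => [|c s [de de0 hde]]; first by exists 1.
    have [c0|c0] := ltP 0 c.2.
      exists (Num.min de (c.2 ^+ 2)); first by rewrite lt_min de0 exprn_gt0.
      by move=> c' [<- _|/hde h /h]; rewrite ge_min ?lexx ?orbT// => ->.
    exists de => // c' [<-|]; last exact: hde.
    by rewrite ltNge c0.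
  (* Elements outside the kernel carry no condition; 1 is put in their place because [near] requires
     kernel elements. *)
  pose ks := [seq (if `[< p c.1.2 = 1%g >] then c.1.2 else 1%g) | c <- s].
  pose L : seq (((G -> X) -> G -> X) * ((G -> X) -> G -> X)) :=
    [seq (ev io c.1.1.1, ev io c.1.1.2) | c <- s].
  have [|||f [g [Qg af bf Vf hfg]]] := near ks L de => //.
  - move=> k /List.in_map_iff[c [<- _]]; case: asboolP => // _; exact: p1.
  - by move=> W /List.in_map_iff[c [<- _]] /=; split; exact: ev_stable.
  exists (f, g) => -[[[u u'] k] e] cs; split; first by split.
  move=> pk e0; have h1 : List.In (ev io u, ev io u') L by apply/List.in_map_iff;
    exists (u, u', k, e).
  have h2 : List.In k ks.
    by apply/List.in_map_iff; exists (u, u', k, e); split => //=; case: asboolP.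
  have := hfg _ _ h1 h2 => /= h3.
  have h4 := le_trans h3 (hde _ cs e0).
  rewrite -(ler_pXn2r (n := 2)) ?nnegrE//; last exact: ltW.
  by rewrite real_normK// num_real.
have Ureg : U regular.
  by apply: filterS (hU (Leaf 1%g, Leaf 1%g, 1%g, 1)) => i [].
have [F hF] : {F : G -> X & forall g, (fun i => i.1 g) @ U --> F g}.
  apply: (@choice G X (fun g l => (fun i : (G -> X) * G => i.1 g) @ U --> l)) => g.
  have [|l _ hl] := @proper_ultra_cvg _ _ _ U UU (fun i => i.1 g) (f0 g) Bd XP; last by exists l.
  by apply: filterS Ureg => i [_ _ h _]; rewrite metric_sym.
have [g0 Qg0 hg0] : exists2 g0, Q g0 & snd @ U --> g0.
  by apply: (compact_ultra_cvg UU cQ); apply: filterS Ureg => i [].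
have equi (e : R) : 0 < e -> \forall x \near (1%g : G), forall i, regular i ->
    forall g, d (i.1 (x * g)%g) (i.1 g) <= e.
  move=> e0; have e2 : 0 < e / 2 by rewrite divr_gt0.
  apply: filterS (tame_equicontinuous (nV _ e2) e2) => x hx i [_ [_ _ ti] _ hi] g.
  have := hx i.1 ti; rewrite mulrCA divff ?mulr1//; apply.
  by move=> h g' Vh; apply: hi.
have lim_le (a b : G) (B : R) : (forall i, regular i -> d (i.1 a) (i.1 b) <= B) ->
    d (F a) (F b) <= B.
  move=> h; apply: (lim_mdist_le (hF a) (hF b)) => e e0; apply: filterS Ureg => i /h.
  by move=> hi; rewrite (le_trans hi)// lerDl ltW.
have aF : admissible F.
  split.
  - apply: unif_continuous => e e0; apply: filterS (equi _ e0) => x hx g.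
    by apply: lim_le => i /hx.
  - move=> g h Gh; apply: (mcvg_unique (hF (g * h)%g)).
    have h1 : (fun i => m h^-1%g (i.1 g)) @ U --> m h^-1%g (F g).
      apply/mcvgP => e e0; move/mcvgP/(_ _ e0): (hF g); apply: filterS => i.
      by rewrite isometric_mapP.
    apply: cvg_trans h1; apply: near_eq_cvg; apply: filterS Ureg => i [_ [_ ei _] _ _].
    by rewrite ei.
  - move=> k pk B hB g; apply: lim_le => i [_ [_ _ ti] _ _]; exact: ti.
(* Map and base point vary together; equicontinuity allows both limits at once. *)
have evl u k : (fun i => ev io u i.1 (k * i.2)%g) @ U --> ev io u F (k * g0)%g.
  elim: u => [h|v IH v' IH' t] /=; last exact: cvg_gpt.
  set y := (io h * (k * g0))%g.
  have h1 : (fun i : (G -> X) * G => (io h * (k * i.2) * y^-1)%g) @ U --> (1%g : G).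
    rewrite -(mulgV y); apply: cvg_mulg; last exact: cvg_cst.
    by apply: cvg_mulg; [exact: cvg_cst|apply: cvg_mulg => //; exact: cvg_cst].
  apply/mcvgP => e e0; have e2 : 0 < e / 2 by rewrite divr_gt0.
  move/mcvgP/(_ _ e2): (hF y) => h2; have h3 := h1 _ (equi _ e2).
  move: h2 h3 Ureg; apply: filterS3 => i h2 h3 ri.
  apply: le_lt_trans (metric_triangle _ (i.1 y) _) _.
  have h4 : d (i.1 y) (i.1 (io h * (k * i.2))%g) <= e / 2.
    by rewrite metric_sym; have := h3 i ri y; rewrite mulgVK.
  by rewrite [ltRHS]splitr; exact: ltr_leD h2 h4.
exists F, g0; split=> // u u' k pk.
have c1 : (fun i => dist u u' i.1 (k * i.2)%g) @ U --> dist u u' F (k * g0)%g by exact: cvg_mdist.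
have c2 : (fun i => dist u u' i.1 i.2) @ U --> dist u u' F g0.
  have -> : (fun i : (G -> X) * G => dist u u' i.1 i.2) = (fun i => dist u u' i.1 (1 * i.2)%g).
    by apply/funext => i; rewrite mul1g.
  by rewrite (_ : dist u u' F g0 = dist u u' F (1 * g0)%g); [exact: cvg_mdist|rewrite mul1g].
apply/eqP; rewrite -subr_eq0 -normr_le0; apply/ler_addgt0Pl => e e0; rewrite addr0.
have e2 : 0 < e / 2 by rewrite divr_gt0.
have c3 : (fun i => dist u u' i.1 (k * i.2)%g - dist u u' i.1 i.2) @ U -->
    dist u u' F (k * g0)%g - dist u u' F g0 by exact: cvgB.
move/cvgrPdist_lt/(_ _ e2): c3 => c3.
have [i [/= h1 [_ h2]]] := filter_ex (filterI c3 (hU (u, u', k, e / 2))).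
have := h2 pk e2; move: h1; rewrite /dist !ltr_norml !ler_norml; lra.
Qed.

End Minimizing.

Lemma rigid_map (K : set G) (M : (G -> R) -> R) (x0 : X) (S0 : seq G) (kap K0 : R) :
  locally_compact [set: G] -> hausdorff_space G -> nbhs 1%g K -> is_local_haar K M ->
  (forall a, List.In a S0 -> Gm a) -> 0 < kap ->
  (forall z, K0 <= d x0 z -> exists2 a, List.In a S0 & kap * d x0 z < d (m a z) z) ->
  exists f g0, admissible f /\ forall u u' k, p k = 1%g ->
    d (ev io u f (k * g0)%g) (ev io u' f (k * g0)%g) = d (ev io u f g0) (ev io u' f g0).
Proof.
move=> lcG hG nK HM GS0 kap0 disp.
have [P [PA Pr PE Pu]] := smoothing_exists lcG hG nK HM.
exact: (limit_map PA Pr PE Pu GS0 kap0 disp).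
Qed.

End Stage.

(** * The orbit of one factor *)

Section Circumcenter.
Variables (R : realType) (X : metricType R).
Hypotheses (XC : is_CAT0 X) (XP : is_proper X).
Local Notation d := (@mdist R X).
Variable T : Type.

Definition sup_sqr (y : T -> X) (z : X) : R := sup (range (fun t => d z (y t) ^+ 2)).

Lemma sup_sqr_le (y : T -> X) (t0 : T) z C : (forall t, d z (y t) ^+ 2 <= C) -> sup_sqr y z <= C.
Proof.
move=> h; apply: ge_sup; first by exists (d z (y t0) ^+ 2), t0.
by move=> _ [t _ <-].
Qed.

Section Bounded.
Variables (y : T -> X) (t0 : T) (B : R).
Hypothesis yB : forall t, d (y t0) (y t) <= B.

Lemma mdist_bounded z t : d z (y t) <= d z (y t0) + B.
Proof. by apply: le_trans (metric_triangle _ (y t0) _) _; rewrite lerD2l. Qed.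

Lemma sup_sqr_ge z t : d z (y t) ^+ 2 <= sup_sqr y z.
Proof.
apply: ub_le_sup; last by exists t.
exists ((d z (y t0) + B) ^+ 2) => _ [t' _ <-].
rewrite lerXn2r ?nnegrE ?mdist_ge0 ?mdist_bounded//.
exact: le_trans (mdist_ge0 _ _) (mdist_bounded z t0).
Qed.

Lemma circumcenter_exists : exists b, is_argmin (sup_sqr y) b.
Proof.
have B0 : 0 <= B := le_trans (mdist_ge0 _ _) (yB t0).
apply: (argmin_exists XC XP (lb := 0) (y t0)).
- move=> u v; apply: (sup_sqr_le t0) => t; have := CN_mid XC u v (y t).
  rewrite !(metric_sym (y t)); have := sup_sqr_ge u t; have := sup_sqr_ge v t; lra.
- by move=> z; apply: le_trans (sup_sqr_ge z t0); exact: sqr_ge0.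
move=> b e e0; have b0 := mdist_ge0 b (y t0); set C := d b (y t0) + B.
have C0 : 0 < 3 + 2 * C by rewrite /C; lra.
exists (Num.min 1 (e / (3 + 2 * C))); first by rewrite lt_min ltr01 divr_gt0.
move=> x; rewrite lt_min ltr_pdivlMr// => /andP[x1 xe]; apply: (sup_sqr_le t0) => t.
have h1 := sup_sqr_ge x t; have h2 := metric_triangle b x (y t).
have h3 := metric_triangle x b (y t); rewrite (metric_sym x b) in h3.
have h4 := mdist_bounded b t; have h5 := mdist_ge0 b x; have h6 := mdist_ge0 x (y t).
have h7 := mdist_ge0 b (y t); rewrite -/C in h4; nra.
Qed.

Lemma circumcenter_radius b t : is_argmin (sup_sqr y) b -> d b (y t) <= B.
Proof.
have B0 : 0 <= B := le_trans (mdist_ge0 _ _) (yB t0).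
move=> hb; apply: ler_sqr_mdist => //; apply: le_trans (sup_sqr_ge b t) _.
apply: (@le_trans _ _ (sup_sqr y (y t0))).
  by apply: le_trans (hb _); rewrite lerDl sqr_ge0.
by apply: (sup_sqr_le t0) => t'; rewrite lerXn2r ?nnegrE ?mdist_ge0.
Qed.

End Bounded.

(** As for barycenters, each growth inequality is tested at the other center. At distance at most
    [B], a change of [e] alters squares by at most [e * (2 * B + e)]. *)
Lemma circumcenter_close (y y' : T -> X) (t0 : T) (B e : R) b b' :
  (forall t, d (y t0) (y t) <= B) -> (forall t, d (y' t0) (y' t) <= B) ->
  (forall t, d (y t) (y' t) <= e) -> is_argmin (sup_sqr y) b -> is_argmin (sup_sqr y') b' ->
  d b b' ^+ 2 <= e * (2 * B + e).
Proof.
move=> yB yB' ye hb hb'.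
have e0 : 0 <= e := le_trans (mdist_ge0 _ _) (ye t0).
have h1 : sup_sqr y' b <= sup_sqr y b + e * (2 * B + e).
  apply: (sup_sqr_le t0) => t; have h1 := sup_sqr_ge yB b t.
  have h2 := circumcenter_radius yB t hb; have h3 := metric_triangle b (y t) (y' t).
  have h4 := mdist_ge0 b (y' t); have h5 := mdist_ge0 b (y t); have := ye t; nra.
have h2 : sup_sqr y b' <= sup_sqr y' b' + e * (2 * B + e).
  apply: (sup_sqr_le t0) => t; have h2 := sup_sqr_ge yB' b' t.
  have h3 := circumcenter_radius yB' t hb'; have h4 := metric_triangle b' (y' t) (y t).
  have h5 := mdist_ge0 b' (y' t); have h6 := mdist_ge0 b' (y t).
  by have := ye t; rewrite (metric_sym (y t)); nra.
by have := hb b'; have := hb' b; rewrite (metric_sym b' b); lra.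
Qed.

End Circumcenter.

(** * Bounded orbits: an invariant equivariant map *)

Section Orbit.
Variables (R : realType) (X : metricType R).
Hypotheses (XC : is_CAT0 X) (XP : is_proper X).
Local Notation d := (@mdist R X).
Variables (G H : topologicalGroupType) (Gam : subgroup G) (m : G -> isometric_map X).
Local Notation Gm := (subgroup_set Gam).
Hypotheses (m1 : forall x, m 1%g x = x)
  (mM : forall g h x, Gm g -> Gm h -> m (g * h)%g x = m g (m h x)).
Variable Q : set G.
Hypotheses (cQ : compact Q) (QG : forall g, exists2 x, Q x & Gm (x^-1 * g)%g).
Variables (io : H -> G) (p : G -> H).
Hypotheses (ioM : forall a b, io (a * b)%g = (io a * io b)%g) (cio : continuous io)
  (pM : forall a b, p (a * b)%g = (p a * p b)%g) (cp : continuous p)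
  (pio : forall h, p (io h) = h)
  (ioC : forall h k, p k = 1%g -> (io h * k)%g = (k * io h)%g).
Variables (f0 f : G -> X) (g0 : G).
Hypotheses (cf0 : continuous f0) (ef0 : equivariant Gam m f0)
  (af : admissible Gam m p f0 f).

Let cf : continuous f. Proof. by case: af. Qed.
Let ef : equivariant Gam m f. Proof. by case: af. Qed.
Let tf : tame p f0 f. Proof. by case: af. Qed.

Let pk x : p (kpart io p x) = 1%g. Proof. exact: p_kpart. Qed.

(** Every [H]-orbit in [G] is a kernel translate of that of [g0], reparametrized by [h']; tameness
    then carries boundedness from the orbit of [g0] to all others. *)
Lemma orbit_split g : exists2 k, p k = 1%g & exists h', forall h,
  (io h * g = k * (io (h * h') * g0))%g.
Proof.
pose x := (g * g0^-1)%g.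
exists (kpart io p x) => //; exists (p x) => h'.
have gE : g = (io (p x) * kpart io p x * g0)%g by rewrite -kpartE mulgVK.
by rewrite {1}gE (mulgA (kpart io p x)) -(ioC _ (pk x)) ioM !mulgA.
Qed.

Lemma tame_bounded k : p k = 1%g -> exists2 B, 0 <= B &
  forall f', tame p f0 f' -> forall g, d (f' (k * g)%g) (f' g) <= B.
Proof.
move=> pk1; have [B B0 hB] := equivariant_bounded cQ QG k cf0 cf0 ef0 ef0.
by exists B; [exact: ltW|move=> f' tf' g; exact: tf'].
Qed.

Section BoundedOrbit.
Variable B : R.
Hypothesis fB : forall h, d (f g0) (f (io h * g0)%g) <= B.

Let y g h := f (io h * g)%g.

Lemma orbit_bounded g : exists C, forall h, d (y g 1%g) (y g h) <= C.
Proof.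
have [k pk1 [h' hE]] := orbit_split g; have [C C0 hC] := tame_bounded pk1.
have near h : d (f g0) (y g h) <= B + C.
  rewrite /y hE; apply: le_trans (metric_triangle _ (f (io (h * h') * g0)%g) _) _.
  by rewrite lerD ?fB// metric_sym hC.
exists (B + C + (B + C)) => h; apply: le_trans (metric_triangle _ (f g0) _) _.
by rewrite lerD// metric_sym.
Qed.

(** The circumcenter depends only on the orbit as a set, which gives [H]-invariance. The last clause
    is tameness with bound 0; it preserves the invariance already obtained along other factors. *)
Lemma invariant_map : exists f', [/\ continuous f', equivariant Gam m f',
  forall h g, f' (io h * g)%g = f' g &
  forall k, p k = 1%g -> (forall g, f0 (k * g)%g = f0 g) -> forall g, f' (k * g)%g = f' g].
Proof.
pose f' g := argmin (f g) (sup_sqr (y g)).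
have f'P g : is_argmin (sup_sqr (y g)) (f' g).
  have [C hC] := orbit_bounded g; have [b hb] := circumcenter_exists XC XP hC.
  by rewrite /f' (argmin_eq (f g) hb).
have f'E g b : is_argmin (sup_sqr (y g)) b -> f' g = b by exact: is_argmin_uniq.
have inv h g : f' (io h * g)%g = f' g.
  apply: f'E; suff -> : sup_sqr (y (io h * g)%g) = sup_sqr (y g) by [].
  apply/funext => z; rewrite /sup_sqr; congr sup; apply/seteqP; split => _ [h' _ <-].
    by exists (h' * h)%g => //; rewrite /y ioM mulgA.
  by exists (h' * h^-1)%g => //; rewrite /y mulgA -ioM mulgVK.
exists f'; split=> //.
- move=> g; apply/mcvgP => e e0; have [C hC] := orbit_bounded g.
  have C0 : 0 <= C := le_trans (mdist_ge0 _ _) (hC 1%g).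
  (* With radius [C + 2 * e'], [circumcenter_close] gives [e' * (2 * C + 5 * e')], at most half of
     [e ^+ 2] as [e' <= 1]. *)
  pose e' := Num.min 1 (e ^+ 2 / (2 * (2 * C + 5))).
  have c5 : 0 < 2 * (2 * C + 5) by lra.
  have e'0 : 0 < e' by rewrite lt_min ltr01 divr_gt0// exprn_gt0.
  have := nbhs_mulgr g (tame_kpart cQ QG ioM cio pM cp pio cf0 ef0 e'0).
  apply: filterS => x /= /(_ _ tf) hx.
  set k := kpart io p (x * g^-1)%g in hx.
  have xE : x = (io (p (x * g^-1)) * (k * g))%g by rewrite mulgA -kpartE mulgVK.
  rewrite [in ltLHS]xE inv.
  have close h : d (y g h) (y (k * g)%g h) <= e'.
    by rewrite /y mulgA (ioC _ (pk _)) -mulgA metric_sym; exact: hx.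
  have hC' h : d (y g 1%g) (y g h) <= C + 2 * e' by have := hC h; lra.
  have hCk h : d (y (k * g)%g 1%g) (y (k * g)%g h) <= C + 2 * e'.
    apply: le_trans (metric_triangle _ (y g 1%g) _) _.
    have := close 1%g; have := close h; rewrite (metric_sym (y _ _) (y (k * g)%g 1%g)).
    have := metric_triangle (y g 1%g) (y g h) (y (k * g)%g h); have := hC h; lra.
  have h1 := circumcenter_close hC' hCk close (f'P g) (f'P (k * g)%g).
  have h2 : e' <= 1 by rewrite ge_min lexx.
  have h3 : e' * (2 * (2 * C + 5)) <= e ^+ 2.
    by rewrite -ler_pdivlMr// ge_min lexx orbT.
  have e20 : 0 < e ^+ 2 by rewrite exprn_gt0.
  have h4 : d (f' g) (f' (k * g)%g) ^+ 2 < e ^+ 2 by nra.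
  by rewrite -(ltr_pXn2r (n := 2)) ?nnegrE ?mdist_ge0// ltW.
- move=> g h Gh; apply: f'E.
  have mh x : m h (m h^-1%g x) = x by rewrite -(mM _ Gh (subgroupV Gh)) mulgV m1.
  have vh z' : sup_sqr (y (g * h)%g) z' = sup_sqr (y g) (m h z').
    have vt h' : d z' (y (g * h)%g h') = d (m h z') (y g h').
      by rewrite /y mulgA ef// -(isometric_mapP (m h) z') mh.
    rewrite /sup_sqr.
    have -> // : (fun t => d z' (y (g * h)%g t) ^+ 2) = (fun t => d (m h z') (y g t) ^+ 2).
    by apply/funext => t; rewrite vt.
  by move=> z; rewrite !vh mh -(isometric_mapP (m h) z) mh; exact: f'P.
- move=> k pk1 fk g; apply: f'E; suff -> : y (k * g)%g = y g by exact: f'P.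
  apply/funext => h; rewrite /y mulgA (ioC _ pk1) -mulgA; apply: mdist_positivity.
  apply/eqP; rewrite eq_le mdist_ge0 andbT; apply: tf => // g'.
  by rewrite fk mdistxx.
Qed.

End BoundedOrbit.

(** * Unbounded orbits: isometric action on the hull *)

Section UnboundedOrbit.
Hypothesis pdense : dense (p @` (Gm : set G)).
Hypothesis rigid : forall u u' k, p k = 1%g ->
  d (ev io u f (k * g0)%g) (ev io u' f (k * g0)%g) = d (ev io u f g0) (ev io u' f g0).

Lemma ev_admissible u : admissible Gam m p f0 (ev io u f).
Proof. exact: admissible_ev. Qed.

(** For [a] in Gamma, [g0 * a] equals [kpart x * io h * g0] with [h] the conjugate of [p a] by
    [p g0]. Equivariance under [a] and rigidity along the kernel give the claim at [h]; such [h] are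
    dense, and both sides are continuous. *)
Lemma ev_isometry u u' q :
  d (ev io u f (io q * g0)%g) (ev io u' f (io q * g0)%g) = d (ev io u f g0) (ev io u' f g0).
Proof.
pose phi q := d (ev io u f (io q * g0)%g) (ev io u' f (io q * g0)%g).
have cphi : continuous phi.
  move=> q'; have h : (fun q => (io q * g0)%g) @ q' --> (io q' * g0)%g.
    by apply: cvg_mulg; [exact: cio|exact: cvg_cst].
  have [c1 _ _] := ev_admissible u; have [c2 _ _] := ev_admissible u'.
  by apply: cvg_mdist; (apply: cvg_comp; [exact: h|]); [exact: c1|exact: c2].
rewrite -/(phi q); apply/eqP; rewrite -subr_eq0 -normr_le0; apply/ler_addgt0Pl => e e0.
rewrite addr0.
have n1 : \forall q' \near q, `|phi q - phi q'| < e.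
  by have /cvgrPdist_lt/(_ _ e0) := cphi q.
pose v := p g0.
have n2 : nbhs (v^-1 * q * v)%g [set z | `|phi q - phi (v * z * v^-1)%g| < e].
  have h : (fun z => (v * z * v^-1)%g) @ (v^-1 * q * v)%g --> (v * (v^-1 * q * v) * v^-1)%g.
    by apply: cvg_mulg; [apply: cvg_mulg; [exact: cvg_cst|exact: cvg_id]|exact: cvg_cst].
  rewrite !mulgA mulgV mul1g mulgK in h.
  exact: h _ n1.
have [z [/interior_subset hz [a Ga za]]] := pdense
  (ex_intro _ _ (nbhs_singleton (nbhs_interior n2))) (@open_interior _ _).
move: hz; rewrite /= -{}za => hz.
suff <- : phi (v * p a * v^-1)%g = d (ev io u f g0) (ev io u' f g0) by exact: ltW.
set h := (v * p a * v^-1)%g.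
pose x := (g0 * a * g0^-1)%g.
have px : p x = h by rewrite /x !pM (pV pM).
have e1 u1 : ev io u1 f (g0 * a)%g = ev io (wmul u1 h) f (kpart io p x * g0)%g.
  rewrite ev_wmul//; congr ev; rewrite mulgA -px -kpartE /x mulgVK.
  by [].
have [_ eu _] := ev_admissible u; have [_ eu' _] := ev_admissible u'.
rewrite -(equivariant_mdist g0 eu eu' Ga) !e1 rigid// !ev_wmul//.
Qed.

Let E u := ev io u f g0.
(** The inverse turns right multiplication of words, [wmul], into a left action of [H]. *)
Let T q u := ev io u f (io q^-1 * g0)%g.

Let TE q u : T q u = E (wmul u q^-1%g).
Proof. by rewrite /T /E ev_wmul. Qed.

Let dT q u u' : d (T q u) (T q u') = d (E u) (E u'). Proof. exact: ev_isometry. Qed.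

Definition orbit_hull : set X := closure (range E).
Local Notation Y := orbit_hull.

Lemma orbit_hullP y : Y y <-> forall e, 0 < e -> exists u, d y (E u) < e.
Proof.
split=> [h e e0|h B].
  have n1 : nbhs y [set z | d y z < e] by have /mcvgP := @cvg_id _ (nbhs y); exact.
  by have [_ [[u _ <-] hu]] := h _ n1; exists u.
move=> /(@metric_structure.metricType_numDomainType.nbhs_mdistP)[e e0 hB].
have [u hu] := h e e0; exists (E u); split; first by exists u.
exact: hB.
Qed.

(* [z] is the image of [y] under the isometry sending each [E u] to [T q u]. *)
Definition extends_by q y z := forall u, d z (T q u) = d y (E u).

(** If [E (un k)] tends to [y], the points [T q (un k)] stay bounded because [T q] preserves the
    distances of [E]; properness gives their ultralimit. *)
Lemma extends_by_exists q y : Y y -> exists z, extends_by q y z.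
Proof.
move=> /orbit_hullP hy.
have [un hun] : {un : nat -> word R H & forall n, d y (E (un n)) < n.+1%:R^-1}.
  by apply: (@choice nat _ (fun n u => d y (E u) < n.+1%:R^-1)) => n; apply: hy; rewrite invr_gt0.
have [U UU hU] : exists2 U : set_system nat, UltraFilter U & forall n, U [set k | (n <= k)%N].
  apply: ultra_fip => s; exists (\big[maxn/0]_(n <- s) n)%N => n ns.
  suff : (n <= \big[maxn/0]_(n <- s) n)%N by [].
  elim: s ns => [//|a s IH] [->|/IH h]; rewrite big_cons leq_max ?leqnn//.
  by rewrite h orbT.
have small (e : R) : 0 < e -> U [set k | d y (E (un k)) < e].
  move=> e0; apply: filterS (hU (Num.truncn e^-1)) => k /= hk.
  apply: lt_le_trans (hun k) _; rewrite invf_ple ?posrE//.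
  apply: ltW; apply: lt_le_trans (truncnS_gt _) _; by rewrite ler_nat ltnS.
have [|z _ hz] := @proper_ultra_cvg _ _ _ U UU (fun k => T q (un k)) (T q (un 0%N)) (1 + 1) XP.
  apply: filterS (small _ ltr01) => k /= hk; rewrite dT.
  apply: le_trans (metric_triangle _ y _) _; rewrite lerD//; last exact: ltW.
  by rewrite metric_sym; apply: le_trans (ltW (hun 0%N)) _; rewrite invr1.
exists z => u.
have c1 : (fun k => d (T q (un k)) (T q u)) @ U --> d z (T q u).
  by apply: cvg_mdist => //; exact: cvg_cst.
have c2 : (fun k => d (T q (un k)) (T q u)) @ U --> d y (E u).
  under eq_fun do rewrite dT.
  apply: cvg_mdist; last exact: cvg_cst.
  by apply/mcvgP.
exact: (cvg_unique _ c1 c2).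
Qed.

Lemma extends_by_uniq q y z z' : Y y -> extends_by q y z -> extends_by q y z' -> z = z'.
Proof.
move=> /orbit_hullP hy hz hz'; apply: mdist_positivity; apply/eqP.
rewrite eq_le mdist_ge0 andbT; apply/ler_addgt0Pl => e e0; rewrite addr0.
have [|u hu] := hy (e / 2); first by rewrite divr_gt0.
apply: le_trans (metric_triangle _ (T q u) _) _.
by rewrite hz metric_sym hz'; lra.
Qed.

Definition hull_act q y := xget y (extends_by q y).

Lemma hull_actP q y : Y y -> extends_by q y (hull_act q y).
Proof. by move=> /(extends_by_exists q)[z hz]; apply: (@xgetPex _ y (extends_by q y));
  exists z. Qed.

Lemma hull_act_eq q y z : Y y -> extends_by q y z -> hull_act q y = z.
Proof. by move=> Yy; apply: extends_by_uniq => //; exact: hull_actP. Qed.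

Lemma orbit_hull_E u : Y (E u).
Proof. by apply/orbit_hullP => e e0; exists u; rewrite mdistxx. Qed.

Lemma hull_act_stable q y : Y y -> Y (hull_act q y).
Proof.
move=> Yy; apply/orbit_hullP => e e0; have [u hu] := (orbit_hullP y).1 Yy e e0.
by exists (wmul u q^-1%g); rewrite -TE hull_actP.
Qed.

Lemma hull_act_isometry q y y' : Y y -> Y y' -> d (hull_act q y) (hull_act q y') = d y y'.
Proof.
move=> Yy Yy'; apply/eqP; rewrite -subr_eq0 -normr_le0; apply/ler_addgt0Pl => e e0; rewrite addr0.
have [|u hu] := (orbit_hullP y').1 Yy' (e / 2); first by rewrite divr_gt0.
have h1 := ler_mdist_mdist (hull_act q y) (hull_act q y') (hull_act q y) (T q u).
have h2 := ler_mdist_mdist y (E u) y y'.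
rewrite !mdistxx !add0r !hull_actP// (metric_sym (E u)) in h1 h2.
move: h1 h2; rewrite !ler_norml; lra.
Qed.

Lemma orbit_hull_convex : gpt_convex Y.
Proof.
move=> y y' t /orbit_hullP hy /orbit_hullP hy'; apply/orbit_hullP => e e0.
have e2 : 0 < e / 2 by rewrite divr_gt0.
have [u hu] := hy _ e2; have [u' hu'] := hy' _ e2.
exists (Node u u' t); apply: (@le_lt_trans _ _ (e / 2)); last by lra.
by apply: (mdist_gpt_max XC); exact: ltW.
Qed.

Lemma hull_actM q q' y : Y y -> hull_act (q * q')%g y = hull_act q (hull_act q' y).
Proof.
move=> Yy; apply: hull_act_eq => // u; have Yq : Y (hull_act q' y) by exact: hull_act_stable.
have -> : T (q * q')%g u = T q (wmul u q'^-1%g).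
  by rewrite /T ev_wmul// mulgA -ioM invgM.
by rewrite hull_actP// -TE hull_actP.
Qed.

Lemma hull_act1 y : Y y -> hull_act 1%g y = y.
Proof.
by move=> Yy; apply: hull_act_eq => // u; rewrite /T invg1 (io1 ioM) mul1g.
Qed.

Lemma hull_act_continuous y : Y y -> continuous (fun q => hull_act q y).
Proof.
move=> Yy q; apply/mcvgP => e e0.
have e3 : 0 < e / 3 by rewrite divr_gt0.
have [u hu] := (orbit_hullP y).1 Yy _ e3.
have cT : (fun q => T q u) @ q --> T q u.
  have [c1 _ _] := ev_admissible u; apply: cvg_comp; last exact: c1.
  apply: cvg_mulg; last exact: cvg_cst.
  by apply: cvg_comp; [apply: cvg_invg; exact: cvg_id|exact: cio].
move/mcvgP/(_ _ e3): cT; apply: filterS => q' hq'.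
have h1 := hull_actP q Yy u; have h2 := hull_actP q' Yy u.
apply: le_lt_trans (metric_triangle _ (T q u) _) _.
have := metric_triangle (T q u) (T q' u) (hull_act q' y).
rewrite (metric_sym (T q' u)); lra.
Qed.

(** The action of [a] replaces [g0] by [g0 * a^-1], which is [io q^-1 * g0] up to the fixed kernel
    element [kpart x]. All words are tame, so this element moves them by a common bound. *)
Lemma hull_act_near a : Gm a -> exists B, forall y, Y y ->
  d (m a y) (hull_act (p g0 * p a * (p g0)^-1)%g y) <= B.
Proof.
move=> Ga; set q := (_ * _)%g; pose x := (g0 * a^-1 * g0^-1)%g.
have px : p x = q^-1%g by rewrite /x !pM !(pV pM) /q !invgM invgK mulgA.
have [B B0 hB] := tame_bounded (pk x); exists B => y Yy.
apply/ler_addgt0Pl => e e0; have e2 : 0 < e / 2 by rewrite divr_gt0.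
have [u hu] := (orbit_hullP y).1 Yy _ e2.
have [_ eu tu] := ev_admissible u.
have h1 : d (m a (E u)) (T q u) <= B.
  have -> : m a (E u) = ev io u f (g0 * a^-1)%g by rewrite eu ?invgK//; exact: subgroupV.
  have -> : (g0 * a^-1 = kpart io p x * (io q^-1 * g0))%g.
    by rewrite mulgA -(ioC _ (pk x)) -px -kpartE /x mulgVK.
  exact: hB.
have h2 := metric_triangle (m a y) (m a (E u)) (hull_act q y).
have h3 := metric_triangle (m a (E u)) (T q u) (hull_act q y).
rewrite isometric_mapP in h2; rewrite (metric_sym (T q u)) hull_actP// in h3; lra.
Qed.

Lemma unbounded_boundary_action (A : Type) (al : A -> G) : (forall a, Gm (al a)) ->
  (forall r, exists h, r <= d (f g0) (f (io h * g0)%g)) ->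
  exists C : set (boundary X), [/\ C !=set0, closed C,
    (forall a, boundary_map (m (al a)) @` C = C) &
    exists b : H -> C -> C, continuous_action b /\
      forall a (xi : C), val (b (p (al a)) xi) = boundary_map (m (al a)) (val xi)].
Proof.
move=> Gal far; pose v := p g0.
have y0E : f g0 = E (Leaf 1%g) by rewrite /E /= (io1 ioM) mul1g.
have [||C [C0 clC mC [b [cb bE]]]] := @boundary_extension R X XC XP H A (fun a => m (al a))
  (fun a => v * p (al a) * v^-1)%g Y (f g0) hull_act (@closed_closure _ _) orbit_hull_convex _ _
  hull_act_stable hull_act1 hull_actM hull_act_isometry hull_act_continuous
  (fun a => hull_act_near (Gal a)).
- by rewrite y0E; exact: orbit_hull_E.
- by move=> r; have [h hr] := far r; exists (E (Leaf h)) => //; exact: orbit_hull_E.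
(* Precomposing with conjugation by [v] makes the action of Gamma factor through [p] itself. *)
exists C; split=> //; exists (fun h => b (v * h * v^-1)%g); split; last by move=> a xi; exact: bE.
have [[b1 bM] bc] := cb; split; first split.
- by move=> xi; rewrite mulg1 mulgV.
- by move=> h h' xi; rewrite -bM; congr b; rewrite !mulgA mulgVK.
move=> z.
have h1 : (fun z : H * C => (v * z.1 * v^-1)%g) @ z --> (v * z.1 * v^-1)%g.
  by apply: cvg_mulg; [apply: cvg_mulg; [exact: cvg_cst|exact: cvg_fst]|exact: cvg_cst].
have h2 : (fun z : H * C => z.2) @ z --> z.2 by exact: cvg_snd.
exact: (cvg_comp _ _ (cvg_pair h1 h2) (bc ((v * z.1 * v^-1)%g, z.2))).
Qed.

End UnboundedOrbit.
End Orbit.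

(** * Products *)

Lemma factor_action_or_invariant (R : realType) (X : metricType R) (G H : topologicalGroupType)
    (Gam : subgroup G) (m : G -> isometric_map X) (Q : set G) (io : H -> G) (p : G -> H)
    (f0 : G -> X) (K : set G) (M : (G -> R) -> R) (x0 : X) (S0 : seq G) (kap K0 : R)
    (A : Type) (al : A -> G) :
  is_CAT0 X -> is_proper X ->
  (forall x, m 1%g x = x) ->
  (forall g h x, subgroup_set Gam g -> subgroup_set Gam h -> m (g * h)%g x = m g (m h x)) ->
  compact Q -> (forall g, exists2 x, Q x & subgroup_set Gam (x^-1 * g)%g) ->
  (forall a b, io (a * b)%g = (io a * io b)%g) -> continuous io ->
  (forall a b, p (a * b)%g = (p a * p b)%g) -> continuous p ->
  (forall h, p (io h) = h) ->
  (forall h k, p k = 1%g -> (io h * k)%g = (k * io h)%g) ->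
  dense (p @` (Gam : set G)) ->
  locally_compact [set: G] -> hausdorff_space G -> nbhs 1%g K -> is_local_haar K M ->
  (forall a, List.In a S0 -> subgroup_set Gam a) -> 0 < kap ->
  (forall z, K0 <= mdist x0 z -> exists2 a, List.In a S0 & kap * mdist x0 z < mdist (m a z) z) ->
  (forall a, subgroup_set Gam (al a)) -> continuous f0 -> equivariant Gam m f0 ->
  (exists C : set (boundary X), [/\ C !=set0, closed C,
    (forall a, boundary_map (m (al a)) @` C = C) &
    exists b : H -> C -> C, continuous_action b /\
      forall a (xi : C), val (b (p (al a)) xi) = boundary_map (m (al a)) (val xi)]) \/
  exists f, [/\ continuous f, equivariant Gam m f, forall h g, f (io h * g)%g = f g &
    forall k, p k = 1%g -> (forall g, f0 (k * g)%g = f0 g) -> forall g, f (k * g)%g = f g].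
Proof.
move=> XC XP m1 mM cQ QG ioM cio pM cp pio ioC pd lcG hG nK HM GS0 kap0 disp Gal cf0 ef0.
have [f [g0 [af rigid]]] :=
  rigid_map XC XP m1 mM cQ QG ioM cio pM cp pio ioC cf0 ef0 lcG hG nK HM GS0 kap0 disp.
have [[B hB]|nB] := pselect (exists B, forall h, mdist (f g0) (f (io h * g0)%g) <= B).
  right; exact: (invariant_map XC XP m1 mM cQ QG ioM cio pM cp pio ioC cf0 ef0 af hB).
left; apply: (unbounded_boundary_action XC XP cQ QG ioM cio pM pio ioC cf0 ef0 af pd rigid Gal).
move=> r; apply: contrapT => h; apply: nB; exists r => q; rewrite leNgt; apply/negP => hq.
by apply: h; exists q; exact: ltW.
Qed.

Section Product.
Variables (n : nat) (G : 'I_n -> topologicalGroupType).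
Local Notation PG := (prod_group G).

Definition embed (i : 'I_n) (h : G i) : PG := @dfwith 'I_n G (fun j => 1%g) i h.

Lemma embed_in i h : embed h i = h. Proof. exact: dfwithin. Qed.

Lemma embed_out i (h : G i) j : i != j -> embed h j = 1%g. Proof. exact: dfwithout. Qed.

Lemma embedM i (a b : G i) : embed (a * b)%g = (embed a * embed b)%g.
Proof.
apply: functional_extensionality_dep => j.
change (embed (a * b)%g j = (embed a j * embed b j)%g).
by have [<-|ij] := eqVneq i j; [rewrite !embed_in|rewrite !embed_out// mulg1].
Qed.

Lemma embed_continuous i : continuous (@embed i).
Proof. exact: (@dfwith_continuous 'I_n G (fun j => 1%g) i). Qed.

Lemma proj_group_continuous i : continuous (fun g : PG => g i).
Proof. exact: (@proj_continuous 'I_n G i). Qed.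

Lemma embedC i (h : G i) (k : PG) : k i = 1%g -> (embed h * k)%g = (k * embed h)%g.
Proof.
move=> ki; apply: functional_extensionality_dep => j.
change ((embed h j * k j)%g = (k j * embed h j)%g).
by have [<-|ij] := eqVneq i j; [rewrite ki mulg1 mul1g|rewrite embed_out// mulg1 mul1g].
Qed.

Lemma prod_group_hausdorff : (forall i, hausdorff_space (G i)) -> hausdorff_space PG.
Proof. exact: hausdorff_product. Qed.

Lemma prod_group_locally_compact : (forall i, hausdorff_space (G i)) ->
  (forall i, locally_compact [set: G i]) -> locally_compact [set: PG].
Proof.
move=> hG lcG g _.
have hex i : exists K, nbhs (g i) K /\ compact K.
  by have [K [? ? _]] := locally_compact_nbhs (g i) (lcG i); exists K.
pose K i := sval (cid (hex i)).
have hK i : nbhs (g i) (K i) /\ compact (K i) := svalP (cid (hex i)).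
have cK : compact [set f : PG | forall i, K i (f i)].
  by apply: (@tychonoff 'I_n G) => i; exact: (hK i).2.
exists [set f : PG | forall i, K i (f i)]; last first.
  by split=> //; apply: compact_closed => //; exact: prod_group_hausdorff.
(* The index set is finite, so this product of neighbourhoods is a neighbourhood. *)
have h : \forall f \near g, forall i, K i (f i).
  apply: (@filter_forall PG 'I_n (fun i f => K i (f i)) (nbhs g)) => i.
  exact: (@proj_group_continuous i g _ (hK i).1).
by rewrite /within /=; apply: filterS h => f hf _.
Qed.

End Product.

(** * Induction over the factors *)

Section Assembly.
Variables (R : realType) (n : nat) (n_gt0 : (0 < n)%N) (G : 'I_n -> topologicalGroupType).
Hypotheses (hG : forall i, hausdorff_space (G i))
  (lcG : forall i, locally_compact [set: G i]).
Variable Gamma : subgroup (prod_group G).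
Hypotheses (Gl : is_lattice Gamma R) (Gu : is_uniform Gamma) (Gi : is_irreducible Gamma).
Variable X : metricType R.
Hypotheses (X0 : [set: X] !=set0) (XC : is_CAT0 X) (XP : is_proper X).
Variable rho : Gamma -> isometric_map X.
Hypothesis (ra : is_group_action (fun (g : Gamma) (x : X) => rho g x)).
Local Notation PG := (prod_group G).

Definition factor_action (C : set (boundary X)) := exists (i : 'I_n) (b : G i -> C -> C),
  continuous_action b /\
  forall (g : Gamma) (xi : C), val (b (val g i) xi) = boundary_map (rho g) (val xi).

Lemma factor_action_extends C : factor_action C -> exists alpha : PG -> C -> C,
  [/\ continuous_action alpha,
      (forall (g : Gamma) (xi : C), val (alpha (val g) xi) = boundary_map (rho g) (val xi)) &
      exists (i : 'I_n) (beta : G i -> C -> C),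
        continuous_action beta /\ forall (g : PG) (xi : C), alpha g xi = beta (g i) xi].
Proof.
move=> [i [b [cb bE]]]; exists (fun g => b (g i)); split=> //; last by exists i, b.
have [[b1 bM] bc] := cb; split; first by split=> [xi|g h xi]; [exact: b1|exact: bM].
move=> z.
have h1 : (fun z : PG * C => z.1 i) @ z --> z.1 i.
  apply: (@cvg_comp _ _ _ (fun z : PG * C => z.1) (fun g : PG => g i) (nbhs z) (nbhs z.1)).
    exact: cvg_fst.
  exact: proj_group_continuous.
have h2 : (fun z : PG * C => z.2) @ z --> z.2 by exact: cvg_snd.
exact: (cvg_comp _ _ (cvg_pair h1 h2) (bc (z.1 i, z.2))).
Qed.

(** The trivial action on a point factors through any projection; [n_gt0] provides one. *)
Lemma fixed_factor_action xi : (forall g, boundary_map (rho g) xi = xi) ->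
  [/\ [set xi] !=set0, closed [set xi],
    (forall g, boundary_map (rho g) @` [set xi] = [set xi]) & factor_action [set xi]].
Proof.
move=> fx; split.
- by exists xi.
- exact: closed_boundary1.
- by move=> g; rewrite image_set1 fx.
exists (Ordinal n_gt0), (fun _ => id); split.
  split=> // z.
  have h : (fun z : G (Ordinal n_gt0) * set_type [set xi] => z.2) @ z --> z.2 by exact: cvg_snd.
  exact: h.
by move=> g [eta /=] /set_mem /= ->; rewrite fx.
Qed.

(** The earlier sections take [m] on the whole group but constrain it on Gamma only; the identity
    off Gamma is a default value. *)
Definition total_action (g : PG) : isometric_map X :=
  if pselect (subgroup_set Gamma g) is left h
  then rho (exist (fun g => g \in (Gamma : set PG)) g (mem_set h))
  else IsometricMap (fun x y => erefl).

Lemma total_actionE (g : Gamma) : total_action (val g) = rho g.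
Proof.
rewrite /total_action; case: pselect => [h|]; last by move: (set_mem (valP g)).
by congr rho; exact: val_inj.
Qed.

Lemma total_action1 x : total_action 1%g x = x.
Proof.
have -> : (1 : PG)%g = val (1%g : Gamma) by [].
by rewrite total_actionE; exact: ra.1.
Qed.

Lemma total_actionM g h x : subgroup_set Gamma g -> subgroup_set Gamma h ->
  total_action (g * h)%g x = total_action g (total_action h x).
Proof.
move=> Gg Gh.
pose g' : Gamma := exist (fun g => g \in (Gamma : set PG)) g (mem_set Gg).
pose h' : Gamma := exist (fun g => g \in (Gamma : set PG)) h (mem_set Gh).
have -> : (g * h)%g = val (g' * h')%g by [].
have -> : g = val g' by []. have -> : h = val h' by [].
by rewrite !total_actionE; exact: ra.2.
Qed.


(** [g] is built from 1 by changing one coordinate at a time: [g_ j] agrees with [g] on the first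
    [j] coordinates. *)
Lemma embed_invariant_const (f : PG -> X) :
  (forall i (h : G i) g, f (embed h * g)%g = f g) -> forall g, f g = f 1%g.
Proof.
move=> inv g.
pose g_ (j : nat) : PG := fun i : 'I_n => if (i < j)%N then g i else 1%g.
have step j : f (g_ j) = f 1%g.
  elim: j => [|j IH]; first by congr f; apply: functional_extensionality_dep => i.
  have [jn|nj] := ltnP j n.
    rewrite -IH -(inv (Ordinal jn) (g (Ordinal jn)) (g_ j)); congr f.
    apply: functional_extensionality_dep => i.
    change (g_ j.+1 i = (embed (g (Ordinal jn)) i * g_ j i)%g).
    have [<-|ij] := eqVneq (Ordinal jn) i.
      by rewrite embed_in /g_ /= ltnSn ltnn mulg1.
    rewrite embed_out// mul1g /g_ ltnS leq_eqVlt; case: eqP => //= e.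
    by move: ij; rewrite -val_eqE /= e eqxx.
  rewrite -IH; congr f; apply: functional_extensionality_dep => i; rewrite /g_.
  by have ij := leq_trans (ltn_ord i) nj; rewrite ij ltnS ltnW.
rewrite -(step n); congr f; apply: functional_extensionality_dep => i.
by rewrite /g_ ltn_ord.
Qed.

Lemma factor_action_exists : (~ exists x : X, forall g : Gamma, rho g x = x) ->
  exists C : set (boundary X), [/\ C !=set0, closed C,
    (forall g : Gamma, boundary_map (rho g) @` C = C) & factor_action C].
Proof.
move=> nofix; have [x0 _] := X0.
have [[xi fx]|[s [kap [K0 [kap0 disp]]]]] := fixed_point_at_infinity_or_displacement XC XP rho x0.
  by exists [set xi]; exact: fixed_factor_action.
have hPG : hausdorff_space PG by exact: prod_group_hausdorff.
have lcPG : locally_compact [set: PG] by exact: prod_group_locally_compact.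
have [dG [mu [muT muI]]] := Gl.
have [Q cQ QG] := uniform_fundamental_set lcPG Gu.
have [K [M [nK HM]]] := local_haar_exists muT muI Gu lcPG hPG dG.
have valG (a : Gamma) : subgroup_set Gamma (val a) := set_mem (valP a).
pose m := total_action.
have mE a : m (val a) = rho a := total_actionE a.
have GS0 a : List.In a (map val s) -> subgroup_set Gamma a.
  by move=> /List.in_map_iff[b [<- _]]; exact: valG.
have disp' z : K0 <= mdist x0 z ->
    exists2 a, List.In a (map val s) & kap * mdist x0 z < mdist (m a z) z.
  move=> /disp[a sa ha]; exists (val a); last by rewrite mE.
  by apply/List.in_map_iff; exists a.
apply: contrapT => none.
have step j : (j <= n)%N -> exists f : PG -> X, [/\ continuous f, equivariant Gamma m f &
    forall (i : 'I_n) (h : G i) g, (i < j)%N -> f (embed h * g)%g = f g].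
  elim: j => [_|j IH jn].
    have [f [cf ef]] := equivariant_exists XC XP total_action1 total_actionM lcPG hPG dG cQ QG x0.
    by exists f; split.
  have [f0 [cf0 ef0 inv0]] := IH (ltnW jn).
  pose i := Ordinal jn.
  have pd : dense [set g i | g in (Gamma : set PG)] by exact: Gi.
  have [[C [C0 clC mC [b [cb bE]]]]|[f [cf ef inv fk]]] := factor_action_or_invariant
    (p := fun g : PG => g i) XC XP total_action1 total_actionM cQ QG (@embedM n G i)
    (@embed_continuous n G i) (fun _ _ => erefl) (@proj_group_continuous n G i) (@embed_in n G i)
    (@embedC n G i) pd lcPG hPG nK HM GS0 kap0 disp' valG cf0 ef0.
    exfalso; apply: none; exists C; split => //.
      by move=> g; rewrite -mE.
    by exists i, b; split=> // g xi; rewrite bE -/m mE.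
  exists f; split=> // i' h g; rewrite ltnS leq_eqVlt => /orP[/eqP ij|ij].
    have e : i' = i by exact: val_inj.
    by move: h; rewrite e => h; exact: inv.
  (* The earlier factors lie in the kernel of the projection to [i], and [f0] is invariant under
     them; [f] inherits this. *)
  apply: fk; last by move=> g'; exact: inv0.
  by apply: embed_out; rewrite -val_eqE /= ltn_eqF.
have [f [cf ef inv]] := step n (leqnn n).
have const := embed_invariant_const (fun i h g => inv i h g (ltn_ord i)).
(* Equivariance at 1 for [a^-1] says that [f a^-1] is [m a (f 1)]; as [f] is constant, its value is
   a fixed point. *)
apply: nofix; exists (f 1%g) => a; rewrite -mE.
have Ga := subgroupV (valG a).
by have := ef 1%g _ Ga; rewrite invgK const.
Qed.

End Assembly.

Theorem theorem2 (R : realType) (n : nat) (n_gt0 : (0 < n)%N)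
    (G : 'I_n -> topologicalGroupType)
    (G_hausdorff : forall i, hausdorff_space (G i))
    (G_locally_compact : forall i, locally_compact [set: G i])
    (G_sigma_compact : forall i, sigma_compact (G i))
    (Gamma : subgroup (prod_group G))
    (Gamma_lattice : is_lattice Gamma R)
    (Gamma_uniform : is_uniform Gamma)
    (Gamma_irreducible : is_irreducible Gamma)
    (X : metricType R)
    (X_nonempty : [set: X] !=set0)
    (X_CAT0 : is_CAT0 X)
    (X_proper : is_proper X)
    (rho : Gamma -> isometric_map X)
    (rho_action : is_group_action (fun (g : Gamma) (x : X) => rho g x))
    (rho_nofix : ~ exists x : X, forall g : Gamma, rho g x = x) :
  exists C : set (boundary X),
    [/\ C !=set0,
        closed C,
        (forall g : Gamma, boundary_map (rho g) @` C = C) &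
        exists alpha : prod_group G -> C -> C,
          [/\ continuous_action alpha,
              (forall (g : Gamma) (xi : C),
                 val (alpha (val g) xi) = boundary_map (rho g) (val xi)) &
              exists (i : 'I_n) (beta : G i -> C -> C),
                continuous_action beta /\
                forall (g : prod_group G) (xi : C), alpha g xi = beta (g i) xi]].
Proof.
have [C [C0 clC mC /factor_action_extends aC]] := factor_action_exists n_gt0 G_hausdorff
  G_locally_compact Gamma_lattice Gamma_uniform Gamma_irreducible X_nonempty X_CAT0 X_proper
  rho_action rho_nofix.
exists C; split=> //.
Qed.
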